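(* Let $\mathbb{F}$ be a field with $\mathrm{ch}\,\mathbb{F}\neq 2$. If $\mathrm{ch}\,\mathbb{F}\neq 7$, then, as modules for the Virasoro algebra $Vir_{\mathbb{F}}$, $V(H_{\mathbb{F}},\frac12+\mathbb{Z})_{\bar 0}$ is isomorphic to $L(\frac12,0)_{\mathbb{F}}$, $V(H_{\mathbb{F}},\frac12+\mathbb{Z})_{\bar 1}$ is isomorphic to $L(\frac12,\frac12)_{\mathbb{F}}$, and $V(H_{\mathbb{F}},\mathbb{Z})_{\bar s}$ is isomorphic to $L(\frac12,\frac1{16})_{\mathbb{F}}$ for $s=0,1$.
   Context: $\mathbb{F}$ is a field of characteristic different from $2$; rational numbers with denominator a power of $2$ are regarded as elements of $\mathbb{F}$. Virasoro algebra: $Vir_{\mathbb{F}}=\bigoplus_{n\in\mathbb{Z}}\mathbb{F}L_n\oplus\mathbb{F}C$ with $[L_m,L_n]=(m-n)L_{m+n}+\frac{m^3-m}{12}\delta_{m+n,0}C$ and $C$ central (since $3\mid m^3-m$, $\frac{m^3-m}{12}=\frac14\cdot\frac{m^3-m}{3}$ makes sense in $\mathbb{F}$). Verma module: for $c,h\in\mathbb{F}$, $V(c,h)_{\mathbb{F}}=U(Vir_{\mathbb{F}})\otimes_{U(Vir_{\mathbb{F}}^{\ge 0})}\mathbb{F}$, where $Vir_{\mathbb{F}}^{\geq 0}$ is generated by $C$ and $L_n$, $n\ge 0$, and acts on $\mathbb{F}$ by $L_n1=0$ ($n>0$), $L_01=h$, $C1=c$. With $v_{c,h}=1\otimes 1$,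 it is graded, $V(c,h)_{\mathbb{F}}=\bigoplus_{n\ge0}V(c,h)_{\mathbb{F}}(n)$, $V(c,h)_{\mathbb{F}}(n)$ having basis $L_{-n_1}\cdots L_{-n_k}v_{c,h}$ with $n_1\ge\cdots\ge n_k\ge1$, $\sum n_i=n$. $W(c,h)_{\mathbb{F}}$ is the unique maximal (proper) graded submodule and $L(c,h)_{\mathbb{F}}=V(c,h)_{\mathbb{F}}/W(c,h)_{\mathbb{F}}$, the irreducible highest weight module. Fermionic modules: for $Z=\mathbb{Z}$ or $Z=\mathbb{Z}+\frac12$, $H_{\mathbb{F}}=\mathbb{F}a$ with $(a,a)=1$, let $A(H_{\mathbb{F}},Z)$ be the associative $\mathbb{F}$-algebra generated by $a(n)$, $n\in Z$, with relations $a(m)a(n)+a(n)a(m)=\delta_{m+n,0}$. Let $A(H_{\mathbb{F}},Z)_+$ be the subalgebra generated by $a(n)$, $n>0$, acting on $\mathbb{F}$ by $a(n)1=0$, and $V(H_{\mathbb{F}},Z)=A(H_{\mathbb{F}},Z)\otimes_{A(H_{\mathbb{F}},Z)_+}\mathbb{F}$. It has basis the monomials $a(-n_1)\cdots a(-n_k)\mathbf 1$ with $n_1>\cdots>n_k\ge 0$, $n_i\in Z$, and $V(H_{\mathbb{F}},Z)_{\bar s}$ ($s=0,1$) is the span of those monomials with $k\equiv s \pmod 2$. Virasoro action on $V(H_{\mathbb{F}},Z)$: put $:\!a(m)a(n)\!:\,=a(m)a(n)$ if $m\le n$ and $=-a(n)a(m)$ if $m>n$. Then $C$ acts as $\frac12$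 and $L_n$ acts as $\frac12\sum_{j\in Z}j:\!a(-j)a(n+j)\!:$ if $Z=\mathbb{Z}+\frac12$ or $n\neq0$, while for $Z=\mathbb{Z}$, $L_0$ acts as $\frac1{16}+\frac12\sum_{j\in\mathbb{Z}}j:\!a(-j)a(j)\!:$. Each $V(H_{\mathbb{F}},Z)_{\bar s}$ is stable under this action. *)

(* Defs.v *)
From HB Require Import structures.
From mathcomp Require Import all_boot all_order all_algebra generic_quotient.
From mathcomp Require Import finmap monalg.
From mathcomp Require Import boolp classical_sets functions cardinality fsbigop.
From mathcomp Require Import zify ring.
Set Implicit Arguments.
Unset Strict Implicit.
Unset Printing Implicit Defensive.
Import Order.TTheory GRing.Theory Num.Theory.
Local Open Scope ring_scope.
Local Open Scope quotient_scope.
Local Open Scope classical_set_scope.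

(* MathComp's lalgType and algType require 1 != 0, which a presentation by
   generators and relations does not guarantee a priori (for the integer
   index set, the algebra [clifford] below is 0 in characteristic 2); hence
   this class of unital associative algebras that may be zero. *)
HB.mixin Record isAssocAlgebra (F : fieldType) A of GRing.Lmodule F A := {
  aone : A;
  amul : A -> A -> A;
  amulA : associative amul;
  amul1r : left_id aone amul;
  amulr1 : right_id aone amul;
  amul_linearl : forall (a : F) (x y z : A),
    amul (a *: x + y) z = a *: amul x z + amul y z;
  amul_linearr : forall (a : F) (x y z : A),
    amul z (a *: x + y) = a *: amul z x + amul z y
}.

#[short(type="assocAlgType")]
HB.structure Definition AssocAlgebra (F : fieldType) :=
  {A of GRing.Lmodule F A & isAssocAlgebra F A}.

Reserved Notation "x ** y" (at level 40, left associativity).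
Notation "x ** y" := (amul x y) : ring_scope.

Section AssocAlgebraTheory.
Context {F : fieldType} {A : assocAlgType F}.
Implicit Types (a : F) (x y z : A).

Lemma amul0r x : 0 ** x = 0.
Proof.
by rewrite -[X in X ** x](addNr (0 : A)) -scaleN1r amul_linearl scaleN1r addNr.
Qed.

Lemma amulr0 x : x ** 0 = 0.
Proof.
by rewrite -[X in x ** X](addNr (0 : A)) -scaleN1r amul_linearr scaleN1r addNr.
Qed.

Lemma amulDl x y z : (x + y) ** z = x ** z + y ** z.
Proof. by rewrite -[x]scale1r amul_linearl !scale1r. Qed.

Lemma amulDr x y z : z ** (x + y) = z ** x + z ** y.
Proof. by rewrite -[x]scale1r amul_linearr !scale1r. Qed.

Lemma amulZl a x z : (a *: x) ** z = a *: (x ** z).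
Proof. by rewrite -[a *: x]addr0 amul_linearl amul0r addr0. Qed.

Lemma amulZr a x z : z ** (a *: x) = a *: (z ** x).
Proof. by rewrite -[a *: x]addr0 amul_linearr amulr0 addr0. Qed.

Lemma amulBl x y z : (x - y) ** z = x ** z - y ** z.
Proof. by rewrite amulDl -scaleN1r amulZl scaleN1r. Qed.

Lemma amulBr x y z : z ** (x - y) = z ** x - z ** y.
Proof. by rewrite amulDr -scaleN1r amulZr scaleN1r. Qed.

End AssocAlgebraTheory.

HB.mixin Record isLieAlgebra (F : fieldType) L of GRing.Lmodule F L := {
  lie : L -> L -> L;
  lie_linearl : forall (a : F) (x y z : L),
    lie (a *: x + y) z = a *: lie x z + lie y z;
  lie_linearr : forall (a : F) (x y z : L),
    lie z (a *: x + y) = a *: lie z x + lie z y;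
  liexx : forall x : L, lie x x = 0;
  lie_jacobi : forall x y z : L,
    lie x (lie y z) + lie y (lie z x) + lie z (lie x y) = 0
}.

#[short(type="lieAlgType")]
HB.structure Definition LieAlgebra (F : fieldType) :=
  {L of GRing.Lmodule F L & isLieAlgebra F L}.

Section Span.
Context {F : fieldType} {V : lmodType F}.

Inductive lspan (S : set V) : set V :=
| lspan_zero : lspan S 0
| lspan_gen x : S x -> lspan S x
| lspan_lin (a : F) u v : lspan S u -> lspan S v -> lspan S (a *: u + v).

Definition lspanb (S : set V) : V -> bool := fun x => `[< lspan S x >].

Lemma lspanbP (S : set V) x : reflect (lspan S x) (x \in lspanb S).
Proof. exact: asboolP. Qed.

Lemma lspanb_zmod_closed (S : set V) : zmod_closed (lspanb S).
Proof.
split; first by apply/lspanbP/lspan_zero.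
move=> u v /lspanbP Su /lspanbP Sv; apply/lspanbP.
by rewrite addrC -scaleN1r; apply: lspan_lin.
Qed.

HB.instance Definition _ (S : set V) :=
  GRing.isZmodClosed.Build V (lspanb S) (lspanb_zmod_closed S).

Lemma lspanZ (S : set V) (a : F) u : lspan S u -> lspan S (a *: u).
Proof. by move=> Su; rewrite -[_ *: _]addr0; apply/lspan_lin/lspan_zero. Qed.

End Span.

(* V / span S *)
Section LmodQuotient.
Context {F : fieldType} {V : lmodType F} (S : set V).

Definition lquot := Quotient.quot (GRing.ZmodClosed.clone V (lspanb S) _).

HB.instance Definition _ := GRing.Zmodule.on lquot.
HB.instance Definition _ := EqQuotient.on lquot.

Definition lpi (x : V) : lquot := \pi_lquot x.

Lemma lpiK (q : lquot) : lpi (repr q) = q.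
Proof. exact: reprK. Qed.

Lemma lpiP x y : lpi x = lpi y <-> lspan S (x - y).
Proof.
rewrite /lpi; split=> [/eqP|Sxy].
  by rewrite -Quotient.idealrBE => /lspanbP.
by apply/eqP; rewrite -Quotient.idealrBE; apply/lspanbP.
Qed.

Lemma lpiB x y : lpi (x - y) = lpi x - lpi y.
Proof. exact: (raddfB (\pi_lquot : {additive V -> lquot})). Qed.

Lemma lpiD x y : lpi (x + y) = lpi x + lpi y.
Proof. exact: (raddfD (\pi_lquot : {additive V -> lquot})). Qed.

Lemma lpi_repr x : lspan S (repr (lpi x) - x).
Proof. by apply/lpiP; rewrite lpiK. Qed.

Definition lquot_scale (a : F) (q : lquot) : lquot := lpi (a *: repr q).

Lemma lquot_scaleE a x : lquot_scale a (lpi x) = lpi (a *: x).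
Proof. by apply/lpiP; rewrite -scalerBr; apply/lspanZ/lpi_repr. Qed.

Fact lquot_scaleA a b q :
  lquot_scale a (lquot_scale b q) = lquot_scale (a * b) q.
Proof. by rewrite -[q]lpiK !lquot_scaleE scalerA. Qed.
Fact lquot_scale1 : left_id 1 lquot_scale.
Proof. by move=> q; rewrite -[q]lpiK !lquot_scaleE scale1r. Qed.
Fact lquot_scaleDr : right_distributive lquot_scale +%R.
Proof.
move=> a p q; rewrite -[p]lpiK -[q]lpiK.
by rewrite -lpiD !lquot_scaleE scalerDr lpiD.
Qed.
Fact lquot_scaleDl q : {morph lquot_scale^~ q : a b / a + b}.
Proof. by move=> a b; rewrite -[q]lpiK !lquot_scaleE scalerDl lpiD. Qed.

HB.instance Definition _ := GRing.Zmodule_isLmodule.Build F lquot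
  lquot_scaleA lquot_scale1 lquot_scaleDr lquot_scaleDl.

Lemma lpi_is_linear : linear lpi.
Proof. by move=> a x y; rewrite lpiD -lquot_scaleE. Qed.

HB.instance Definition _ := GRing.isLinear.Build F V lquot *:%R lpi
  lpi_is_linear.

End LmodQuotient.

(* A / (S), where (S) is the two-sided ideal generated by S *)
Section AlgQuotient.
Context {F : fieldType} {A : assocAlgType F} (S : set A).

Definition ideal_span : set A :=
  [set x | exists u s v, S s /\ x = u ** s ** v].

Lemma ideal_mull u x : lspan ideal_span x -> lspan ideal_span (u ** x).
Proof.
elim=> [|y [p [s [q [Ss ->]]]]|a y z _ IHy _ IHz].
- by rewrite amulr0; exact: lspan_zero.
- by apply: lspan_gen; exists (u ** p), s, q; rewrite !amulA.
- by rewrite amul_linearr; apply: lspan_lin.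
Qed.

Lemma ideal_mulr u x : lspan ideal_span x -> lspan ideal_span (x ** u).
Proof.
elim=> [|y [p [s [q [Ss ->]]]]|a y z _ IHy _ IHz].
- by rewrite amul0r; exact: lspan_zero.
- by apply: lspan_gen; exists p, s, (q ** u); rewrite !amulA.
- by rewrite amul_linearl; apply: lspan_lin.
Qed.

Definition aquot := lquot ideal_span.
HB.instance Definition _ := GRing.Lmodule.on aquot.

Definition api (x : A) : aquot := lpi ideal_span x.
HB.instance Definition _ := GRing.Linear.copy api (lpi ideal_span).

Lemma apiK (q : aquot) : api (repr q) = q.
Proof. exact: lpiK. Qed.

Definition aquot_mul (p q : aquot) : aquot := api (repr p ** repr q).

Lemma aquot_mulE x y : aquot_mul (api x) (api y) = api (x ** y).
Proof.
apply/lpiP; set x' := repr _; set y' := repr _.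
have -> : x' ** y' - x ** y = 1 *: (x' ** (y' - y)) + (x' - x) ** y.
  by rewrite scale1r amulBr amulBl addrA subrK.
by apply: lspan_lin; [apply: ideal_mull|apply: ideal_mulr]; apply: lpi_repr.
Qed.

Fact aquot_mulA : associative aquot_mul.
Proof.
move=> p q r; rewrite -[p]apiK -[q]apiK -[r]apiK.
by rewrite !aquot_mulE amulA.
Qed.
Fact aquot_mul1r : left_id (api aone) aquot_mul.
Proof. by move=> p; rewrite -[p]apiK aquot_mulE amul1r. Qed.
Fact aquot_mulr1 : right_id (api aone) aquot_mul.
Proof. by move=> p; rewrite -[p]apiK aquot_mulE amulr1. Qed.
Fact aquot_mul_linearl (a : F) (p q r : aquot) :
  aquot_mul (a *: p + q) r = a *: aquot_mul p r + aquot_mul q r.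
Proof.
rewrite -[p]apiK -[q]apiK -[r]apiK.
by rewrite -linearP !aquot_mulE -linearP amul_linearl.
Qed.
Fact aquot_mul_linearr (a : F) (p q r : aquot) :
  aquot_mul r (a *: p + q) = a *: aquot_mul r p + aquot_mul r q.
Proof.
rewrite -[p]apiK -[q]apiK -[r]apiK.
by rewrite -linearP !aquot_mulE -linearP amul_linearr.
Qed.

HB.instance Definition _ := isAssocAlgebra.Build F aquot
  aquot_mulA aquot_mul1r aquot_mulr1 aquot_mul_linearl aquot_mul_linearr.

Lemma apiM x y : api (x ** y) = api x ** api y.
Proof. by rewrite -aquot_mulE. Qed.

End AlgQuotient.

(* The free associative algebra on X: the algebra of the free monoid on X *)
Section FreeAlgebra.
Context (F : fieldType) (X : choiceType).

Definition freealg := {malg F[{fmonom X}]}.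
HB.instance Definition _ := GRing.Lalgebra.on freealg.

Definition fgen (x : X) : freealg := << fmu x >>.

Fact freealg_mul_linearl (a : F) (x y z : freealg) :
  (a *: x + y) * z = a *: (x * z) + y * z.
Proof. by rewrite mulrDl scalerAl. Qed.

Fact freealg_mul_linearr (a : F) (x y z : freealg) :
  z * (a *: x + y) = a *: (z * x) + z * y.
Proof.
rewrite mulrDr; congr (_ + _).
have Ca : z * a%:MP = a *: z :> freealg.
  rewrite [LHS]fgmulgU; apply: eq_bigr => m _.
  by rewrite mulm1 mulrC.
by rewrite -[a *: x]mul_malgC mulrA Ca scalerAl.
Qed.

HB.instance Definition _ := isAssocAlgebra.Build F freealg
  (@mulrA freealg) (@mul1r freealg) (@mulr1 freealg)
  freealg_mul_linearl freealg_mul_linearr.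

End FreeAlgebra.

(* Let B be the subalgebra of A generated by the first components of G, acting
   on the one-dimensional space F in such a way that b acts as the scalar l for
   every (b, l) in G. Then [acts_by G b l] says that b is in B and acts as l. *)
Section Induced.
Context {F : fieldType} {A : assocAlgType F} (G : set (A * F)).

Inductive acts_by : A -> F -> Prop :=
| acts_gen b l : G (b, l) -> acts_by b l
| acts_one : acts_by aone 1
| acts_lin (a : F) b l b' l' :
    acts_by b l -> acts_by b' l' -> acts_by (a *: b + b') (a * l + l')
| acts_mul b l b' l' :
    acts_by b l -> acts_by b' l' -> acts_by (b ** b') (l * l').

(* The induced module A (x)_B F: identifying A (x)_F F with A, it is the
   quotient of A by the span of the elements u b (x) 1 - u (x) (b 1). *)
Definition tensor_rel : set A :=
  [set x | exists u b l, acts_by b l /\ x = u ** b - l *: u].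

Definition ind_mod := lquot tensor_rel.
HB.instance Definition _ := GRing.Lmodule.on ind_mod.

Definition ind_vec : ind_mod := lpi tensor_rel aone.

Definition ind_act (u : A) (m : ind_mod) : ind_mod :=
  lpi tensor_rel (u ** repr m).

Lemma tensor_rel_mull u x : lspan tensor_rel x -> lspan tensor_rel (u ** x).
Proof.
elim=> [|y [p [b [l [bl ->]]]]|a y z _ IHy _ IHz].
- by rewrite amulr0; exact: lspan_zero.
- apply: lspan_gen; exists (u ** p), b, l.
  by rewrite amulBr amulA amulZr.
- by rewrite amul_linearr; apply: lspan_lin.
Qed.

Lemma ind_actE u x :
  ind_act u (lpi tensor_rel x) = lpi tensor_rel (u ** x).
Proof. by apply/lpiP; rewrite -amulBr; apply/tensor_rel_mull/lpi_repr. Qed.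

Lemma ind_act_linear u a m n :
  ind_act u (a *: m + n) = a *: ind_act u m + ind_act u n.
Proof.
rewrite -[m]lpiK -[n]lpiK.
by rewrite -linearP !ind_actE -linearP amul_linearr.
Qed.

End Induced.

Section EnvelopingAlgebra.
Context {F : fieldType} (L : lieAlgType F).

Definition env_rel : set (freealg F L) :=
  [set r | exists (a : F) (x y : L),
     r = fgen F (a *: x + y) - (a *: fgen F x + fgen F y)] `|`
  [set r | exists x y : L,
     r = fgen F x ** fgen F y - fgen F y ** fgen F x - fgen F (lie x y)].

Definition env := aquot env_rel.
HB.instance Definition _ := AssocAlgebra.on env.

Definition env_in (x : L) : env := api env_rel (fgen F x).

End EnvelopingAlgebra.

(* Linear extension of a family indexed by the basis K of {malg F[K]} *)
Section LinearExtension.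
Context {F : fieldType} {K : choiceType} {V : lmodType F}.

Definition lin_ext (f : K -> V) (x : {malg F[K]}) : V :=
  \sum_(k <- msupp x) x@_k *: f k.

Lemma lin_extEw (f : K -> V) (x : {malg F[K]}) (d : {fset K}) :
  (msupp x `<=` d)%fset -> lin_ext f x = \sum_(k <- d) x@_k *: f k.
Proof.
move=> le; rewrite [LHS](big_fset_incl _ le) //= => k _ /mcoeff_outdom ->.
by rewrite scale0r.
Qed.

Lemma lin_ext_is_linear f : linear (lin_ext f).
Proof.
move=> a x y; pose d := (msupp x `|` msupp y `|` msupp (a *: x + y))%fset.
rewrite (@lin_extEw _ _ d) ?fsubsetUr // (@lin_extEw _ x d); last first.
  by rewrite /d -fsetUA fsubsetUl.
rewrite (@lin_extEw _ y d); last by rewrite /d fsetUAC fsubsetUr.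
rewrite scaler_sumr -big_split; apply: eq_bigr => k _ /=.
by rewrite mcoeffD mcoeffZ scalerDl scalerA.
Qed.

HB.instance Definition _ f := GRing.isLinear.Build F {malg F[K]} V *:%R
  (lin_ext f) (lin_ext_is_linear f).

Lemma lin_extU f k : lin_ext f << k >> = f k.
Proof.
by rewrite /lin_ext msuppU oner_eq0 big_seq_fset1 mcoeffUU scale1r.
Qed.

Lemma malg_ind (P : {malg F[K]} -> Prop) :
  P 0 -> (forall a x y, P x -> P y -> P (a *: x + y)) ->
  (forall k, P << k >>) -> forall x, P x.
Proof.
move=> P0 PD PU x; rewrite [x]monalgE.
elim: (enum_fset _) => [|k s IHs]; first by rewrite big_nil.
rewrite big_cons; suff -> : << x@_k *g k >> = x@_k *: << k >> by exact: PD.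
by apply/malgP => l; rewrite mcoeffZ !mcoeffU mulrnAr mulr1.
Qed.

End LinearExtension.

(* The basis vector of [vir F] indexed by [Some n] is L_n, the one indexed by
   [None] is C. *)
Section Virasoro.
Context (F : fieldType).

Definition vir := {malg F[option int]}.
HB.instance Definition _ := GRing.Lmodule.on vir.

Definition virL (n : int) : vir := << Some n >>.
Definition virC : vir := << None >>.

Definition vir_cocycle (m : int) : F := ((m ^+ 3 - m) %/ 3)%Z%:~R / 4%:R.

Definition vir_bracket_basis (k l : option int) : vir :=
  match k, l with
  | Some m, Some n => (m - n)%:~R *: virL (m + n)
                      + (vir_cocycle m *+ (m + n == 0)) *: virC
  | _, _ => 0
  end.

Definition vir_bracket (x y : vir) : vir :=
  lin_ext (fun k => lin_ext (vir_bracket_basis k) y) x.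

Lemma vir_bracketU k l : vir_bracket << k >> << l >> = vir_bracket_basis k l.
Proof. by rewrite /vir_bracket !lin_extU. Qed.

Fact vir_linearl a (x y z : vir) :
  vir_bracket (a *: x + y) z = a *: vir_bracket x z + vir_bracket y z.
Proof. exact: linearP. Qed.

Fact vir_linearr a (x y z : vir) :
  vir_bracket z (a *: x + y) = a *: vir_bracket z x + vir_bracket z y.
Proof.
rewrite /vir_bracket /lin_ext scaler_sumr -big_split; apply: eq_bigr => k _ /=.
rewrite -!/(lin_ext _ _) linearP scalerDr !scalerA.
by rewrite [a * _]mulrC.
Qed.

Fact vir_cocycle_divE (m : int) : ((m ^+ 3 - m) %/ 3)%Z * 3 = m ^+ 3 - m.
Proof.
apply: divzK; rewrite (divz_eq m 3).
have : (0 <= m %% 3)%Z by apply: modz_ge0.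
have : (m %% 3 < 3)%Z by apply: ltz_pmod.
set q := (m %/ 3)%Z; set r := (m %% 3)%Z => r3 r0.
have -> : (q * 3 + r) ^+ 3 - (q * 3 + r)
  = (9 * q ^+ 3 + 9 * q ^+ 2 * r + 3 * q * r ^+ 2 - q) * 3 + (r ^+ 3 - r).
  by ring.
apply: rpredD; first by rewrite dvdz_mull.
have : r \in [:: 0; 1; 2] by rewrite !inE; lia.
by rewrite !inE => /or3P[] /eqP->.
Qed.

Fact vir_cocycleN (m : int) : vir_cocycle (- m) = - vir_cocycle m.
Proof.
rewrite /vir_cocycle -mulNr -mulrNz; congr (_%:~R / _).
apply: (@mulIf _ 3) => //; rewrite mulNr !vir_cocycle_divE; ring.
Qed.

Fact vir_cocycle_jacobi (m n p : int) : m + n + p = 0 ->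
  (n - p)%:~R * vir_cocycle m + (p - m)%:~R * vir_cocycle n
  + (m - n)%:~R * vir_cocycle p = 0.
Proof.
move=> mnp; rewrite /vir_cocycle !mulrA -!mulrDl -!rmorphM -!rmorphD /=.
rewrite [X in X%:~R](_ : _ = 0) ?mul0r //.
apply: (@mulIf _ 3) => //; rewrite mul0r !mulrDl -!mulrA !vir_cocycle_divE.
have -> : p = - (m + n) by lia.
by ring.
Qed.

Fact vir_ind (P : vir -> Prop) :
  P 0 -> (forall a x y, P x -> P y -> P (a *: x + y)) ->
  (forall k, P (<< k >> : {malg F[option int]})) -> forall x, P x.
Proof. exact: malg_ind. Qed.

Fact vir_bracket0l x : vir_bracket 0 x = 0.
Proof. exact: linear0. Qed.

Fact vir_bracket0r x : vir_bracket x 0 = 0.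
Proof.
by have := vir_linearr (-1) 0 0 x; rewrite scaler0 addr0 scaleN1r addNr.
Qed.

Fact vir_bracketDl x y z :
  vir_bracket (x + y) z = vir_bracket x z + vir_bracket y z.
Proof. by rewrite -[x]scale1r vir_linearl !scale1r. Qed.

Fact vir_bracketDr x y z :
  vir_bracket z (x + y) = vir_bracket z x + vir_bracket z y.
Proof. by rewrite -[x]scale1r vir_linearr !scale1r. Qed.

Fact vir_bracketZr a x z : vir_bracket z (a *: x) = a *: vir_bracket z x.
Proof. by rewrite -[a *: x]addr0 vir_linearr vir_bracket0r addr0. Qed.

Fact vir_antisym x y : vir_bracket x y + vir_bracket y x = 0.
Proof.
elim/vir_ind: x => [|a x x' IHx IHx'|k].
- by rewrite vir_bracket0l vir_bracket0r addr0.
- rewrite vir_linearl vir_linearr addrACA -scalerDr.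
  by rewrite IHx IHx' scaler0 addr0.
elim/vir_ind: y => [|a y y' IHy IHy'|l].
- by rewrite vir_bracket0l vir_bracket0r addr0.
- rewrite vir_linearl vir_linearr addrACA -scalerDr.
  by rewrite IHy IHy' scaler0 addr0.
rewrite !vir_bracketU; case: k l => [m|] [n|] /=; rewrite ?addr0 //.
rewrite addrACA [n + m]addrC -!scalerDl -rmorphD /=.
have -> : m - n + (n - m) = 0 by ring.
rewrite scale0r add0r -mulrnDl; case: eqP => [mn|]; last by rewrite scale0r.
have -> : n = - m by lia.
by rewrite vir_cocycleN subrr mul0rn scale0r.
Qed.

Let scale_antisym (V : lmodType F) (a : F) (u v : V) :
  u + v = 0 -> a *: (a *: 0 + u) + (a *: v + 0) = 0.
Proof. by move=> uv; rewrite scaler0 add0r addr0 -scalerDr uv scaler0. Qed.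

Let jac (V : lmodType F) (B : V -> V -> V) x y z :=
  B x (B y z) + B y (B z x) + B z (B x y).

Let jacC (V : lmodType F) B (x y z : V) : jac B x y z = jac B y z x.
Proof. by rewrite /jac -addrA addrC. Qed.

Let collect (V : lmodType F) (a a' a'' b b' b'' : F) (u v : V) :
  a + a' + a'' = 0 -> b + b' + b'' = 0 ->
  (a *: u + b *: v) + (a' *: u + b' *: v) + (a'' *: u + b'' *: v) = 0.
Proof.
move=> a0 b0; rewrite (addrACA (a *: u)) (addrACA (_ + _)) -!scalerDl a0 b0.
by rewrite !scale0r addr0.
Qed.

Let jac_lin0 (V : lmodType F) (B : V -> V -> V) :
  (forall a x y z, B (a *: x + y) z = a *: B x z + B y z) ->
  (forall a x y z, B z (a *: x + y) = a *: B z x + B z y) ->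
  forall a x x' y z, jac B x y z = 0 -> jac B x' y z = 0 ->
  jac B (a *: x + x') y z = 0.
Proof.
move=> Bl Br a x x' y z J J'; rewrite /jac !Bl !Br.
rewrite (addrACA (a *: B x _)) (addrACA (_ + _)) -!scalerDr.
by rewrite -!/(jac B _ _ _) J J' scaler0 addr0.
Qed.

Fact vir_bracketxx x : vir_bracket x x = 0.
Proof.
elim/vir_ind: x => [|a x x' IHx IHx'|k].
- exact: vir_bracket0l.
- rewrite vir_linearl (vir_linearr a x x' x) (vir_linearr a x x' x') IHx IHx'.
  exact/scale_antisym/vir_antisym.
rewrite vir_bracketU; case: k => //= m.
rewrite subrr scale0r add0r; case: eqP => [mm|]; last by rewrite scale0r.
have -> : m = 0 by lia.
by rewrite /vir_cocycle mul0r scale0r.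
Qed.

Fact vir_bracketCr x : vir_bracket x virC = 0.
Proof.
elim/vir_ind: x => [|a x x' IHx IHx'|k].
- exact: vir_bracket0l.
- by rewrite vir_linearl IHx IHx' scaler0 addr0.
by rewrite vir_bracketU; case: k.
Qed.

Fact vir_bracketCl x : vir_bracket virC x = 0.
Proof. by have := vir_antisym x virC; rewrite vir_bracketCr add0r. Qed.

Fact vir_jacobi x y z :
  vir_bracket x (vir_bracket y z) + vir_bracket y (vir_bracket z x)
  + vir_bracket z (vir_bracket x y) = 0.
Proof.
rewrite -/(jac _ x y z).
have J0 v w : jac vir_bracket 0 v w = 0.
  by rewrite /jac !(vir_bracket0l, vir_bracket0r) !addr0.
have Jlin := jac_lin0 vir_linearl vir_linearr.
elim/vir_ind: x => [|a x x' IHx IHx'|k].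
- exact: J0.
- exact (Jlin a x x' _ _ IHx IHx').
rewrite jacC; elim/vir_ind: y => [|a y y' IHy IHy'|l].
- exact: J0.
- exact (Jlin a y y' _ _ IHy IHy').
rewrite jacC; elim/vir_ind: z => [|a z z' IHz IHz'|r].
- exact: J0.
- exact (Jlin a z z' _ _ IHz IHz').
rewrite jacC /jac.
have C0 := (vir_bracketCl, vir_bracketCr, vir_bracket0l, vir_bracket0r).
rewrite !vir_bracketU; case: k l r => [m|] [n|] [p|] //=;
  rewrite -?/virC ?C0 ?addr0 //.
have LLL (i j k : int) : i + (j + k) = m + n + p ->
    vir_bracket << Some i >> (vir_bracket_basis (Some j) (Some k)) =
    ((j - k) * (i - (j + k)))%:~R *: virL (m + n + p) +
    ((j - k)%:~R * vir_cocycle i *+ (m + n + p == 0)) *: virC.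
  move=> ijk; rewrite /= vir_bracketDr !vir_bracketZr vir_bracketCr scaler0.
  rewrite addr0 vir_bracketU /= ijk scalerDr !scalerA -rmorphM.
  by rewrite -mulrnAr.
rewrite !LLL; [|ring..].
apply: collect.
  by rewrite -!rmorphD /= [X in X%:~R](_ : _ = 0) //; ring.
rewrite -!mulrnDl; case: eqP => [mnp|] //.
by rewrite vir_cocycle_jacobi.
Qed.

HB.instance Definition _ := isLieAlgebra.Build F vir
  vir_linearl vir_linearr vir_bracketxx vir_jacobi.

End Virasoro.

Section Verma.
Context {F : fieldType} (c h : F).

Local Notation L n := (env_in (virL F n)).
Local Notation C := (env_in (virC F)).

Definition verma_char : set (env (vir F) * F) :=
  [set p | [\/ p = (C, c), p = (L 0, h)
             | exists2 n : int, 0 < n & p = (L n, 0)]].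

Definition verma := ind_mod verma_char.
HB.instance Definition _ := GRing.Lmodule.on verma.

Definition verma_vec : verma := ind_vec verma_char.

Definition verma_act (x : vir F) (m : verma) : verma := ind_act (env_in x) m.

(* L_{- n_1} ... L_{- n_k} v_{c,h} for s = [:: n_1; ...; n_k] *)
Definition verma_monom (s : seq nat) : verma :=
  foldr (fun n m => verma_act (virL F (- n%:Z)) m) verma_vec s.

Definition verma_deg (n : nat) : set verma :=
  lspan [set m | exists s : seq nat,
    [/\ sorted geq s, all (fun i => 0 < i)%N s, sumn s = n
      & m = verma_monom s]].

Definition verma_submod (W : set verma) : Prop :=
  [/\ W 0, forall (a : F) u v, W u -> W v -> W (a *: u + v)
    & forall x u, W u -> W (verma_act x u)].

Definition verma_graded (W : set verma) : Prop :=
  forall u, W u -> exists (N : nat) (f : nat -> verma),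
    (forall n, W (f n) /\ verma_deg n (f n)) /\ u = \sum_(n < N) f n.

Definition proper_graded_submod (W : set verma) : Prop :=
  [/\ verma_submod W, verma_graded W & W <> setT].

Definition maximal_graded_submod (W : set verma) : Prop :=
  proper_graded_submod W /\
  forall W', proper_graded_submod W' -> W `<=` W' -> W' = W.

(* W(c,h), the maximal proper graded submodule; it is unique, so that the
   choice made by [xget] is immaterial. *)
Definition verma_max : set verma := xget set0 maximal_graded_submod.

(* lspan verma_max = verma_max *)
Definition irr_mod := lquot verma_max.
HB.instance Definition _ := GRing.Lmodule.on irr_mod.

Definition irr_act (x : vir F) (q : irr_mod) : irr_mod :=
  lpi verma_max (verma_act x (repr q)).

Lemma irr_actE x m :
  irr_act x (lpi verma_max m) = lpi verma_max (verma_act x m).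
Proof.
have act_lin a u v : verma_act x (a *: u + v)
    = a *: verma_act x u + verma_act x v by exact: ind_act_linear.
apply/lpiP; rewrite addrC -scaleN1r -act_lin scaleN1r addrC.
elim: (lpi_repr verma_max m) => [|u Wu|a u v _ IHu _ IHv].
- have := act_lin (-1) 0 0; rewrite scaler0 addr0 scaleN1r addNr => ->.
  exact: lspan_zero.
- apply: lspan_gen; move: Wu; rewrite /verma_max.
  by case: xgetP => // W -> [[[_ _ Wact] _ _] _]; exact: Wact.
- by rewrite act_lin; apply: lspan_lin.
Qed.

End Verma.

(* The index set Z is the integers for b = false and the integers plus 1/2 for
   b = true; its element k + b / 2 is encoded by the integer k. *)
Section Fermions.
Context (F : fieldType) (b : bool).

(* The index encoded by k, in R = rat, or regarded as an element of R = F *)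
Definition fval (R : unitRingType) (k : int) : R := k%:~R + b%:R / 2%:R.

Definition fopp (k : int) : int := - k - b%:Z.

Lemma fval_opp k : fval rat (fopp k) = - fval rat k.
Proof.
rewrite /fval /fopp rmorphB rmorphN /=.
by case: b; rewrite /= ?subr0 ?mul0r ?addr0 //; field.
Qed.

Lemma fval_addl (n k : int) : fval rat (n + k) = n%:~R + fval rat k.
Proof. by rewrite /fval rmorphD addrA. Qed.

Definition clifford_rel : set (freealg F int) :=
  [set r | exists m n : int,
    r = fgen F m ** fgen F n + fgen F n ** fgen F m
        - (fval rat m + fval rat n == 0)%:R *: aone].

(* A(H, Z) *)
Definition clifford := aquot clifford_rel.
HB.instance Definition _ := AssocAlgebra.on clifford.

Definition fa (k : int) : clifford := api clifford_rel (fgen F k).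

Definition fock_char : set (clifford * F) :=
  [set p | exists2 k : int, 0 < fval rat k & p = (fa k, 0)].

(* V(H, Z) *)
Definition fock := ind_mod fock_char.
HB.instance Definition _ := GRing.Lmodule.on fock.

Definition fock_vec : fock := ind_vec fock_char.

Definition fock_act (u : clifford) (v : fock) : fock := ind_act u v.

(* V(H, Z)_{s mod 2}, with s = 1 for [true]; the monomial attached to
   [:: k_1; ...; k_r] is a(- n_1) ... a(- n_r) 1, n_i being encoded by k_i. *)
Definition fock_parity (s : bool) : set fock :=
  lspan [set v | exists ks : seq int,
    [/\ sorted (fun k l => fval rat l < fval rat k) ks,
        all (fun k => 0 <= fval rat k) ks, odd (size ks) = s
      & v = foldr (fun k w => fock_act (fa (fopp k)) w) fock_vec ks]].

Definition normal_order (m n : int) : clifford :=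
  if fval rat m <= fval rat n then fa m ** fa n else - (fa n ** fa m).

(* All but finitely many terms of the sum vanish for a given v. *)
Definition fock_L (n : int) (v : fock) : fock :=
  (if ~~ b && (n == 0) then 16%:R^-1 *: v else 0)
  + 2%:R^-1 *: \sum_(j \in [set: int])
      fval F j *: fock_act (normal_order (fopp j) (n + j)) v.

Definition fock_vir (x : vir F) (v : fock) : fock :=
  lin_ext (fun k => if k is Some n then fock_L n v else 2%:R^-1 *: v) x.

End Fermions.

Arguments irr_act {F} c h x q.
Arguments fock_parity : clear implicits.
Arguments fock_vir : clear implicits.

(* M, with the action actM of vir F, is isomorphic to the submodule S of N:
   f is a bijection from M onto S. *)
Definition vir_isomorphic (F : fieldType) (M N : lmodType F)
    (actM : vir F -> M -> M) (actN : vir F -> N -> N) (S : set N) : Prop :=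
  exists f : {linear M -> N},
    [/\ injective f, range f = S & forall x m, f (actM x m) = actN x (f m)].

(* Main.v *)
Require Import Defs.
From HB Require Import structures.
From mathcomp Require Import all_boot all_order all_algebra.
From mathcomp Require Import finmap monalg.
From mathcomp Require Import boolp classical_sets functions fsbigop.
From mathcomp Require Import zify ring.
Set Implicit Arguments.
Unset Strict Implicit.
Unset Printing Implicit Defensive.
Import Order.TTheory GRing.Theory Num.Theory.
Local Open Scope ring_scope.

(** The fermionic Fock space has basis the monomials in the modes [a(k)], and an
    operator commuting with all of them is a scalar (for integral indices it must
    also commute with a second zero mode). This gives the Virasoro relations: the
    two sides have the same commutators with the modes, hence differ by a scalar,
    which is read off the vacuum.

    For a function [f] of the indices let [Phi f n] be the sum of the [f(i)
    :a(i) a(n - i):], so that [L_n] is [Phi f n] for a linear [f], up to a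
    constant. A subspace [M] stable under the [L_n] is stable under [Phi f n]
    for every polynomial [f], by induction on its degree [N], from [N = 1].
    Since [f] may be antisymmetrized, only odd [N] matter. If [f] and [g] have
    degrees [r] and [s] with [r + s + 1 = N], the modes of the normally ordered
    product of the fields [Phi f] and [Phi g] preserve [M]; this product has no
    quartic part, which would contain the square of a fermionic field, so its
    modes are [Phi h n] plus a constant, where [h] has degree [N] and, up to
    sign, leading coefficient ['C(N + 1, r + 1) - (-1)^r (N + 1) 'C(N - 1, r)].
    Some choice of [r] makes it nonzero: if [N + 1] is invertible in [F], then
    [r = 1] or, when [3 N = 2] in [F], [r = 2], where the characteristic 7 has
    to be excluded; if [N + 1 = p^e k] with [p = char F] not dividing [k], then
    [r = p^e - 1], which gives [k]. By interpolation [M] is stable under all the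
    [a(i) a(j)], hence it is [0] or a whole parity component if it is contained
    in one.

    The kernel of the map from the Verma module to a parity component is therefore
    the maximal graded submodule. *)

(** * Induced modules of algebras given by generators and relations *)

Lemma linear_closed0 (F : fieldType) (V : lmodType F) (P : V -> Prop) :
  P 0 -> (forall (a : F) u v, P u -> P v -> P (a *: u + v)) ->
  [/\ forall u v, P u -> P v -> P (u + v),
      forall (a : F) u, P u -> P (a *: u),
      forall u, P u -> P (- u)
    & forall u v, P u -> P v -> P (u - v)].
Proof.
move=> P0 Pl.
have PD u v : P u -> P v -> P (u + v).
  by move=> Pu Pv; rewrite -[u]scale1r; exact: Pl.
have PZ (a : F) u : P u -> P (a *: u).
  by move=> Pu; rewrite -[_ *: _]addr0; exact: Pl.
have PN u : P u -> P (- u) by move=> Pu; rewrite -scaleN1r; exact: PZ.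
by split=> // u v Pu Pv; apply: PD => //; exact: PN.
Qed.

Lemma freealg_ind (F : fieldType) (X : choiceType)
    (P : freealg F X -> Prop) :
  P 0 -> (forall a x y, P x -> P y -> P (a *: x + y)) ->
  (forall m, P (<< m >> : {malg F[{fmonom X}]})) -> forall x, P x.
Proof. exact: malg_ind. Qed.

Lemma freealgUU (F : fieldType) (X : choiceType) (m l : {fmonom X}) :
  (<< m >> : freealg F X) ** << l >> = << fmmul m l >>.
Proof. by rewrite -[1 in RHS]mulr1; exact: fgmulUU. Qed.

Section InducedTheory.
Context {F : fieldType} {A : assocAlgType F} (G : set (A * F)).
Implicit Types (u w : A) (m : ind_mod G).

Lemma ind_actM u w m : ind_act (u ** w) m = ind_act u (ind_act w m).
Proof. by rewrite -[m]lpiK !ind_actE amulA. Qed.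

Lemma ind_actDZ (c : F) u w m :
  ind_act (c *: u + w) m = c *: ind_act u m + ind_act w m.
Proof.
rewrite -[m]lpiK !ind_actE amul_linearl.
exact: (linearP (lpi (tensor_rel G))).
Qed.

Lemma ind_actN u m : ind_act (- u) m = - ind_act u m.
Proof.
have := ind_actDZ (-1) u 0 m; rewrite scaleN1r addr0 => ->.
have := ind_actDZ (-1) 0 0 m; rewrite scaleN1r addr0 oppr0 scaleN1r addNr => ->.
by rewrite scaleN1r addr0.
Qed.

End InducedTheory.

Section FreeAction.
Context {F : fieldType} {X : choiceType} {W : lmodType F}.
Variable op : X -> W -> W.
Hypothesis op_linear : forall x, linear (op x).

HB.instance Definition _ x := GRing.isLinear.Build F W W *:%R (op x)
  (op_linear x).

Definition word_act (m : {fmonom X}) (w : W) : W := foldr op w (m : seq X).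

Lemma word_act_linear m : linear (word_act m).
Proof.
move=> a u v; rewrite /word_act; elim: (m : seq X) => //= x s ->.
by rewrite linearP.
Qed.

Definition free_act (y : freealg F X) (w : W) : W :=
  lin_ext (fun m => word_act m w) y.

Lemma free_act_linearl w : linear (free_act^~ w).
Proof. by move=> a x y; rewrite /free_act linearP. Qed.

(** Linearity for the module structure that the free algebra carries as an [assocAlgType], the one
    in which sums of [**] products are formed. *)
Lemma free_actDZ w (a : F) (x y : AssocAlgebra.clone F (freealg F X) _) :
  free_act (a *: x + y) w = a *: free_act x w + free_act y w.
Proof. exact: (free_act_linearl w a x y). Qed.

Lemma free_act_linearr y : linear (free_act y).
Proof.
move=> a u v; rewrite /free_act /lin_ext scaler_sumr -big_split.
apply: eq_bigr => m _ /=.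
by rewrite word_act_linear scalerDr !scalerA [a * _]mulrC.
Qed.

Lemma free_act0 w : free_act 0 w = 0.
Proof. by rewrite /free_act linear0. Qed.

Lemma free_actr0 y : free_act y 0 = 0.
Proof.
have := free_act_linearr y (-1) 0 0.
by rewrite scaler0 addr0 scaleN1r addNr.
Qed.

Lemma free_act_gen x w : free_act (fgen F x) w = op x w.
Proof. by rewrite /free_act /fgen lin_extU /word_act fmuE. Qed.

Lemma free_act1 w : free_act aone w = w.
Proof. by rewrite /free_act lin_extU /word_act fm1. Qed.

Lemma free_actM y z w : free_act (y ** z) w = free_act y (free_act z w).
Proof.
elim/freealg_ind: y => [|a y y' IHy IHy'|m].
- by rewrite amul0r !free_act0.
- refine (etrans (congr1 (free_act^~ w) (amul_linearl a y y' z)) _).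
  refine (etrans (free_actDZ w a _ _) _); rewrite IHy IHy'.
  exact: esym (free_act_linearl (free_act z w) a y y').
elim/freealg_ind: z => [|a z z' IHz IHz'|l].
- by rewrite amulr0 free_act0 free_actr0.
- refine (etrans (congr1 (free_act^~ w) (amul_linearr a z z' _)) _).
  refine (etrans (free_actDZ w a _ _) _); rewrite IHz IHz'.
  rewrite -(free_act_linearr << m >> a); congr (free_act _ _).
  exact: esym (free_act_linearl w a z z').
rewrite freealgUU.
by rewrite /free_act !lin_extU /word_act fmmulE foldr_cat.
Qed.

End FreeAction.

(* Modules induced from the subalgebra of an algebra given by the generators X
   and the relations R. *)
Section InducedUniversal.
Context {F : fieldType} {X : choiceType} (R : set (freealg F X)).
Local Notation A := (aquot R).
Context (G : set (A * F)).
Local Notation act x := (ind_act (api R (fgen F x)) : ind_mod G -> ind_mod G).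

(** The module is spanned by words in the generators applied to [ind_vec]: reduce a representative
    to words of the free algebra, then induct on their length. *)
Lemma ind_mod_ind (P : ind_mod G -> Prop) :
  P 0 -> (forall (a : F) u v, P u -> P v -> P (a *: u + v)) ->
  P (ind_vec G) -> (forall x u, P u -> P (act x u)) -> forall u, P u.
Proof.
move=> P0 Pl Pv Pact u; rewrite -[u]lpiK -[repr u]apiK.
elim/freealg_ind: (repr (repr u)) => [|a y z Py Pz|m].
- by rewrite (linear0 (api R)) (linear0 (lpi (tensor_rel G))).
- by rewrite (linearP (api R)) (linearP (lpi (tensor_rel G))); exact: Pl.
rewrite -[m]fmK; elim: (m : seq X) => [|x s IHs].
  by rewrite -fmoneE; exact: Pv.
have -> : (<< FMonom (x :: s) >> : freealg F X)
    = (fgen F x : freealg F X) ** << FMonom s >>.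
  by rewrite freealgUU fmmulE fmuE.
by rewrite apiM -ind_actE; exact: Pact.
Qed.

Context {W : lmodType F} (op : X -> W -> W) (w0 : W).
Hypothesis op_linear : forall x, linear (op x).
Hypothesis op_rel : forall r w, R r -> free_act op r w = 0.
Hypothesis op_char : forall q l, G (q, l) ->
  exists2 y, q = api R y & free_act op y w0 = l *: w0.

Let Lr := free_act_linearr op_linear.
Let Ll := free_act_linearl op.

Let free_act_ideal x w : lspan (ideal_span R) x -> free_act op x w = 0.
Proof.
elim=> [|y [u [r [v [Rr ->]]]]|a y z _ IHy _ IHz].
- exact: free_act0.
- by rewrite !(free_actM op_linear) (op_rel _ Rr) (free_actr0 op_linear).
- by rewrite Ll IHy IHz scaler0 addr0.
Qed.

Let qact (q : A) w := free_act op (repr q) w.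

Let qactE x w : qact (api R x) w = free_act op x w.
Proof.
apply/eqP; rewrite -subr_eq0; apply/eqP.
rewrite -scaleN1r addrC -Ll scaleN1r addrC.
exact/free_act_ideal/lpi_repr.
Qed.

Let qact_linear w : linear (qact^~ w).
Proof.
move=> a x y; rewrite -[x]apiK -[y]apiK -linearP !qactE.
exact: Ll.
Qed.

Let qactM x y w : qact (x ** y) w = qact x (qact y w).
Proof.
by rewrite -[x]apiK -[y]apiK -apiM !qactE (free_actM op_linear).
Qed.

(** [op_char] concerns only the generators of the subalgebra; the derivation of [acts_by] carries it
    to the whole subalgebra. *)
Let qact_char q l : acts_by G q l -> qact q w0 = l *: w0.
Proof.
elim=> [q' k /op_char[y -> <-]|||]; first exact: qactE.
- by rewrite scale1r [LHS]qactE free_act1.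
- move=> a b k b' k' _ IH _ IH'.
  by rewrite (qact_linear w0 a) IH IH' scalerA scalerDl.
- move=> b k b' k' _ IH _ IH'.
  rewrite qactM IH' /qact; have := Lr (repr b) k' w0 0.
  rewrite !addr0 (free_actr0 op_linear) addr0 => ->.
  by rewrite -/(qact b w0) IH scalerA mulrC.
Qed.

(** The action of the free algebra on [W] descends to [A] because the relations act as 0, and
    evaluation at [w0] kills the tensor relations because the subalgebra acts on [w0] through its
    character. *)
Lemma ind_mod_univ : exists f : {linear ind_mod G -> W},
  f (ind_vec G) = w0 /\ forall x u, f (act x u) = op x (f u).
Proof.
pose f (u : ind_mod G) := qact (repr u) w0.
have fE x : f (lpi (tensor_rel G) x) = qact x w0.
  apply/eqP; rewrite -subr_eq0 -scaleN1r addrC -qact_linear scaleN1r addrC.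
  apply/eqP; elim: (lpi_repr (tensor_rel G) x) => [|y [p [q [l [ql ->]]]]|].
  - by rewrite -(linear0 (api R)) qactE free_act0.
  - rewrite addrC -scaleN1r scalerA mulN1r qact_linear qactM (qact_char ql).
    have := Lr (repr p) l w0 0; rewrite !addr0 (free_actr0 op_linear) addr0.
    by rewrite /qact => ->; rewrite scaleNr addNr.
  - move=> a y z _ IHy _ IHz.
    by rewrite qact_linear IHy IHz scaler0 addr0.
have fl : linear f.
  move=> a u v; rewrite -[u]lpiK -[v]lpiK -(linearP (lpi (tensor_rel G))).
  by rewrite !fE qact_linear.
pose fL := GRing.isLinear.Build F (ind_mod G) W *:%R f fl.
pose f' : {linear ind_mod G -> W} := HB.pack f fL.
exists f'; split=> [|x u] /=.
  by rewrite [LHS]fE [LHS]qactE free_act1.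
rewrite -[u]lpiK ind_actE [LHS]fE qactM fE qactE.
by rewrite free_act_gen.
Qed.

End InducedUniversal.

(** * Modes of the Fock module: anticommutation relations, induction, universal property *)

Section FockBasics.
Context (F : fieldType) (b : bool).
Local Notation V := (fock F b).

Definition fock_a (k : int) (v : V) : V := fock_act (fa F b k) v.
Local Notation a := fock_a.

Lemma fock_a_linear k : linear (a k).
Proof. by move=> c u v; exact: ind_act_linear. Qed.

HB.instance Definition _ k := GRing.isLinear.Build F V V *:%R (a k)
  (fock_a_linear k).

Lemma fval_gt0 k : (0 < fval b rat k) = (0 < k * 2 + b%:Z :> int).
Proof.
have -> : fval b rat k = (k * 2 + b%:Z)%:~R / 2%:R.
  by rewrite /fval; case: b => /=; rewrite !(rmorphD, rmorphM) /=; field.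
by rewrite pmulr_lgt0 ?invr_gt0 ?ltr0n // ltr0z.
Qed.

Lemma fval_lt k l : (fval b rat k < fval b rat l) = (k < l).
Proof. by rewrite /fval ltrD2r ltr_int. Qed.

Lemma fval_le k l : (fval b rat k <= fval b rat l) = (k <= l).
Proof. by rewrite /fval lerD2r ler_int. Qed.

Lemma fval_add_eq0 k l :
  (fval b rat k + fval b rat l == 0) = (k + l + b%:Z == 0).
Proof.
have -> : fval b rat k + fval b rat l = (k + l + b%:Z)%:~R.
  rewrite /fval; case: b => /=; rewrite !rmorphD /=; first by field.
  by rewrite mul0r !addr0.
by rewrite intr_eq0.
Qed.

Lemma fock_car k l v :
  a k (a l v) + a l (a k v) = (k + l + b%:Z == 0)%:R *: v.
Proof.
rewrite -[v]lpiK /a /fock_act !ind_actE.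
rewrite -(linearD (lpi (tensor_rel (@fock_char F b)))).
rewrite -(linearZZ (lpi (tensor_rel (@fock_char F b)))).
set u := repr v; rewrite !amulA -amulDl.
have -> : fa F b k ** fa F b l + fa F b l ** fa F b k
   = (k + l + b%:Z == 0)%:R *: aone.
  rewrite /fa -!apiM -(linearD (api (@clifford_rel F b))).
  rewrite -[aone]/(api (@clifford_rel F b) aone).
  rewrite -(linearZZ (api (@clifford_rel F b))).
  apply/lpiP; set r := _ - _; apply: lspan_gen; exists aone, r, aone.
  split; last by rewrite amul1r amulr1.
  by exists k, l; rewrite fval_add_eq0.
by rewrite amulZl amul1r.
Qed.

Lemma fock_a_vec k : 0 < k * 2 + b%:Z :> int -> a k (fock_vec F b) = 0.
Proof.
rewrite -fval_gt0 => k0; rewrite /a /fock_act /fock_vec /ind_vec ind_actE.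
rewrite -(linear0 (lpi (tensor_rel (@fock_char F b)))); apply/lpiP.
apply: lspan_gen; exists aone, (fa F b k), 0; split.
  by apply: acts_gen; exists k.
by rewrite amul1r amulr1 scale0r.
Qed.

Lemma fock_ind (P : V -> Prop) :
  P 0 -> (forall (c : F) u v, P u -> P v -> P (c *: u + v)) ->
  P (fock_vec F b) -> (forall k u, P u -> P (a k u)) -> forall u, P u.
Proof. exact: ind_mod_ind. Qed.

Lemma fock_univ (W : lmodType F) (op : int -> W -> W) (w0 : W) :
  (forall k, linear (op k)) ->
  (forall k l w,
     op k (op l w) + op l (op k w) = (k + l + b%:Z == 0)%:R *: w) ->
  (forall k, 0 < k * 2 + b%:Z :> int -> op k w0 = 0) ->
  exists f : {linear V -> W},
    f (fock_vec F b) = w0 /\ forall k u, f (a k u) = op k (f u).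
Proof.
move=> opL opC op0.
apply: (@ind_mod_univ F int (@clifford_rel F b) (@fock_char F b) W op w0 opL).
  move=> r w [m [n ->]].
  set c := (_ == 0)%:R.
  have -> : fgen F m ** fgen F n + fgen F n ** fgen F m - c *: aone
    = - c *: aone + (1 *: (fgen F m ** fgen F n) + fgen F n ** fgen F m).
    by rewrite scale1r scaleNr addrC.
  have E x y u : free_act op (fgen F x ** fgen F y) u = op x (op y u).
    by rewrite (free_actM opL) (free_act_gen op y) (free_act_gen op x).
  rewrite (free_actDZ op w (- c)) (free_actDZ op w 1).
  transitivity (- c *: w + (1 *: op m (op n w) + op n (op m w))).
    congr (_ *: _ + (_ *: _ + _)); [exact: free_act1|exact: E|exact: E].
  by rewrite scale1r opC /c fval_add_eq0 scaleNr addNr.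
move=> q l [k k0 [-> ->]]; exists (fgen F k) => //.
by rewrite free_act_gen scale0r op0 // -fval_gt0.
Qed.

End FockBasics.

(** * The vacuum is nonzero *)

Section JordanWigner.
Context (F : fieldType) (b : bool) (char_neq2 : 2%:R != 0 :> F).
Local Notation W := ((nat -> bool) -> F^o).

Let flip (n : nat) (S : nat -> bool) (j : nat) := S j (+) (j == n).

(** The Jordan-Wigner sign, the parity of the number of occupied sites before [n]: it makes
    operators at distinct sites anticommute. *)
Let sgn (n : nat) (S : nat -> bool) : F := \prod_(j < n) (-1) ^+ S j.

(* The mode +-(n + b/2) acts at the site n: lowering for positive modes, raising
   for negative modes, and raising + lowering / 2 for the zero mode. *)
Let site (k : int) : nat := if 0 <= k then absz k else absz (k + b%:Z).

Let coef (k : int) (s : bool) : F :=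
  if 0 < k * 2 + b%:Z then (~~ s)%:R
  else if k * 2 + b%:Z < 0 then s%:R
  else if s then 1 else 2%:R^-1.

Let op (k : int) (phi : W) : W :=
  fun S => coef k (S (site k)) * sgn (site k) S * phi (flip (site k) S).

Let flipK n S : flip n (flip n S) = S.
Proof. by apply: funext => j; rewrite /flip -addbA addbb addbF. Qed.

Let flipC m n S : flip m (flip n S) = flip n (flip m S).
Proof. by apply: funext => j; rewrite /flip -!addbA [X in _ (+) X]addbC. Qed.

Let sgn_flip m n S : sgn m (flip n S) = (-1) ^+ (n < m)%N * sgn m S.
Proof.
rewrite /sgn; elim: m => [|m IHm]; first by rewrite !big_ord0 expr0 mulr1.
rewrite !big_ord_recr /= IHm /flip signr_addb ltnS.
by case: (ltngtP m n) => _ /=; rewrite ?expr0 ?expr1; ring.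
Qed.

Let sgn_sqr n S : sgn n S * sgn n S = 1.
Proof.
rewrite /sgn; elim: n => [|n IHn]; first by rewrite !big_ord0 mulr1.
by rewrite !big_ord_recr /= mulrACA IHn mul1r -signr_addb addbb.
Qed.

Let opM k l phi S :
  op k (op l phi) S = coef k (S (site k)) * coef l (flip (site k) S (site l))
   * (sgn (site k) S * sgn (site l) S * (-1) ^+ (site k < site l)%N)
   * phi (flip (site l) (flip (site k) S)).
Proof. by rewrite /op sgn_flip; ring. Qed.

Let op_car k l phi :
  op k (op l phi) + op l (op k phi) = (k + l + b%:Z == 0)%:R *: phi.
Proof.
apply: funext => S.
rewrite -[LHS]/(op k (op l phi) S + op l (op k phi) S).
rewrite -[RHS]/((k + l + b%:Z == 0)%:R * phi S) !opM [flip (site k) (flip _ _)]flipC.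
(* At a common site the signs square to 1 and a finite check of [coef] remains; at distinct sites
   exactly one of the two orders picks up a sign. *)
case: (eqVneq (site k) (site l)) => [kl|kl].
  rewrite kl ltnn flipK expr0 mulr1 sgn_sqr !mulr1 -mulrDl; congr (_ * _).
  rewrite /flip eqxx addbT; move: kl; move: (S _) => s kl.
  have half : 1 * 2%:R^-1 + 1 * 2%:R^-1 = 1 :> F by field.
  have half' : 2%:R^-1 * 1 + 2%:R^-1 * 1 = 1 :> F by field.
  have {kl} [->|kl] : k = l \/ k + l + b%:Z = 0.
    move: kl; rewrite /site; case: b => /=; case: ifP => ?; case: ifP => ? ?;
      by [left; lia|right; lia].
  - have -> : (l + l + b%:Z == 0) = (l * 2 + b%:Z == 0).
      by congr (_ == 0); ring.
    rewrite /coef; case: (ltgtP 0 (l * 2 + b%:Z)) => [lb|lb|_].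
    + by case: s; rewrite /= ?mulr0 ?mul0r ?addr0.
    + by case: s; rewrite /= ?mulr0 ?mul0r ?addr0.
    + by case: s; rewrite /= ?half ?half'.
  - rewrite /coef kl eqxx.
    have -> : k * 2 + b%:Z = - (l * 2 + b%:Z).
      by have -> : k = - l - b%:Z; [lia|ring].
    rewrite oppr_gt0 oppr_lt0.
    case: (ltgtP 0 (l * 2 + b%:Z)) => _; case: s;
      by rewrite /= ?half ?half' ?mulr0 ?mul0r ?addr0 ?add0r ?mulr1.
have -> : (k + l + b%:Z == 0) = false.
  apply/negP => /eqP H; move/eqP: kl; apply; rewrite /site.
  by case: b H => /= H; case: ifP => ?; case: ifP => ?; lia.
rewrite /flip [site l == _]eq_sym (negPf kl) !addbF mul0r.
by case: (ltngtP (site k) (site l)) kl => //= _ _; rewrite ?expr1 ?expr0; ring.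
Qed.

Let op_linear k : linear (op k).
Proof.
move=> c phi psi; apply: funext => S; rewrite /op.
rewrite -[(c *: phi + psi) _]/(c * phi _ + psi _).
rewrite -[RHS]/(c * (_ * _) + _ * _); ring.
Qed.

(** The operators [op] act on all functions of configurations, and positive modes kill the indicator
    of the empty configuration; [fock_univ] therefore maps the vacuum to this nonzero function. *)
Lemma fock_vec_neq0 : fock_vec F b != 0.
Proof.
pose w0 : W := fun S => (`[< S = (fun=> false) >])%:R.
have w0E k : 0 < k * 2 + b%:Z -> op k w0 = 0.
  move=> k0; apply: funext => S; rewrite /op /w0 /coef k0.
  case: asboolP => [/(congr1 (@^~ (site k)))|_]; last by rewrite mulr0.
  by rewrite /flip eqxx addbT => /negbFE ->; rewrite !mul0r.
have [f [f0 _]] := fock_univ op_linear op_car w0E.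
apply: contra_neq (oner_neq0 F) => v0.
move: f0; rewrite v0 linear0 => /(congr1 (@^~ (fun=> false))).
by rewrite /w0; case: asboolP.
Qed.

End JordanWigner.

(** * Finitely supported sums over the integers *)

Section IntegerSums.
Context {F : fieldType} {V : lmodType F}.
Implicit Types (s t : int -> V).

Definition zsum t : V := \sum_(j \in [set: int]%classic) t j.

(** The side condition under which [zsum] is additive: a sum with infinite support takes the default
    value 0. *)
Definition fins t := exists A : {fset int}, forall j, j \notin A -> t j = 0.

Lemma fins_bound t (lo hi : int) :
  (forall j, j <= lo \/ hi <= j -> t j = 0) -> fins t.
Proof.
move=> t0; exists [fset (lo + k%:Z)%R | k in iota 0 (absz (hi - lo)%R)]%fset => j.
move=> jA; apply: t0.
have [?|lt_lo] := leP j lo; first by left.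
have [?|lt_hi] := leP hi j; first by right.
case/negP: jA; apply/imfsetP; exists (absz (j - lo)); last by lia.
by rewrite /= mem_iota; lia.
Qed.

Lemma zsumE t (A : {fset int}) :
  (forall j, j \notin A -> t j = 0) -> zsum t = \sum_(j <- A) t j.
Proof. exact: fsbigTE. Qed.

Lemma eq_zsum s t : s =1 t -> zsum s = zsum t.
Proof. by move=> /funext ->. Qed.

Lemma zsum0 : zsum (fun=> 0) = 0.
Proof. by rewrite (@zsumE _ fset0) // big_seq_fset0. Qed.

Lemma zsum1 t k : (forall j, j != k -> t j = 0) -> zsum t = t k.
Proof.
move=> t0; rewrite (@zsumE _ [fset k]%fset) ?big_seq_fset1 // => j.
by rewrite in_fset1; exact: t0.
Qed.

Lemma fins1 t k : (forall j, j != k -> t j = 0) -> fins t.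
Proof. by move=> t0; exists [fset k]%fset => j; rewrite in_fset1; exact: t0. Qed.

Lemma finsDZ (c : F) s t : fins s -> fins t -> fins (fun j => c *: s j + t j).
Proof.
move=> [A sA] [B tB]; exists (A `|` B)%fset => j.
rewrite in_fsetU negb_or => /andP[/sA -> /tB ->].
by rewrite scaler0 addr0.
Qed.

Lemma zsumDZ (c : F) s t : fins s -> fins t ->
  zsum (fun j => c *: s j + t j) = c *: zsum s + zsum t.
Proof.
move=> [A sA] [B tB].
have sAB j : j \notin (A `|` B)%fset -> s j = 0.
  by rewrite in_fsetU negb_or => /andP[/sA].
have tAB j : j \notin (A `|` B)%fset -> t j = 0.
  by rewrite in_fsetU negb_or => /andP[_ /tB].
rewrite (zsumE sAB) (zsumE tAB) scaler_sumr -big_split; apply: zsumE => j jAB.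
by rewrite sAB // tAB // scaler0 addr0.
Qed.

Lemma fins0 : fins (fun=> 0).
Proof. by exists fset0. Qed.

Lemma finsD s t : fins s -> fins t -> fins (fun j => s j + t j).
Proof.
move=> fs ft; have [A AE] := finsDZ 1 fs ft.
by exists A => j /AE; rewrite scale1r.
Qed.

Lemma finsB s t : fins s -> fins t -> fins (fun j => s j - t j).
Proof.
move=> fs ft; have [A AE] := finsDZ (-1) ft fs.
by exists A => j /AE; rewrite scaleN1r addrC.
Qed.

Lemma zsumD s t : fins s -> fins t ->
  zsum (fun j => s j + t j) = zsum s + zsum t.
Proof.
move=> fs ft; rewrite -[zsum s]scale1r -zsumDZ //; apply: eq_zsum => j.
by rewrite scale1r.
Qed.

Lemma zsumB s t : fins s -> fins t ->
  zsum (fun j => s j - t j) = zsum s - zsum t.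
Proof.
move=> fs ft; rewrite addrC -scaleN1r -zsumDZ //; apply: eq_zsum => j.
by rewrite scaleN1r addrC.
Qed.

Lemma fins_shift t c : fins t -> fins (fun j => t (j + c)).
Proof.
move=> [A AE]; exists [fset (j - c)%R | j in A]%fset => j jA; apply: AE.
apply: contra jA => jA; apply/imfsetP; exists (j + c) => //=.
by rewrite addrK.
Qed.

Lemma zsum_shift t c : zsum t = zsum (fun j => t (j + c)).
Proof.
rewrite /zsum (@reindex_fsbigT _ _ _ _ _ (fun j : int => j + c)) //.
by exists (fun j : int => j - c) => j; rewrite ?addrK ?subrK.
Qed.

Lemma zsum_flip t c : zsum t = zsum (fun j => t (c - j)).
Proof.
rewrite /zsum (@reindex_fsbigT _ _ _ _ _ (fun j : int => c - j)) //.
by exists (fun j : int => c - j) => j; rewrite subKr.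
Qed.

Lemma zsum_closed (P : V -> Prop) t : P 0 ->
  (forall (c : F) u v, P u -> P v -> P (c *: u + v)) ->
  (forall j, P (t j)) -> P (zsum t).
Proof.
move=> P0 Pl Pt; have [PD _ _ _] := linear_closed0 P0 Pl.
by rewrite /zsum; apply: big_ind.
Qed.

End IntegerSums.

Lemma fins_scale (F : fieldType) (V : lmodType F) (f : int -> F)
  (t : int -> V) : fins t -> fins (fun j => f j *: t j).
Proof. by move=> [A AE]; exists A => j /AE ->; rewrite scaler0. Qed.

Lemma fins_linear (F : fieldType) (V W : lmodType F) (f : {linear V -> W})
  (t : int -> V) : fins t -> fins (fun j => f (t j)).
Proof. by move=> [A AE]; exists A => j /AE ->; rewrite linear0. Qed.

Lemma zsum_linear (F : fieldType) (V W : lmodType F) (f : {linear V -> W})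
  (t : int -> V) : fins t -> f (zsum t) = zsum (fun j => f (t j)).
Proof.
move=> [A AE]; rewrite (zsumE AE) linear_sum.
by apply/esym/zsumE => j /AE ->; rewrite linear0.
Qed.

(* [fs_a k] is a(k + b/2), [fs_pi] the parity; [fs_gr d] is the projection onto
   degree d / 2; [fs_om] is the second
   Majorana zero mode, needed because for b = false the a(k) alone have a
   nontrivial commutant. *)
Record fermiSpace (F : fieldType) (b : bool) := FermiSpace {
  fs_sort :> lmodType F;
  fs_a : int -> {linear fs_sort -> fs_sort};
  fs_vac : fs_sort;
  fs_pi : {linear fs_sort -> fs_sort};
  fs_om : {linear fs_sort -> fs_sort};
  fs_gr : int -> {linear fs_sort -> fs_sort};
  fs_car : forall k l v, fs_a k (fs_a l v) + fs_a l (fs_a k v)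
    = (k + l + b%:Z == 0)%:R *: v;
  fs_a_vac : forall k, 0 < k * 2 + b%:Z -> fs_a k fs_vac = 0;
  fs_ind : forall P : fs_sort -> Prop,
    P 0 -> (forall (c : F) u v, P u -> P v -> P (c *: u + v)) ->
    P fs_vac -> (forall k u, P u -> P (fs_a k u)) -> forall u, P u;
  fs_vac_neq0 : fs_vac != 0;
  fs_pi_vac : fs_pi fs_vac = fs_vac;
  fs_pi_a : forall k v, fs_pi (fs_a k v) = - fs_a k (fs_pi v);
  fs_om_vac : fs_om fs_vac = (~~ b)%:R *: fs_a 0 fs_vac;
  fs_om_a : forall k v, fs_om (fs_a k v) = - fs_a k (fs_om v);
  fs_gr_vac : forall d, fs_gr d fs_vac = (d == 0)%:R *: fs_vac;
  fs_gr_a : forall d k v,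
    fs_gr d (fs_a k v) = fs_a k (fs_gr (d + (k * 2 + b%:Z)) v)
}.

(** * Modes of quadratic fields *)

Section FermiTheory.
Context {F : fieldType} {b : bool} (S : fermiSpace F b).
Local Notation V := (fs_sort S).
Local Notation a := (fs_a S).
Local Notation vac := (fs_vac S).
Local Notation pi := (fs_pi S).
Local Notation om := (fs_om S).
Local Notation gr := (fs_gr S).
Local Notation bz := (b%:Z).
Implicit Types (f g h : int -> F) (v : V).

Lemma fs_carN k l v : a k (a l v) = (k + l + bz == 0)%:R *: v - a l (a k v).
Proof. by rewrite -fs_car addrK. Qed.

Lemma fs_anti k l v : k + l + bz != 0 -> a k (a l v) = - a l (a k v).
Proof. by move=> /negPf kl; rewrite fs_carN kl scale0r add0r. Qed.

Lemma fs_sqr0 k v : 2%:R != 0 :> F -> k * 2 + bz != 0 -> a k (a k v) = 0.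
Proof.
move=> char_neq2 k0; have := fs_car k k v.
rewrite (_ : k + k + bz = k * 2 + bz); last by ring.
rewrite (negPf k0) scale0r -[X in X + X]scale1r -scalerDl => /eqP.
by rewrite scaler_eq0 (negPf char_neq2) => /eqP.
Qed.

(** Applying [a l] preserves such a bound once it exceeds [- l - bz], since beyond that point the
    modes anticommute. This makes all sums of modes finite on each vector. *)
Lemma fs_nil v : exists K : int, forall k, K <= k -> a k v = 0.
Proof.
move: v; apply: fs_ind.
- by exists 0 => k _; rewrite linear0.
- move=> c u v [K uK] [L vL]; exists (Num.max K L) => k.
  rewrite ge_max => /andP[Kk Lk].
  by rewrite linearP uK // vL // scaler0 addr0.
- by exists 1 => k k1; apply: fs_a_vac; case: b => /=; lia.
- move=> l u [K uK]; exists (Num.max K (1 - l - bz)) => k.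
  rewrite ge_max => /andP[Kk lk].
  rewrite fs_anti ?uK ?linear0 ?oppr0 //; lia.
Qed.

(** Differs from [normal_order] only on the diagonal, where it is set to 0 to be exactly
    antisymmetric. In characteristic other than 2 this changes only the square of the zero mode,
    which is 1/2. *)
Definition nord (i j : int) v : V :=
  if i < j then a i (a j v) else if j < i then - a j (a i v) else 0.

Lemma nord_linear i j : linear (nord i j).
Proof.
move=> c u v; rewrite /nord; case: ifP => _.
  by rewrite (linearP (a j)) (linearP (a i)).
case: ifP => _; last by rewrite scaler0 addr0.
by rewrite (linearP (a i)) (linearP (a j)) opprD scalerN.
Qed.

HB.instance Definition _ i j := GRing.isLinear.Build F V V *:%R (nord i j)
  (nord_linear i j).

Lemma nordC i j v : nord j i v = - nord i j v.
Proof. by rewrite /nord; case: ltgtP => _; rewrite ?opprK ?oppr0. Qed.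

Lemma nordE i j v : 2%:R != 0 :> F -> i + j + bz != 0 -> nord i j v = a i (a j v).
Proof.
move=> char_neq2; rewrite /nord; case: ltgtP => // [ji ij|<- ii].
  by rewrite [RHS]fs_anti.
by rewrite fs_sqr0 //; apply: contraNneq ii => <-; apply/eqP; ring.
Qed.

Lemma nord_nil v : exists K : int,
  forall i j, K <= i \/ K <= j -> nord i j v = 0.
Proof.
have [K vK] := fs_nil v; exists K => i j Kij; rewrite /nord.
by case: ltgtP => // ij; rewrite vK ?linear0 ?oppr0 //; lia.
Qed.

Lemma nord_fins n v : fins (fun i => nord i (n - i) v).
Proof.
have [K vK] := nord_nil v.
by apply: (@fins_bound _ _ _ (n - K) K) => i iK; apply: vK; lia.
Qed.

(** Normal ordering changes a product of two modes by a scalar at most, so the commutator with a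
    third mode is that of the plain product. *)
Lemma nord_a i j l v : nord i j (a l v) = a l (nord i j v)
  + ((j + l + bz == 0)%:R *: a i v - (i + l + bz == 0)%:R *: a j v).
Proof.
have E k m : a k (a m (a l v)) = a l (a k (a m v))
    + ((m + l + bz == 0)%:R *: a k v - (k + l + bz == 0)%:R *: a m v).
  rewrite (fs_carN m l) linearB linearZ /= (fs_carN k l).
  by rewrite opprB addrCA.
rewrite /nord; case: ltgtP => [ij|ji|->]; first exact: E.
  by rewrite E linearN opprD opprB.
by rewrite linear0 add0r subrr.
Qed.

(** Indices [i + b/2] and [j + b/2] add up to [n] exactly when [j = n - bz - i]. *)
Definition Phi f n v : V := zsum (fun i => f i *: nord i (n - bz - i) v).

Lemma Phi_fins f n v : fins (fun i => f i *: nord i (n - bz - i) v).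
Proof. exact/fins_scale/nord_fins. Qed.

Lemma Phi_linear f n : linear (Phi f n).
Proof.
move=> c u v; rewrite -zsumDZ; do ?exact: Phi_fins.
apply: eq_zsum => i.
by rewrite linearP scalerDr !scalerA mulrC.
Qed.

HB.instance Definition _ f n := GRing.isLinear.Build F V V *:%R (Phi f n)
  (Phi_linear f n).

Lemma eq_Phi f g n v : f =1 g -> Phi f n v = Phi g n v.
Proof. by move=> /funext ->. Qed.

Lemma PhiDZ c f g n v :
  Phi (fun i => c * f i + g i) n v = c *: Phi f n v + Phi g n v.
Proof.
rewrite -zsumDZ; do ?exact: Phi_fins.
by apply: eq_zsum => i; rewrite scalerDl scalerA.
Qed.

(** Only the part of [f] antisymmetric under [i -> n - bz - i] matters; in particular constant
    functions will give 0. *)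
Lemma PhiN f n v : Phi f n v = - Phi (fun i => f (n - bz - i)) n v.
Proof.
rewrite /Phi (zsum_flip _ (n - bz)) -[RHS]sub0r -zsum0 -zsumB; last 2 first.
- exact: fins0.
- exact: (Phi_fins (fun i => f (n - bz - i))).
by apply: eq_zsum => i; rewrite subKr nordC scalerN sub0r.
Qed.

Lemma Phi_nil v : exists K : int, forall f n, K <= n -> Phi f n v = 0.
Proof.
have [K vK] := nord_nil v; exists (K * 2 + bz) => f n Kn.
rewrite -[RHS]zsum0; apply: eq_zsum => i; rewrite vK ?scaler0 //; lia.
Qed.

(** Only two terms fail to commute with [a l]: those in which the second or the first mode is
    contracted with it, at [i = n + l] and [i = - bz - l]. *)
Lemma Phi_a f n l v :
  Phi f n (a l v) = a l (Phi f n v) + (f (n + l) - f (- bz - l)) *: a (n + l) v.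
Proof.
rewrite /Phi (zsum_linear (a l)); last exact: Phi_fins.
pose s i := (n - bz - i + l + bz == 0)%:R *: (f i *: a i v).
pose t i := (i + l + bz == 0)%:R *: (f i *: a (n - bz - i) v).
have s0 i : i != n + l -> s i = 0.
  by move=> il; rewrite /s (_ : (_ == 0) = false) ?scale0r //; lia.
have t0 i : i != - bz - l -> t i = 0.
  by move=> il; rewrite /t (_ : (_ == 0) = false) ?scale0r //; lia.
transitivity (zsum (fun i => a l (f i *: nord i (n - bz - i) v))
   + (zsum s - zsum t)).
  rewrite -zsumB; [|exact: fins1 s0|exact: fins1 t0].
  rewrite -zsumD; last 2 first.
  - exact/fins_linear/Phi_fins.
  - by apply: finsB; [exact: fins1 s0|exact: fins1 t0].
  apply: eq_zsum => i.
  rewrite nord_a [a l (_ *: _)]linearZ /= [LHS]scalerDr scalerBr !scalerA.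
  by rewrite /s /t !scalerA ![f i * _]mulrC.
rewrite (zsum1 s0) (zsum1 t0) /s /t.
rewrite (_ : n - bz - (n + l) + l + bz = 0); last by ring.
rewrite (_ : - bz - l + l + bz = 0); last by ring.
rewrite eqxx !scale1r scalerBl; congr (_ + (_ - _ *: a _ _)); ring.
Qed.

Definition even_op (Y : V -> V) :=
  (forall v, pi (Y v) = Y (pi v)) /\ (forall v, om (Y v) = Y (om v)).

Lemma nord_even i j : even_op (nord i j).
Proof.
have Ep k l v : pi (a k (a l v)) = a k (a l (pi v)).
  by rewrite fs_pi_a fs_pi_a linearN opprK.
have Eo k l v : om (a k (a l v)) = a k (a l (om v)).
  by rewrite fs_om_a fs_om_a linearN opprK.
split=> v; rewrite /nord; case: ltgtP => _.
- exact: Ep.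
- by rewrite linearN /= Ep.
- by rewrite linear0.
- exact: Eo.
- by rewrite linearN /= Eo.
- by rewrite linear0.
Qed.

Lemma zsum_even (t : int -> V -> V) : (forall v, fins (t^~ v)) ->
  (forall i, even_op (t i)) -> even_op (fun v => zsum (t^~ v)).
Proof.
move=> tf te; split=> v; rewrite zsum_linear //; apply: eq_zsum => i.
- exact: (te i).1.
- exact: (te i).2.
Qed.

Lemma Phi_even f n : even_op (Phi f n).
Proof.
apply: zsum_even => [v|i]; first exact: Phi_fins.
by split=> v; rewrite linearZ /= ((nord_even _ _).1, (nord_even _ _).2).
Qed.

Lemma fs_piK v : pi (pi v) = v.
Proof.
move: v; apply: fs_ind => [|c u v IHu IHv||k u IHu].
- by rewrite !linear0.
- by rewrite (linearP pi) (linearP pi) IHu IHv.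
- by rewrite !fs_pi_vac.
- by rewrite fs_pi_a linearN /= fs_pi_a opprK IHu.
Qed.

Lemma fs_pi_om v : pi (om v) = - om (pi v).
Proof.
move: v; apply: fs_ind => [|c u v IHu IHv||k u IHu].
- by rewrite !linear0.
- by rewrite (linearP om) (linearP pi) IHu IHv (linearP pi) (linearP om) opprD scalerN.
- by rewrite fs_pi_vac fs_om_vac linearZ /= fs_pi_a fs_pi_vac scalerN.
- rewrite (fs_om_a k u) (linearN pi) (fs_pi_a k (om u)) opprK IHu.
  by rewrite (fs_pi_a k u) (linearN om) (fs_om_a k (pi u)) opprK (linearN (a k)).
Qed.

End FermiTheory.

(** * Uniqueness of the vacuum and Schur's lemma for the modes *)

Section FermiSchur.
Context {F : fieldType} {b : bool} (S : fermiSpace F b).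
Local Notation V := (fs_sort S).
Local Notation a := (fs_a S).
Local Notation vac := (fs_vac S).
Local Notation pi := (fs_pi S).
Local Notation om := (fs_om S).
Local Notation bz := (b%:Z).
Implicit Types (v : V).

(** The span of the monomials in the first [N] creation modes, built one mode at a time. For
    integral indices the first of them is the zero mode. *)
Fixpoint Sp (N : nat) v : Prop :=
  if N is N'.+1 then exists x y, [/\ Sp N' x, Sp N' y & v = x + a (- bz - N'%:Z) y]
  else exists c, v = c *: vac.

Lemma Sp_lin N (c : F) u v : Sp N u -> Sp N v -> Sp N (c *: u + v).
Proof.
elim: N u v => [|N IHN] u v /=.
  by move=> [x ->] [y ->]; exists (c * x + y); rewrite scalerDl scalerA.
move=> [x [y [Sx Sy ->]]] [x' [y' [Sx' Sy' ->]]].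
exists (c *: x + x'), (c *: y + y'); split; do ?exact: IHN.
by rewrite linearP scalerDr addrACA.
Qed.

Lemma Sp0 N : Sp N 0.
Proof.
elim: N => [|N IHN] /=; first by exists 0; rewrite scale0r.
by exists 0, 0; rewrite linear0 addr0.
Qed.

Lemma SpZ N (c : F) u : Sp N u -> Sp N (c *: u).
Proof. by move=> Su; rewrite -[_ *: _]addr0; apply: Sp_lin => //; exact: Sp0. Qed.

Lemma Sp_mono M N v : (M <= N)%N -> Sp M v -> Sp N v.
Proof.
move=> /subnK <-; elim: (N - M)%N => //= k IHk Sv.
by exists v, 0; rewrite linear0 addr0; split; [exact: IHk|exact: Sp0|].
Qed.

Lemma Sp_low N v (k : int) : Sp N v -> N%:Z <= k -> 0 < k * 2 + bz -> a k v = 0.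
Proof.
elim: N v => [|N IHN] v /=.
  by move=> [c ->] _ k0; rewrite linearZ /= fs_a_vac // scaler0.
move=> [x [y [Sx Sy ->]]] Nk k0; rewrite linearD /= fs_anti; last by lia.
by rewrite !IHN ?linear0 ?oppr0 ?addr0 //; lia.
Qed.

Lemma Sp_create N v : Sp N v -> (0 < N)%N || b ->
  a N%:Z (a (- bz - N%:Z) v) = v.
Proof.
move=> Sv N0; rewrite fs_carN (Sp_low Sv) ?linear0 ?oppr0; last 2 first.
- by [].
- by lia.
by rewrite addr0 (_ : _ + bz = 0) ?eqxx ?scale1r //; lia.
Qed.

Context (char_neq2 : 2%:R != 0 :> F).

Lemma Sp_stable N v k : Sp N v -> - bz - N%:Z < k -> k < N%:Z -> Sp N (a k v).
Proof.
elim: N v => [|N IHN] v /=; first by lia.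
move=> [x [y [Sx Sy ->]]] k1 k2; rewrite linearD /=.
have [kN|kN] := eqVneq k (- bz - N%:Z).
  (* The square of a mode is half its anticommutator with itself, nonzero only for the zero mode. *)
  rewrite -kN; exists (2%:R^-1 *: ((k + k + bz == 0)%:R *: y)), x; split=> //.
    by do 2!apply: SpZ.
  rewrite addrC -(fs_car k k) -[X in X + X]scale1r -scalerDl scalerA.
  by rewrite mulVf // scale1r.
have [kN'|kN'] := eqVneq k N%:Z.
  rewrite kN' (Sp_low Sx) //; last by lia.
  rewrite add0r Sp_create //; last by lia.
  by exists y, 0; rewrite linear0 addr0; split=> //; exact: Sp0.
exists (a k x), (- a k y); split; first by apply: IHN => //; lia.
  by rewrite -scaleN1r; apply: SpZ; apply: IHN => //; lia.
by rewrite linearN /= [in LHS]fs_anti //; lia.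
Qed.

Lemma Sp_all v : exists N, Sp N v.
Proof.
move: v; apply: fs_ind => [|c u v [M uM] [N vN]||k u [N uN]].
- by exists 0%N; exact: Sp0.
- exists (maxn M N); apply: Sp_lin; last exact: Sp_mono (leq_maxr _ _) _.
  exact: Sp_mono (leq_maxl _ _) _.
- by exists 0%N; exists 1; rewrite scale1r.
- exists (maxn N `|k|.+1); apply: Sp_stable; last 2 first.
  + by lia.
  + by lia.
  exact: Sp_mono (leq_maxl _ _) _.
Qed.

(** The mode [a N] extracts the coefficient of the top creation mode, which must then vanish. The
    descent stops at 0, or at 1 for integral indices, where [a 0] is not among the annihilating
    modes. *)
Lemma Sp_kill v : (forall k, 0 < k * 2 + bz -> a k v = 0) -> Sp (~~ b) v.
Proof.
move=> v0; have [N] := Sp_all v; elim: N => [|N IHN] Sv.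
  exact: Sp_mono Sv.
have [/orP N0|] := boolP ((0 < N)%N || b); last first.
  rewrite negb_or -eqn0Ngt => /andP[/eqP N0 bN].
  by move: Sv; rewrite N0 bN.
case: Sv => x [y [Sx Sy vE]]; apply: IHN.
have : a N%:Z v = 0 by apply: v0; lia.
rewrite vE linearD /= (Sp_low Sx) //; last by lia.
by rewrite add0r Sp_create // => [->|]; rewrite ?linear0 ?addr0 //; exact/orP.
Qed.

(** For integral indices [c vac + d a(0) vac] is left; [a 0] and [om] agree on [vac] but differ by a
    sign on [a 0 vac], so [d = 0]. *)
Lemma vac_uniq v : (forall k, 0 < k * 2 + bz -> a k v = 0) ->
  (~~ b -> a 0 v = om v) -> exists c, v = c *: vac.
Proof.
move=> /Sp_kill; case bE: (~~ b) => /=; last by [].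
move=> [x [y [[c ->] [d ->] ->]]] /(_ isT).
have b0 : b%:Z = 0 by lia.
rewrite b0 subrr !linearD !linearZ /= fs_om_a fs_om_vac bE scale1r.
have <- : 2%:R^-1 *: vac = a 0 (a 0 vac).
  have := fs_car 0 0 vac; rewrite b0 !addr0 eqxx.
  rewrite -[X in X + X]scale1r -scalerDl => E.
  by apply: (scalerI char_neq2); rewrite scalerA mulfV //; exact: esym E.
move=> /addrI; rewrite scalerN scalerA => /eqP.
rewrite -subr_eq0 opprK -scalerDl (_ : _ + _ = d); last by field.
rewrite scaler_eq0 (negPf (fs_vac_neq0 S)) orbF => /eqP ->.
by exists c; rewrite scale0r addr0.
Qed.

(** [Y vac] satisfies the conditions of [vac_uniq], and the resulting scalar propagates along the
    modes. *)
Lemma fs_schur (Y : {linear V -> V}) :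
  (forall k v, Y (a k v) = a k (Y v)) -> (forall v, om (Y v) = Y (om v)) ->
  exists c, forall v, Y v = c *: v.
Proof.
move=> Ya Yo.
have [k k0||c Yc] := @vac_uniq (Y vac).
- by rewrite -Ya fs_a_vac // linear0.
- by move=> bN; rewrite Yo -Ya fs_om_vac bN scale1r.
exists c; apply: fs_ind => [|d u v IHu IHv||k u IHu] //.
- by rewrite linear0 scaler0.
- by rewrite linearP IHu IHv scalerDr !scalerA mulrC.
- by rewrite Ya IHu linearZ.
Qed.

(* An odd operator anticommuting with everything vanishes, being a multiple of
   the (even) parity operator. *)
Lemma fs_schur2 (Y : {linear V -> V}) : even_op Y ->
  (forall l m v, Y (a l (a m v)) - a l (Y (a m v))
                 + (a m (Y (a l v)) - a m (a l (Y v))) = 0) ->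
  exists c, forall v, Y v = c *: v.
Proof.
move=> [Yp Yo] Y2.
have Ya l v : Y (a l v) = a l (Y v).
  (* The hypothesis says that [[Y, a l]] anticommutes with every mode; its composite with [pi] then
     commutes with them and is a scalar. *)
  pose Z v := pi (Y (a l v) - a l (Y v)).
  have Zl : linear Z.
    move=> c u w; rewrite /Z -(linearP pi) (linearP (a l)) !(linearP Y).
    by rewrite (linearP (a l)) opprD addrACA scalerBr.
  pose ZL := GRing.isLinear.Build F V V *:%R Z Zl.
  pose Z' : {linear V -> V} := HB.pack Z ZL.
  have [k w|w|c Zc] := @fs_schur Z'.
  - have E : Y (a l (a k w)) - a l (Y (a k w)) = - a k (Y (a l w) - a l (Y w)).
      by apply/eqP; rewrite -addr_eq0 (linearB (a k)) Y2.
    by rewrite /= /Z E (linearN pi) fs_pi_a opprK.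
  - rewrite /= /Z -[LHS]opprK -fs_pi_om -(linearN pi).
    congr (pi _); rewrite (linearB om) Yo !fs_om_a (linearN Y) Yo.
    by rewrite opprB opprK addrC.
  have Ec : Y (a l vac) - a l (Y vac) = c *: vac.
    by rewrite -[LHS]fs_piK [pi (_ - _)]Zc linearZ /= fs_pi_vac.
  (* [[Y, a l]] is odd while the vacuum is even. *)
  have : c *: vac = - (c *: vac).
    rewrite -{1}fs_pi_vac -linearZ /= -Ec linearB /= fs_pi_a !Yp fs_pi_a.
    by rewrite linearN fs_pi_vac opprB opprK addrC.
  move=> /eqP; rewrite -subr_eq0 opprK -scalerDl -mulr2n -mulr_natr.
  rewrite scaler_eq0 (negPf (fs_vac_neq0 S)) orbF mulf_eq0 (negPf char_neq2).
  rewrite orbF => /eqP c0; apply/eqP; rewrite -subr_eq0; apply/eqP.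
  by rewrite -[LHS]fs_piK [pi (_ - _)]Zc c0 scale0r linear0.
exact: fs_schur.
Qed.

End FermiSchur.

(** * Normally ordered products of quadratic fields *)

Section NormalProduct.
Context {F : fieldType} {b : bool} (S : fermiSpace F b).
Context (char_neq2 : 2%:R != 0 :> F).
Local Notation V := (fs_sort S).
Local Notation a := (fs_a S).
Local Notation bz := (b%:Z).
Local Notation nord := (@nord _ _ S).
Local Notation Phi := (@Phi _ _ S).
Implicit Types (f g h : int -> F) (v : V).

(** The scalar by which ordering the pair [a t], [a (- bz - t)] according to [t < l] differs from
    normal ordering. It vanishes for all but finitely many [t]. *)
Definition eps (l t : int) : F :=
  (t < l)%R%:R - (t * 2 + bz < 0)%R%:R - 2%:R^-1 * (t * 2 + bz == 0)%:R.

Lemma eps_fins (V' : lmodType F) l (t : int -> V') : fins (fun i => eps l i *: t i).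
Proof.
apply: (@fins_bound _ _ _ (Num.min l 0 - 2) (Num.max l 0 + 2)) => i.
rewrite /eps => il; rewrite [_ == 0](_ : _ = false); last by lia.
rewrite (_ : (_ < l) = (i * 2 + bz < 0)); last by lia.
by rewrite subrr mulr0 subrr scale0r.
Qed.

(** The ordering that arises in commutators with [nprod]: its split at [k < 0] becomes a split at
    [k + l < l]. *)
Let cut (l i j : int) v : V := if i < l then a i (a j v) else - a j (a i v).

Let cutE l i j v :
  cut l i j v = nord i j v + ((i + j + bz == 0)%:R * eps l i) *: v.
Proof.
rewrite /cut; have [ij0|ij0] := eqVneq (i + j + bz) 0; last first.
  rewrite mul0r scale0r addr0 nordE //; case: ifP => // _.
  by rewrite [RHS]fs_anti.
have E : a i (a j v) = v - a j (a i v) by rewrite fs_carN ij0 eqxx scale1r.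
rewrite mul1r /eps /nord.
case: (ltgtP i j) => ij.
- have -> : (i * 2 + bz < 0) = true by lia.
  have -> : (i * 2 + bz == 0) = false by lia.
  rewrite mulr0 subr0; case: ifP => _ /=; first by rewrite subrr scale0r addr0.
  by rewrite sub0r scaleN1r E addrAC subrr sub0r.
- have -> : (i * 2 + bz < 0) = false by lia.
  have -> : (i * 2 + bz == 0) = false by lia.
  rewrite mulr0 !subr0; case: ifP => _ /=; last by rewrite scale0r addr0.
  by rewrite scale1r E addrC.
have -> : (i * 2 + bz < 0) = false by lia.
have -> : (i * 2 + bz == 0) = true by lia.
have {}E : a i (a i v) = 2%:R^-1 *: v.
  apply: (scalerI char_neq2); rewrite scalerA mulfV //.
  move: E; rewrite -ij => E.
  by rewrite scale1r scaler_nat mulr2n {1}E subrK.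
rewrite -ij E add0r mulr1 subr0; case: ifP => _; last by rewrite sub0r scaleNr.
have half : 2%:R^-1 = 1 - 2%:R^-1 :> F by field.
by congr (_ *: _); exact: half.
Qed.

Let addK (x y : V) : x + y - x = y.
Proof. by rewrite addrAC subrr add0r. Qed.

(** The anticommutator of [[Y, a l]] with [a m]; by [fs_schur2] it determines an even operator up to
    a scalar. *)
Let comm2 (Y : V -> V) l m v :=
  Y (a l (a m v)) - a l (Y (a m v)) + (a m (Y (a l v)) - a m (a l (Y v))).

Let comm2_Phi f n l m v : comm2 (Phi f n) l m v
  = ((f (n + l) - f (- bz - l)) * (n + l + m + bz == 0)%:R) *: v.
Proof.
rewrite /comm2 !(Phi_a f n l) linearD /= !addK.
by rewrite linearZ /= -scalerDr fs_car scalerA.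
Qed.

Let alpha f n l := f (n + l) - f (- bz - l).

Let comm2_comp f g k n l m v : comm2 (fun v => Phi f k (Phi g n v)) l m v
 = (alpha f k l * (k + l + m + bz == 0)%:R) *: Phi g n v
 + (alpha f k l * alpha g n m) *: a (k + l) (a (n + m) v)
 + ((alpha g n l * (n + l + m + bz == 0)%:R) *: Phi f k v
 - (alpha g n l * alpha f k m) *: a (k + m) (a (n + l) v)).
Proof.
have D w : Phi f k (Phi g n (a l w)) = a l (Phi f k (Phi g n w))
   + (alpha f k l *: a (k + l) (Phi g n w) + alpha g n l *: Phi f k (a (n + l) w)).
  by rewrite (Phi_a g n l) linearD linearZ /= (Phi_a f k l) addrA.
rewrite /comm2 (D (a m v)) (D v) (linearD (a m)) !addK.
rewrite (linearD (a m)) !linearZ /= addrACA -!scalerDr; congr (_ + _).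
  rewrite (Phi_a g n m) (linearD (a (k + l))) [a (k + l) (_ *: _)]linearZ /=.
  rewrite addrAC fs_car.
  by rewrite scalerDr !scalerA.
rewrite -[X in _ *: (_ + X)](addrK (alpha f k m *: a (k + m) (a (n + l) v))).
rewrite -(Phi_a f k m) addrA -(linearD (Phi f k)) fs_car linearZ /=.
by rewrite scalerBr !scalerA scalerN.
Qed.

Section Product.
Variables (f g : int -> F) (n : int).

(* The n-th mode of the normally ordered product of the fields with modes
   Phi f and Phi g. *)
Definition nprod_term (k : int) v : V :=
  if k < 0 then Phi f k (Phi g (n - k) v) else Phi g (n - k) (Phi f k v).

Definition nprod v : V := zsum (nprod_term^~ v).

Lemma nprod_term_linear k : linear (nprod_term k).
Proof. by move=> c u v; rewrite /nprod_term; case: ifP => _; rewrite !linearP. Qed.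

HB.instance Definition _ k := GRing.isLinear.Build F V V *:%R (nprod_term k)
  (nprod_term_linear k).

Lemma nprod_fins v : fins (nprod_term^~ v).
Proof.
have [K vK] := Phi_nil v.
apply: (@fins_bound _ _ _ (Num.min (n - K) (- 1)) (Num.max K 0)) => k kK.
rewrite /nprod_term; case: ifP => k0; rewrite vK ?linear0 //; lia.
Qed.

Lemma nprod_linear : linear nprod.
Proof.
move=> c u v; rewrite -zsumDZ; do ?exact: nprod_fins.
by apply: eq_zsum => k; rewrite linearP.
Qed.

(** The coefficients of the quadratic terms of [comm2_comp] after the substitutions [i = k + l],
    here, and [i = k + m], in [w2]. *)
Let w1 l m i := (f i - f (- bz - l)) * (g (n + l + m - i) - g (- bz - m)).
Let w2 l m i := (g (n + l + m - i) - g (- bz - l)) * (f i - f (- bz - m)).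

Let comm2_term k l m v : comm2 (nprod_term k) l m v
  = (w1 l m (k + l) *: cut l (k + l) (n + l + m - (k + l)) v
     - w2 l m (k + m) *: cut m (k + m) (n + l + m - (k + m)) v)
  + ((alpha f k l * (k + l + m + bz == 0)%:R) *: Phi g (n - k) v
     + (alpha g (n - k) l * (n - k + l + m + bz == 0)%:R) *: Phi f k v).
Proof.
rewrite /w1 /w2.
rewrite (_ : n + l + m - (k + l) = n - k + m); last by ring.
rewrite (_ : n + l + m - (k + m) = n - k + l); last by ring.
rewrite -!/(alpha _ _ _) /cut /nprod_term.
have -> : (k + l < l) = (k < 0) by lia.
have -> : (k + m < m) = (k < 0) by lia.
case: (k < 0); rewrite [LHS]comm2_comp.
  by rewrite addrACA [LHS]addrC.
rewrite !scalerN opprK addrACA [LHS]addrC.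
by congr (_ + _); exact: addrC.
Qed.

Let zsum_cut w l N v : zsum (fun i => w i *: cut l i (N - i) v)
  = Phi w (N + bz) v
    + ((N + bz == 0)%:R * zsum (fun i => eps l i *: (w i : F^o))) *: v.
Proof.
have -> : Phi w (N + bz) v = zsum (fun i => w i *: nord i (N - i) v).
  by apply: eq_zsum => i; rewrite addrK.
have -> : ((N + bz == 0)%:R * zsum (fun i => eps l i *: (w i : F^o))) *: v
    = zsum (fun i => eps l i *: (((N + bz == 0)%:R * w i) *: v)).
  pose mul (x : F^o) : V := ((N + bz == 0)%:R * x : F) *: v.
  have L : linear mul.
    rewrite /mul; move=> c x y; rewrite -[c *: x + y]/(c * x + y : F).
    by rewrite mulrDr scalerDl scalerA mulrCA.
  pose LL := GRing.isLinear.Build F F^o V *:%R mul L.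
  pose L' : {linear F^o -> V} := HB.pack mul LL.
  rewrite -[LHS]/(L' _) zsum_linear; last exact: (@eps_fins F^o).
  apply: eq_zsum => i; rewrite /= /mul scalerA.
  by congr (_ *: _); rewrite mulrCA.
rewrite -zsumD; [|exact/fins_scale/nord_fins|exact: eps_fins].
apply: eq_zsum => i; rewrite cutE scalerDr !scalerA.
rewrite (_ : i + (N - i) + bz = N + bz); last by ring.
by congr (_ + _ *: _); ring.
Qed.

Let fins_cut w l N v : fins (fun i => w i *: cut l i (N - i) v).
Proof.
apply: fins_scale.
have [A AE] := finsD (nord_fins N v)
  (eps_fins l (fun i => (i + (N - i) + bz == 0)%:R *: v)).
by exists A => i /AE; rewrite cutE scalerA mulrC.
Qed.

Let comm2_nprod l m v : comm2 nprod l m v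
  = zsum (fun k => comm2 (nprod_term k) l m v).
Proof.
have fn := nprod_fins; have fl w p : fins (fun k => a p (nprod_term k w)).
  exact/fins_linear/fn.
rewrite /comm2 /nprod !(zsum_linear (a _)); do ?[exact: fn|exact: fl].
rewrite -!zsumB; do ?[exact: fn|exact: fl|exact/fins_linear/fl].
rewrite -zsumD //.
- by apply: finsB; [exact: fn|exact: fl].
- by apply: finsB; [exact: fl|exact/fins_linear/fl].
Qed.

(** Chosen so that the contractions left in [comm2 nprod l m] are [nprod_fun l - nprod_fun m] when
    [n + l + m + bz = 0], as for the operator [Phi] with this function shifted by [n]. *)
Definition nprod_fun (l : int) : F := zsum (fun i =>
  eps l i *: ((f i - f (- bz - l)) * (g (- bz - i) - g (n + l)) : F^o)).

(** The quadratic terms combine into [Phi] of a constant function, which vanishes by antisymmetry.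
    This is where the absence of a quartic part shows. *)
Let Phi_quad l m v : let N := n + l + m in
  Phi (w1 l m) (N + bz) v - Phi (w2 l m) (N + bz) v
  + ((f (- bz - m) - f (- bz - l)) *: Phi g (N + bz) v
     + (g (- bz - m) - g (- bz - l)) *: Phi f (N + bz) v) = 0.
Proof.
move=> N; rewrite (PhiN g).
pose c : F := f (- bz - l) * g (- bz - m) - g (- bz - l) * f (- bz - m).
have c0 : Phi (fun=> c) (N + bz) v = 0.
  apply: (scalerI char_neq2); rewrite scaler0 scaler_nat mulr2n {1}PhiN.
  by rewrite addNr.
set c3 := f _ - f _; set c4 := g _ - g _.
have E (A B C D : V) : A - B + (c3 *: - C + c4 *: D)
    = (-1) *: B + ((- c3) *: C + (c4 *: D + A)).
  rewrite scaleN1r scaleNr scalerN [A - B]addrC -addrA; congr (_ + _).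
  by rewrite addrC -addrA.
rewrite E -!PhiDZ -[RHS]c0.
apply: eq_Phi => i; rewrite /w1 /w2 /c /c3 /c4 addrK -/N; ring.
Qed.

(** Both operators are even and have the same [comm2] with all pairs of modes, so [fs_schur2]
    applies to their difference. *)
Lemma nprodE : exists c, forall v,
  nprod v = Phi (fun x => nprod_fun (x - n)) n v + c *: v.
Proof.
pose h x := nprod_fun (x - n); pose Y v := nprod v - Phi h n v.
have Yl : linear Y.
  move=> c u v; rewrite /Y nprod_linear linearP.
  by rewrite opprD addrACA scalerBr.
pose YL := GRing.isLinear.Build F V V *:%R Y Yl.
pose Y' : {linear V -> V} := HB.pack Y YL.
have Ye : even_op Y.
  have [Pp Po] := Phi_even S h n.
  have [||Xp Xo] := @zsum_even _ _ S nprod_term.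
  - exact: nprod_fins.
  - move=> k; have [p1 o1] := Phi_even S f k; have [p2 o2] := Phi_even S g (n - k).
    split=> v; rewrite /nprod_term; case: ifP => _.
    + by rewrite p1 p2.
    + by rewrite p2 p1.
    + by rewrite o1 o2.
    + by rewrite o2 o1.
  split=> v.
  - by rewrite /Y (linearB (fs_pi S)) Pp; congr (_ - _); exact: Xp.
  - by rewrite /Y (linearB (fs_om S)) Po; congr (_ - _); exact: Xo.
have [l m v|c Yc] := @fs_schur2 _ _ S char_neq2 Y' Ye; last first.
  by exists c => v; rewrite -Yc /= /Y addrC subrK.
have E : comm2 nprod l m v = comm2 (Phi h n) l m v.
  rewrite comm2_nprod (eq_zsum (fun k => comm2_term k l m v)).
  pose N := n + l + m.
  pose p i := w1 l m i *: cut l i (N - i) v.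
  pose q i := w2 l m i *: cut m i (N - i) v.
  pose U k := (alpha f k l * (k + l + m + bz == 0)%:R) *: Phi g (n - k) v.
  pose W k := (alpha g (n - k) l * (n - k + l + m + bz == 0)%:R) *: Phi f k v.
  have pf : fins p by exact: fins_cut.
  have qf : fins q by exact: fins_cut.
  have U0 k : k != - l - m - bz -> U k = 0.
    move=> kE; rewrite /U.
    have -> : (k + l + m + bz == 0) = false by lia.
    by rewrite mulr0 scale0r.
  have W0 k : k != N + bz -> W k = 0.
    rewrite /N => kE; rewrite /W.
    have -> : (n - k + l + m + bz == 0) = false by lia.
    by rewrite mulr0 scale0r.
  rewrite [LHS](_ : _ = zsum (fun k => (p (k + l) - q (k + m)) + (U k + W k))) //.
  (* The two quadratic families are reindexed by different shifts, [k + l] and [k + m]; [U] and [W]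
     each have a single nonzero term. *)
  have pf' := fins_shift l pf; have qf' := fins_shift m qf.
  have Uf := fins1 U0; have Wf := fins1 W0.
  rewrite zsumD; [|exact: finsB|exact: finsD].
  rewrite zsumB // zsumD // -(zsum_shift p) -(zsum_shift q).
  rewrite (zsum1 U0) (zsum1 W0) !zsum_cut /U /W.
  rewrite (_ : n - (- l - m - bz) = N + bz); last by rewrite /N; ring.
  rewrite (_ : - l - m - bz + l + m + bz = 0); last by ring.
  rewrite (_ : n - (N + bz) + l + m + bz = 0); last by rewrite /N; ring.
  rewrite eqxx !mulr1 /alpha.
  rewrite (_ : - l - m - bz + l = - bz - m); last by ring.
  rewrite (_ : n - (N + bz) + l = - bz - m); last by rewrite /N; ring.
  have R (A B C D E : V) : A + B - (C + D) + E = A - C + E + (B - D).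
    by rewrite opprD [in LHS]addrACA [LHS]addrAC.
  rewrite R (Phi_quad l m v) add0r comm2_Phi.
  rewrite -scalerBl -mulrBr -/N mulrC.
  have [N0|] := eqVneq (N + bz) 0; last by rewrite !mulr0.
  have Nm : n + l = - bz - m by move: N0; rewrite /N; lia.
  have Nl : - bz - l = n + m by move: N0; rewrite /N; lia.
  rewrite !mulr1 /h; congr ((_ - _) *: _).
    rewrite /nprod_fun (_ : n + l - n = l); last by ring.
    apply: (@eq_zsum F F^o) => i; congr (_ *: _); rewrite /w1 -/N.
    by rewrite (_ : N - i = - bz - i) ?Nm //; move: N0; lia.
  rewrite /nprod_fun (_ : - bz - l - n = m); last by rewrite Nl; ring.
  apply: (@eq_zsum F F^o) => i; congr (_ *: _); rewrite /w2 -/N.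
  by rewrite (_ : N - i = - bz - i) ?Nl 1?mulrC //; move: N0; lia.
have R (x y z t : V) : (x - y) - (z - t) = (x - z) - (y - t).
  by rewrite !opprB [t - z]addrC addrACA [- y + t]addrC.
rewrite -[LHS]/(comm2 Y l m v) -(subrr (comm2 (Phi h n) l m v)) -{1}E.
rewrite /comm2 /Y (linearB (a l)) !(linearB (a m)) (linearB (a l)).
by rewrite ?(linearB (a m)) [X in X + _]R [X in _ + X]R addrACA -opprD.
Qed.

End Product.
End NormalProduct.

(** * Stability under all quadratic operators *)

Section PolynomialFunctions.
Context {F : fieldType}.
Implicit Types (f g h : int -> F) (c d : F).

(* f is a polynomial function of degree at most N, and N! times its
   coefficient of degree N is c (in the sense of finite differences, so that
   N! need not be invertible). *)
Fixpoint pdeg (N : nat) f c : Prop :=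
  if N is N'.+1 then pdeg N' (fun x => f (x + 1) - f x) c
  else forall x, f x = c.

Lemma eq_pdeg N f g c : f =1 g -> pdeg N f c -> pdeg N g c.
Proof. by move=> /funext ->. Qed.

Lemma pdegDZ N f g c d k :
  pdeg N f c -> pdeg N g d -> pdeg N (fun x => k * f x + g x) (k * c + d).
Proof.
elim: N f g => [|N IHN] f g /=; first by move=> fc gd x; rewrite fc gd.
move=> /IHN{}IHN /IHN; apply: eq_pdeg => x; ring.
Qed.

Lemma pdegZ N f c k : pdeg N f c -> pdeg N (fun x => k * f x) (k * c).
Proof.
elim: N f => [|N IHN] f /=; first by move=> fc x; rewrite fc.
by move=> /IHN; apply: eq_pdeg => x; rewrite mulrBr.
Qed.

Lemma pdeg_shift N f c s : pdeg N f c -> pdeg N (fun x => f (x + s)) c.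
Proof.
elim: N f => [|N IHN] f /=; first by move=> fc x; rewrite fc.
by move=> /IHN; apply: eq_pdeg => x; rewrite addrAC.
Qed.

Lemma pdeg_flip N f c s :
  pdeg N f c -> pdeg N (fun x => f (s - x)) ((-1) ^+ N * c).
Proof.
elim: N f s => [|N IHN] f s /=; first by move=> fc x; rewrite fc expr0 mul1r.
move=> /(IHN _ (s - 1)) /(pdegZ (-1)); rewrite exprS -mulrA.
apply: eq_pdeg => x; rewrite (_ : s - 1 - x + 1 = s - x); last by ring.
rewrite (_ : s - (x + 1) = s - 1 - x); last by ring.
by rewrite mulN1r opprB.
Qed.

(** The binomial coefficient comes from normalizing leading coefficients by factorials. The
    induction uses the discrete Leibniz rule, which lowers [r] in one term and [s] in the other,
    hence the bound on [r + s]. *)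
Lemma pdegM r s f g c d : pdeg r f c -> pdeg s g d ->
  pdeg (r + s) (fun x => f x * g x) ('C(r + s, r)%:R * (c * d)).
Proof.
move: {2}(r + s)%N (leqnn (r + s)) => n.
elim: n r s f g => [|n IHn] r s f g.
  case: r s => [|//] [|//] _ /= fc gd x.
  by rewrite fc gd bin0 mul1r.
case: r s => [|r] [|s] rsn.
- by move=> fc gd x; rewrite fc gd bin0 mul1r.
- move=> fc /(pdegZ c); rewrite bin0 mul1r; apply: eq_pdeg => x.
  by rewrite fc.
- move=> /(pdegZ d) + gd; rewrite addn0 binn mul1r mulrC; apply: eq_pdeg => x.
  by rewrite gd mulrC.
move=> fc gd; rewrite addSn addnS.
have E1 := IHn r s.+1 _ _ _ fc (pdeg_shift 1 gd).
have E2 := IHn r.+1 s _ _ _ fc gd.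
rewrite -addSnnS in E1; have sn : (r.+1 + s <= n)%N by lia.
have := pdegDZ 1 (E2 sn) (E1 sn).
rewrite mul1r -mulrDl binS natrD => /=; apply: (@eq_pdeg (r + s).+1) => x.
ring.
Qed.

Lemma pdeg_lower N f : pdeg N.+1 f 0 -> exists c, pdeg N f c.
Proof.
elim: N f => [|N IHN] f; last exact: IHN.
move=> /= f0; exists (f 0).
have up (x : int) (n : nat) : f (x + n%:Z) = f x.
  elim: n => [|n IHn]; first by rewrite addr0.
  by apply/eqP; rewrite -IHn -subr_eq0 -(f0 (x + n%:Z)) -addrA -PoszD addn1.
move=> x; have [x0|x0] := leP 0 x.
  by rewrite -[x]add0r -(gez0_abs x0) up.
by rewrite -(up x (absz x)); congr f; lia.
Qed.

(** A discrete antiderivative, obtained by summing from 0 in both directions. It divides by nothing,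
    so it serves in every characteristic. *)
Lemma pdeg_exists (h : int -> F) : exists H, forall x, H (x + 1) - H x = h x.
Proof.
pose H (x : int) : F := if 0 <= x then \sum_(i < absz x) h i%:Z
  else - \sum_(i < absz x) h (- i.+1%:Z).
exists H => x; rewrite /H; have [x0|x0] := leP 0 x.
  rewrite (_ : 0 <= x + 1); last by lia.
  rewrite (_ : absz (x + 1) = (absz x).+1); last by lia.
  by rewrite big_ord_recr /= addrAC subrr add0r; congr h; lia.
rewrite (_ : absz x = (absz (x + 1)).+1); last by lia.
rewrite big_ord_recr /= opprK.
have [x1|x1] := leP 0 (x + 1).
  rewrite (_ : absz (x + 1) = 0%N) ?big_ord0; last by lia.
  by rewrite !add0r; congr h; lia.
rewrite addrA addNr add0r; congr h; lia.
Qed.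

Lemma pdeg_monic N : exists f, pdeg N f 1.
Proof.
elim: N => [|N [f f1]]; first by exists (fun=> 1).
have [H HE] := pdeg_exists f; exists H => /=.
by apply: eq_pdeg f1 => x; rewrite HE.
Qed.

(** Interpolate the differences on one point fewer, then sum and adjust the value at [lo]. No
    division by differences of nodes occurs, so the window may be longer than the characteristic. *)
Lemma pdeg_interpolate (m : nat) (lo : int) q : exists N p c,
  pdeg N p c /\ forall i, lo <= i -> i < lo + m%:Z -> p i = q i.
Proof.
elim: m q => [|m IHm] q.
  by exists 0%N, (fun=> 0), 0; split=> // i; lia.
have [N [p [c [pc pq]]]] := IHm (fun x => q (x + 1) - q x).
have [H HE] := pdeg_exists p; exists N.+1, (fun x => H x + (q lo - H lo)), c.
split=> [|i i0 im].
  by apply: eq_pdeg pc => x; rewrite -HE; ring.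
have [k kE] : exists k : nat, i = lo + k%:Z by exists (absz (i - lo)); lia.
have : (k < m.+1)%N by lia.
rewrite kE; elim: k {i i0 im kE} => [|k IHk] km; first by rewrite addr0; ring.
have -> : lo + k.+1%:Z = lo + k%:Z + 1 by lia.
have E : H (lo + k%:Z + 1) - H (lo + k%:Z) = q (lo + k%:Z + 1) - q (lo + k%:Z).
  by rewrite HE; apply: pq; lia.
have {}IHk := IHk (ltnW km).
apply: (addIr (- q (lo + k%:Z))); rewrite -{}E -{}IHk; ring.
Qed.

End PolynomialFunctions.

Section QuadraticStability.
Context {F : fieldType} {b : bool} (S : fermiSpace F b).
Context (char_neq2 : 2%:R != 0 :> F).
Local Notation V := (fs_sort S).
Local Notation a := (fs_a S).
Local Notation bz := (b%:Z).
Local Notation Phi := (@Phi _ _ S).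
Local Notation eps := (@eps F b).
Implicit Types (f g h : int -> F) (v : V).

(* Up to sign, the leading coefficient of nprod_fun f g when f and g are monic
   of degrees r and s with r + s even. *)
Definition nprod_lead (r s : nat) : F :=
  'C((r + s).+2, r.+1)%:R - (-1) ^+ r * ((r + s).+2%:R * 'C(r + s, r)%:R).

Let sum h (l : int) : F := zsum (fun i => eps l i *: (h i : F^o)).

(** Summation against [eps] is a discrete antiderivative, so it raises the degree by one and keeps
    the normalized leading coefficient. *)
Let sumS h l : sum h (l + 1) - sum h l = h l.
Proof.
have D j : eps (l + 1) j - eps l j = (j == l)%:R.
  have R (x y z w : F) : x - z - w - (y - z - w) = x - y by ring.
  rewrite /eps R; case: (ltgtP j l) => jl.
  - by rewrite (_ : j < l + 1) ?subrr //; lia.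
  - by rewrite (_ : j < l + 1 = false) ?subrr //; lia.
  - by rewrite (_ : j < l + 1) ?subr0 //; lia.
rewrite /sum -(@zsumB F F^o); [|exact: eps_fins..].
rewrite (@zsum1 F F^o _ l) => [|j jl]; rewrite -scalerBl D ?eqxx ?scale1r //.
by rewrite (negPf jl) scale0r.
Qed.

Let sumDZ (k : F) u w l :
  sum (fun i => k * u i + w i) l = k * sum u l + sum w l.
Proof.
rewrite /sum; transitivity (k *: zsum (fun i => eps l i *: (u i : F^o))
  + zsum (fun i => eps l i *: (w i : F^o))); last by [].
rewrite -(@zsumDZ F F^o); do ?exact: eps_fins.
apply: (@eq_zsum F F^o) => i.
rewrite -[LHS]/(eps l i * (k * u i + w i)).
by rewrite -[RHS]/(k * (eps l i * u i) + eps l i * w i) mulrDr mulrCA.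
Qed.

Let sum0 l : sum (fun=> 0) l = 0.
Proof.
by rewrite -[RHS](@zsum0 F F^o); apply: (@eq_zsum F F^o) => i; rewrite scaler0.
Qed.

Lemma nprod_fun_lead f g n r s : pdeg r f 1 -> pdeg s g 1 -> ~~ odd (r + s) ->
  pdeg (r + s).+1 (@nprod_fun F b f g n) (- nprod_lead r s).
Proof.
move=> fr gs rs.
have sgn : (-1) ^+ r = (-1) ^+ s :> F.
  by rewrite -signr_odd -[RHS]signr_odd; move: rs; rewrite oddD; do 2!case: odd.
have sgn2 : (-1) ^+ r * (-1) ^+ r = 1 :> F by rewrite -expr2 sqrr_sign.
pose g' x := g (- bz - x); pose f' x := f (- bz - x).
have g's : pdeg s g' ((-1) ^+ r) by rewrite sgn -[_ ^+ s]mulr1; exact: pdeg_flip.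
have f'r : pdeg r f' ((-1) ^+ r) by rewrite -[_ ^+ r]mulr1; exact: pdeg_flip.
pose g'' x := g (x + n); have g''s : pdeg s g'' 1 by exact: pdeg_shift.
have Sdeg N h c : pdeg N h c -> pdeg N.+1 (sum h) c.
  by apply: eq_pdeg => x; rewrite sumS.
(* [E1] to [E4] are the four terms of the expanded product in [nprod_fun], up to sign; the binomials
   of [E2] and [E3] merge by Pascal's rule. *)
have E1 := Sdeg _ _ _ (pdegM fr g's).
have E2 := pdegM g''s (Sdeg _ _ _ fr).
have E3 := pdegM f'r (Sdeg _ _ _ g's).
have E4 := pdegM (pdegM f'r g''s) (Sdeg 0%N (fun=> 1) 1 (fun=> erefl)).
move: E2 E3 E4; rewrite !addnS addn0 [(s + r)%N]addnC => E2 E3 E4.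
have E34 := pdegDZ (-1) E3 E4; have E234 := pdegDZ (-1) E2 E34.
have := pdegDZ 1 E1 E234.
rewrite (_ : 1 * _ + _ = - nprod_lead r s); last first.
  rewrite /nprod_lead binS natrD !mul1r !mulr1 binSn sgn2.
  have -> : 'C((r + s).+1, r.+1) = 'C((r + s).+1, s).
    by rewrite -bin_sub; [congr 'C(_, _); lia|lia].
  rewrite -!natr1; ring.
apply: eq_pdeg => l; apply/esym.
transitivity (sum (fun i => 1 * (f i * g' i) + (- g'' l * f i
    + (- f' l * g' i + (f' l * g'' l) * 1))) l).
  apply: (@eq_zsum F F^o) => i; congr (_ *: _).
  by rewrite /f' /g' /g'' [n + l]addrC; ring.
rewrite !sumDZ; set s1 := sum (fun=> (f' l * g'' l) * 1) l.
have -> : s1 = f' l * g'' l * sum (fun=> 1) l.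
  have := sumDZ (f' l * g'' l) (fun=> 1) (fun=> 0) l.
  rewrite sum0 [RHS]addr0 => <-.
  by apply: (@eq_zsum F F^o) => i; rewrite addr0.
ring.
Qed.

Section Stable.
Context (M : V -> Prop).
Hypothesis (M0 : M 0).
Hypothesis (Ml : forall (c : F) u v, M u -> M v -> M (c *: u + v)).
Hypothesis (M1 : forall n v, M v -> M (Phi (fun i => i%:~R) n v)).
Hypothesis (lead_neq0 : forall N, odd N -> (1 < N)%N ->
  exists r s, (r + s).+1 = N /\ nprod_lead r s != 0).

Let Good N := forall q c, pdeg N q c -> forall n v, M v -> M (Phi q n v).

Lemma Phi_stable_pdeg N : Good N.
Proof.
have [MD MZ MN MB] := linear_closed0 M0 Ml.
elim/ltn_ind: N => N IH.
have low q : pdeg N q 0 -> forall n v, M v -> M (Phi q n v).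
  case: N IH => [|N] IH; last by move=> /pdeg_lower[c]; exact: IH.
  move=> /= q0 n v _; rewrite (_ : Phi q n v = 0) // -[RHS](@zsum0 F).
  by apply: eq_zsum => i; rewrite q0 scale0r.
have [oN|eN] := boolP (odd N); last first.
  move=> q c qc n v Mv.
  (* Replace [q] by half of its antisymmetrization; for even [N] the leading coefficients cancel
     there. *)
  have -> : Phi q n v = 2%:R^-1 *: Phi (fun i => -1 * q (n - bz - i) + q i) n v.
    apply: (scalerI char_neq2); rewrite scalerA mulfV // scale1r PhiDZ.
    by rewrite scaleN1r -PhiN scaler_nat mulr2n.
  apply/MZ/low => //; have := pdegDZ (-1) (pdeg_flip (n - bz) qc) qc.
  by rewrite -signr_odd (negPf eN) expr0 mul1r mulN1r addNr.
have [N1|N1] := leqP N 1.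
  have {N1} NE : N = 1%N by case: N oN N1 {IH low} => [|[|[]]].
  move: low; rewrite /Good NE => low q c qc n v Mv.
  have -> : Phi q n v = c *: Phi (fun i => i%:~R) n v
      + Phi (fun i => - c * i%:~R + q i) n v.
    by rewrite PhiDZ scaleNr addrA subrr add0r.
  apply: Ml; first exact: M1.
  apply: low => // x; rewrite -[RHS](addNr c) -[X in _ = _ + X](qc x) /=.
  by rewrite rmorphD /=; ring.
have [r [s [rsN K0]]] := lead_neq0 oN N1.
have [f f1] := @pdeg_monic F r; have [g g1] := @pdeg_monic F s.
have [rN sN] : (r < N)%N /\ (s < N)%N by lia.
have Mf n v : M v -> M (Phi f n v) by exact: (IH r rN f 1 f1).
have Mg n v : M v -> M (Phi g n v) by exact: (IH s sN g 1 g1).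
move=> q c qc n v Mv.
have [d dE] := nprodE S char_neq2 f g n.
pose h x := @nprod_fun F b f g n (x - n).
have Mh : M (Phi h n v).
  have -> : Phi h n v = nprod f g n v - d *: v by rewrite dE addrK.
  apply: MB; last exact: MZ.
  apply: zsum_closed => // k; rewrite /nprod_term.
  by case: ifP => _; [apply/Mf/Mg|apply/Mg/Mf].
have hN : pdeg N h (- nprod_lead r s).
  rewrite -rsN; apply: (pdeg_shift (- n)); apply: nprod_fun_lead => //.
  by move: oN; rewrite -rsN /=.
(* [h] has leading coefficient [- nprod_lead r s], so this multiple of it cancels that of [q]. *)
have -> : Phi q n v = (- (c / nprod_lead r s)) *: Phi h n v
    + Phi (fun i => (c / nprod_lead r s) * h i + q i) n v.
  by rewrite PhiDZ scaleNr addrA addNr add0r.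
apply: Ml => //; apply: low => //.
by have := pdegDZ (c / nprod_lead r s) hN qc; rewrite mulrN divfK // addNr.
Qed.

(** On a fixed vector only the [i] with [n - bz - K <= i < K] contribute, so [q] may be replaced by
    an interpolating function of finite degree. *)
Lemma Phi_stable q n v : M v -> M (Phi q n v).
Proof.
move=> Mv; have [K vK] := nord_nil v.
have [N [p [c [pN pq]]]] := pdeg_interpolate (absz (K - (n - bz - K))%R) (n - bz - K) q.
have -> : Phi q n v = Phi p n v; last exact: Phi_stable_pdeg pN n v Mv.
apply: eq_zsum => i.
have [iK|iK] := boolP ((n - bz - K <= i) && (i < K)).
  by rewrite pq //; lia.
by rewrite vK ?scaler0 //; lia.
Qed.

(** Taking for [q] the indicator of one index isolates a single normally ordered pair; the plain
    product differs from it by a scalar. *)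
Lemma aa_stable i j v : M v -> M (a i (a j v)).
Proof.
have [MD MZ MN MB] := linear_closed0 M0 Ml.
move=> Mv.
have Mn k l : M (nord k l v).
  have := Phi_stable (fun x => (x == k)%:R) (k + l + bz) Mv.
  rewrite /Phi (zsum1 (k := k)) => [|m /negPf ->]; last by rewrite scale0r.
  by rewrite eqxx scale1r (_ : _ - k = l) //; ring.
have [ij|ij] := eqVneq (i + j + bz) 0; last by rewrite -nordE.
have [lt_ij|lt_ji|ij'] := ltgtP i j.
- by have := Mn i j; rewrite /nord lt_ij.
- rewrite fs_carN ij eqxx scale1r; apply: MD => //.
  by have := Mn i j; rewrite /nord lt_ji ltNge (ltW lt_ji).
rewrite -[X in M X]scale1r -(mulVf char_neq2) -scalerA; apply: MZ.
by rewrite scaler_nat mulr2n ij' fs_car -{1}ij' ij eqxx scale1r.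
Qed.

End Stable.
End QuadraticStability.

(** * Nonvanishing of the leading coefficients *)

(** With [q = p ^ e], compare the coefficients of [X^q] in [(X + 1)^(q k) = (X^q + 1)^k]. *)
Lemma bin_pfactor_pchar (F : fieldType) (p e k : nat) : p \in [pchar F] ->
  'C(p ^ e * k, p ^ e)%:R = k%:R :> F.
Proof.
move=> pF; set q := (p ^ e)%N.
have q0 : (0 < q)%N by rewrite expn_gt0 prime_gt0 // (pcharf_prime pF).
have pP : p \in [pchar {poly F}] by rewrite (pchar_lalg {poly F}).
have E : ('X + 1 : {poly F}) ^+ (q * k) = ('X^q + 1) ^+ k.
  rewrite exprM (@exprDn_pchar {poly F}) ?expr1n //.
  by rewrite pnatX (pnatE _ (pcharf_prime pP)) pP.
have C d n j : (0 < d)%N -> (('X^d + 1 : {poly F}) ^+ n)`_(d * j) = 'C(n, j)%:R.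
  move=> d0; rewrite addrC exprDn coef_sum.
  have T (i : 'I_n.+1) : (1 ^+ (n - i) * 'X^d ^+ i *+ 'C(n, i) : {poly F})`_(d * j)
      = (j == i)%:R *+ 'C(n, i).
    by rewrite expr1n mul1r -exprM coefMn coefXn eqn_pmul2l.
  have [jn|jn] := ltnP j n.+1; last first.
    rewrite bin_small // big1 // => i _; rewrite T gtn_eqF ?mul0rn //.
    exact: leq_trans (ltn_ord i) jn.
  rewrite (bigD1 (Ordinal jn)) // T /= eqxx big1 ?addr0 // => i ij.
  rewrite T (_ : j == i = false) ?mul0rn //.
  by apply: contraNF ij => /eqP ji; apply/eqP/val_inj.
move: E => /(congr1 (fun P : {poly F} => P`_q)).
rewrite -[X in (('X + 1) ^+ _)`_X]mul1n -[X in (('X^q + 1) ^+ _)`_X]muln1.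
by rewrite (C 1%N) // (C q) // bin1.
Qed.

Lemma nprod_lead_neq0 (F : fieldType) (N : nat) :
  2%N \notin [pchar F] -> 7%N \notin [pchar F] -> odd N -> (1 < N)%N ->
  exists r s, (r + s).+1 = N /\ @nprod_lead F r s != 0.
Proof.
move=> c2 c7 oN N1.
have n2 : 2%:R != 0 :> F by move: c2; rewrite inE /=.
have n7 : 7%:R != 0 :> F by move: c7; rewrite inE /=.
have b2 m : 'C(m, 2)%:R * 2%:R = m%:R * (m%:R - 1) :> F.
  case: m => [|m]; first by rewrite !mul0r.
  have -> : m.+1%:R - 1 = m%:R :> F by rewrite -natr1 addrK.
  by rewrite -natrM (bin_ffact _ 2) ffactnS ffactn1 natrM.
have b3 m : 'C(m, 3)%:R * 6%:R = m%:R * (m%:R - 1) * (m%:R - 2%:R) :> F.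
  case: m => [|[|m]]; rewrite ?mul0r ?subrr ?mulr0 ?mul0r //.
  have -> : m.+2%:R - 1 = m.+1%:R :> F by rewrite -natr1 addrK.
  have -> : m.+2%:R - 2%:R = m%:R :> F by rewrite -addn2 natrD addrK.
  by rewrite -natrM (bin_ffact _ 3) !ffactnS ffactn0 muln1 !natrM mulrA.
have [N0|N0] := eqVneq (N.+1%:R : F) 0; last first.
  have [N3|N3] := eqVneq (3%:R * N%:R - 2%:R : F) 0; last first.
    exists 1%N, (N - 2)%N; split; first by lia.
    have : @nprod_lead F 1 (N - 2) * 2%:R = N.+1%:R * (3%:R * N%:R - 2%:R).
      rewrite /nprod_lead (_ : (1 + (N - 2)).+2 = N.+1); last by lia.
      rewrite mulrBl b2 bin1 addnC natrD natrB // -natr1; ring.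
    by apply: contra_eq_neq => ->; rewrite mul0r eq_sym mulf_neq0.
  exists 2, (N - 3)%N; split; first by lia.
  (* Multiplying by 54 clears denominators; the product is then reduced by the relation [3 N = 2],
     leaving the factor 14. *)
  have : @nprod_lead F 2 (N - 3) * (9%:R * 6%:R) = N.+1%:R * - 14%:R.
    rewrite /nprod_lead (_ : (2 + (N - 3)).+2 = N.+1); last by lia.
    rewrite (_ : (2 + (N - 3))%N = (N - 1)%N); last by lia.
    rewrite sqrrN expr1n mul1r.
    have := b3 N.+1; have := b2 (N - 1)%N; rewrite natrB ?(ltnW N1) //.
    have -> : N.+1%:R = N%:R + 1 :> F by rewrite natr1.
    move: ('C(_, 2)%:R) ('C(_, 3)%:R) (N%:R) N3 => x y z /eqP.
    rewrite subr_eq0 => /eqP N3 b2' b3'.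
    transitivity (9%:R * (y * 6%:R) - 27%:R * (z + 1) * (x * 2%:R)); first by ring.
    rewrite b2' b3'.
    transitivity ((z + 1) * (3%:R * z - 3%:R) * (18%:R - 2%:R * (3%:R * z))).
      by ring.
    by rewrite N3; ring.
  move=> E; apply/eqP => K0; move/eqP: E; apply/negP.
  rewrite K0 mul0r eq_sym mulf_neq0 // oppr_eq0.
  by rewrite (natrM _ 2 7) mulf_neq0.
have [p pF] := natf0_pchar (ltn0Sn N) (introT eqP N0).
have pp := pcharf_prime pF.
have pN : (p %| N.+1)%N by rewrite (dvdn_pcharf pF) N0.
have [k pk NE] := pfactor_coprime pp (ltn0Sn N).
move: (logn p N.+1) NE => e NE.
have oq : odd (p ^ e).
  rewrite oddX; apply/orP; right; move: c2; apply: contraR => op.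
  by case: (even_prime pp) op => [pE _|->] //; rewrite -pE.
(* [N + 1] is even and [p] is odd, so [k] is even; as it is also nonzero, [k >= 2] and [p ^ e <= N],
   which makes [s] meaningful. *)
have ek : ~~ odd k.
  by move: oN; rewrite -[odd N]negbK -[~~ odd N]/(odd N.+1) NE oddM oq andbT.
have k0 : k%:R != 0 :> F by rewrite -(dvdn_pcharf pF) -prime_coprime.
have k2 : (1 < k)%N.
  by case: k ek k0 {pk NE} => [|[|]] //=; rewrite eqxx.
have q0 : (0 < p ^ e)%N by rewrite expn_gt0 prime_gt0.
have qN : (p ^ e <= N)%N by nia.
exists (p ^ e).-1, (N - p ^ e)%N; split; first by lia.
(* The second term of [nprod_lead] contains the factor [N + 1 = 0], and the binomial left is [k]. *)
rewrite /nprod_lead (_ : ((p ^ e).-1 + (N - p ^ e)).+2 = N.+1); last by lia.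
rewrite N0 mul0r mulr0 subr0 prednK // [in 'C(_, _)]NE [(k * _)%N]mulnC.
by rewrite (bin_pfactor_pchar _ _ pF).
Qed.

(** * Virasoro relations *)

Lemma zsum_ord (F : fieldType) (V : lmodType F) (t : int -> V) (lo : int)
    (n : nat) : (forall j, j < lo \/ lo + n%:Z <= j -> t j = 0) ->
  zsum t = \sum_(k < n) t (lo + k%:Z).
Proof.
elim: n t => [|n IHn] t t0.
  rewrite big_ord0 -[RHS](@zsum0 F); apply: eq_zsum => j.
  by apply: t0; lia.
have f1 : fins (fun j => if j == lo + n%:Z then t j else 0).
  by apply: (@fins1 _ _ _ (lo + n%:Z)) => j /negPf ->.
have f2 : fins (fun j => if j == lo + n%:Z then 0 else t j).
  apply: (@fins_bound _ _ _ (lo - 1) (lo + n.+1%:Z)) => j jn.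
  by case: ifP => // _; apply: t0; lia.
rewrite big_ord_recr /=.
transitivity (zsum (fun j => (if j == lo + n%:Z then 0 else t j)
  + if j == lo + n%:Z then t j else 0)).
  by apply: eq_zsum => j; case: ifP => _; rewrite ?addr0 ?add0r.
rewrite zsumD // (IHn (fun j => if j == lo + n%:Z then 0 else t j)).
  rewrite (@zsum1 _ _ _ (lo + n%:Z)) => [|j /negPf -> //]; rewrite eqxx.
  congr (_ + _); apply: eq_bigr => k _; rewrite ifF //; have := ltn_ord k; lia.
by move=> j jn; case: eqP => // jE; apply: t0; lia.
Qed.

Section CentralCharge.
Context {F : fieldType} (char_neq2 : 2%:R != 0 :> F).

(** The sums for half-integral ([sum1]) and integral ([sum0]) indices are evaluated over the
    integers: 3 may vanish in [F], so it has to be cancelled beforehand. *)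
Let sum1 (n : nat) (m : int) :
  (\sum_(k < n) (k%:Z * 2 - m * 2 + 1) * (k%:Z * 2 - m + 1)) * 3
  = 2 * (n%:Z - 1) * n%:Z * (2 * n%:Z - 1) + 3 * n%:Z * (n%:Z - 1) * (2 - 3 * m)
    + 3 * n%:Z * (1 - 2 * m) * (1 - m).
Proof.
elim: n => [|n IHn]; first by rewrite big_ord0; ring.
rewrite big_ord_recr /= mulrDl IHn (_ : n.+1%:Z = n%:Z + 1); [ring|lia].
Qed.

Let sum0 (n : nat) (m : int) :
  (\sum_(k < n) (k%:Z - m) * (k%:Z * 2 - m)) * 6
  = 2 * (n%:Z - 1) * n%:Z * (2 * n%:Z - 1) - 9 * m * n%:Z * (n%:Z - 1)
    + 6 * n%:Z * m ^+ 2.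
Proof.
elim: n => [|n IHn]; first by rewrite big_ord0; ring.
rewrite big_ord_recr /= mulrDl IHn (_ : n.+1%:Z = n%:Z + 1); [ring|lia].
Qed.

Let q (m : nat) : int := ((m%:Z ^+ 3 - m%:Z) %/ 3)%Z.

Let sum1E (m : nat) :
  \sum_(k < m) (k%:Z * 2 - m%:Z * 2 + 1) * (k%:Z * 2 - m%:Z + 1) = q m.
Proof.
apply: (@mulIf _ 3) => //; rewrite sum1 /q vir_cocycle_divE; ring.
Qed.

Let sum0E (m : nat) :
  (\sum_(k < m) (k%:Z - m%:Z) * (k%:Z * 2 - m%:Z)) * 2 = q m + m%:Z ^+ 2 + m%:Z.
Proof.
apply: (@mulIf _ 3) => //; rewrite -mulrA [2 * 3](_ : _ = 6) // sum0.
rewrite !mulrDl /q vir_cocycle_divE; ring.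
Qed.

(* The contractions of L_m with L_{-m} on the vacuum, the zero mode
   contributing with weight 1/2. *)
Lemma vir_vacuum_sum (b : bool) (m : nat) :
  \sum_(k < m) (- 2%:R^-1 * ((- m%:Z + k%:Z)%:~R + b%:R / 2%:R))
    * (- 2%:R^-1 * (m%:Z + (- m%:Z + k%:Z) * 2 + b%:Z)%:~R)
    * (if b || (0 < k)%N then 1 else 2%:R^-1)
  = 2%:R^-1 * vir_cocycle F m%:Z + (2%:R * m%:R) * ((~~ b)%:R / 16%:R).
Proof.
have n4 : 4%:R != 0 :> F by rewrite (natrM _ 2 2) mulf_neq0.
have n16 : 16%:R != 0 :> F by rewrite (natrM _ 4 4) mulf_neq0.
rewrite /vir_cocycle -/(q m); case: b => /=.
  rewrite mul0r mulr0 addr0 -sum1E rmorph_sum /= mulr_suml mulr_sumr.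
  apply: eq_bigr => k _; rewrite mulr1 !(rmorphD, rmorphM, rmorphN, rmorphB) /=.
  by field; rewrite ?n4 ?n16 ?char_neq2.
rewrite mul0r.
have E : (q m)%:~R = (\sum_(k < m) (k%:Z - m%:Z) * (k%:Z * 2 - m%:Z))%:~R * 2%:R
    - m%:R ^+ 2 - m%:R :> F.
  have -> : q m = (\sum_(k < m) (k%:Z - m%:Z) * (k%:Z * 2 - m%:Z)) * 2
      - m%:Z ^+ 2 - m%:Z by rewrite sum0E; ring.
  by rewrite !(rmorphB, rmorphM, rmorphXn) /=.
rewrite {}E; case: m => [|m].
  by rewrite !big_ord0; field; rewrite ?n4 ?n16 ?char_neq2.
(* The term [k = 0] pairs [a(-m)] with the zero mode and has weight 1/2, so it is split off. *)
rewrite !big_ord_recl /= !rmorphD rmorph_sum /=.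
set s := \sum_(k < m) (_ * _)%:~R.
set s' := \sum_(k < m) _; have -> : s' = 4%:R^-1 * s.
  rewrite /s' /s mulr_sumr; apply: eq_bigr => k _; rewrite mulr1.
  rewrite !(rmorphD, rmorphM, rmorphN, rmorphB) /=.
  by field; rewrite ?n4 ?n16 ?char_neq2.
rewrite !(rmorphD, rmorphM, rmorphN, rmorphB) /=.
move: s => s; rewrite -!pmulrn.
by field; rewrite ?n4 ?n16 ?char_neq2.
Qed.

End CentralCharge.

Section VirasoroOperators.
Context {F : fieldType} {b : bool} (S : fermiSpace F b).
Context (char_neq2 : 2%:R != 0 :> F).
Local Notation V := (fs_sort S).
Local Notation a := (fs_a S).
Local Notation vac := (fs_vac S).
Local Notation gr := (fs_gr S).
Local Notation bz := (b%:Z).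
Implicit Types (v : V).

(** The substitution [j = -i] turns the defining sum of [L_n] into [-1/2] times the sum of the
    [i :a(i) a(n - i):]. *)
Definition vir_coef (i : int) : F := - 2%:R^-1 * fval b F i.

Definition vir_shift (n : int) : F := (~~ b && (n == 0))%:R / 16%:R.

Definition vir_op (n : int) v : V := vir_shift n *: v + Phi vir_coef n v.

Lemma vir_op_linear n : linear (vir_op n).
Proof.
move=> c u v; rewrite /vir_op Phi_linear !scalerDr !scalerA.
by rewrite [vir_shift n * c]mulrC addrACA.
Qed.

HB.instance Definition _ n := GRing.isLinear.Build F V V *:%R (vir_op n)
  (vir_op_linear n).

Lemma vir_op_even n : even_op (vir_op n).
Proof.
have [p o] := Phi_even S vir_coef n.
by split=> v; rewrite /vir_op linearD linearZ /= ?p ?o.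
Qed.

Let wt n l : F := - 2%:R^-1 * (n + l * 2 + bz)%:~R.

(** The [a(l)] are the modes of a primary field of conformal weight 1/2. *)
Lemma vir_op_a n l v :
  vir_op n (a l v) = a l (vir_op n v) + (- 2%:R^-1 * (n + l * 2 + bz)%:~R) *: a (n + l) v.
Proof.
rewrite /vir_op Phi_a linearD linearZ /= addrA; congr (_ + _ *: _).
rewrite /vir_coef /fval !(rmorphD, rmorphM, rmorphB, rmorphN) /= -!pmulrn.
by field.
Qed.

Lemma gr_Phi d f n v : gr d (Phi f n v) = Phi f n (gr (d + n * 2) v).
Proof.
rewrite /Phi zsum_linear; last exact: Phi_fins.
apply: eq_zsum => i; rewrite linearZ /=; congr (_ *: _).
have E k l w : k + l = n - bz -> gr d (a k (a l w)) = a k (a l (gr (d + n * 2) w)).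
  by move=> kl; rewrite !fs_gr_a; congr (a k (a l (gr _ w))); lia.
rewrite /nord; case: ltgtP => _; rewrite ?linear0 ?linearN /= ?E //; lia.
Qed.

Lemma gr_vir_op d n v : gr d (vir_op n v) = vir_op n (gr (d + n * 2) v).
Proof.
rewrite /vir_op linearD linearZ /= gr_Phi /vir_shift.
by have [->|] := eqVneq n 0; rewrite ?mul0r ?addr0 ?andbF ?mul0r ?scale0r.
Qed.

(** When the indices of two distinct modes add up to [n >= 0], the larger one is positive, and it
    acts first. *)
Lemma Phi_vac f n : 0 <= n -> Phi f n vac = 0.
Proof.
move=> n0; rewrite /Phi -[RHS](@zsum0 F); apply: eq_zsum => i.
rewrite /nord; case: ltgtP => ij; rewrite ?scaler0 //.
  by rewrite fs_a_vac ?linear0 ?scaler0 //; lia.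
by rewrite (@fs_a_vac _ _ S i) ?linear0 ?oppr0 ?scaler0 //; lia.
Qed.

Let anom m n v : V := vir_op m (vir_op n v) - vir_op n (vir_op m v)
  - (m - n)%:~R *: vir_op (m + n) v.

(** The weights in [vir_op_a] satisfy the relation without central term, so the anomaly commutes
    with every mode and [fs_schur] applies. *)
Let anom_scalar m n : exists c, forall v, anom m n v = c *: v.
Proof.
have Al : linear (anom m n).
  move=> c u v.
  have R (A B A' B' D E : V) : c *: A + B - (c *: A' + B') - (c *: D + E)
      = c *: (A - A' - D) + (B - B' - E).
    by rewrite !opprD (addrACA (c *: A)) [LHS]addrACA !scalerBr.
  rewrite /anom (linearP (vir_op n)) !(linearP (vir_op m)).
  rewrite (linearP (vir_op n)) (linearP (vir_op (m + n))).
  rewrite [(_)%:~R *: _]scalerDr scalerA [_%:~R * c]mulrC -scalerA.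
  exact: R.
pose AL := GRing.isLinear.Build F V V *:%R (anom m n) Al.
pose A : {linear V -> V} := HB.pack (anom m n) AL.
apply: (@fs_schur _ _ S char_neq2 A) => [l v|v].
  rewrite /= /anom.
  have R (P P' Q X Y Y' Z : V) : P + (X + Y) - (P' + (X + Y')) - (Q + Z)
      = P - P' - Q + (Y - Y' - Z).
    have -> : P + (X + Y) - (P' + (X + Y')) = P - P' + (Y - Y').
      by rewrite !opprD (addrACA P) (addrACA X) subrr add0r.
    by rewrite opprD [LHS]addrACA.
  have E k p w : vir_op k (vir_op p (a l w)) = a l (vir_op k (vir_op p w))
     + (wt k l *: a (k + l) (vir_op p w) + wt p l *: a (p + l) (vir_op k w)
        + (wt p l * wt k (p + l)) *: a (k + p + l) w).
    rewrite (vir_op_a p l w) linearD linearZ /= (vir_op_a k l) (vir_op_a k (p + l)).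
    by rewrite scalerDr scalerA -/(wt k l) -/(wt p l) !addrA.
  rewrite !E (vir_op_a (m + n)) -/(wt (m + n) l) [n + m]addrC.
  rewrite [wt n l *: _ + wt m l *: _]addrC; set x := a (m + n + l) v.
  set X := wt m l *: _ + wt n l *: _.
  rewrite [in LHS](scalerDr _ (a l _)) [in LHS]scalerA.
  rewrite [RHS](linearB (a l)) [in RHS](linearB (a l)) (linearZZ (a l)).
  rewrite R -!scalerBl [X in _ + X *: _](_ : _ = 0) ?scale0r ?addr0 //.
  rewrite /wt !(rmorphD, rmorphM, rmorphB, rmorphN) /= -!pmulrn.
  by field.
have o k := (vir_op_even k).2.
rewrite /= /anom !(linearB (fs_om S)) (linearZZ (fs_om S)) !o.
by [].
Qed.

Lemma vir_op_vac n : 0 <= n -> vir_op n vac = vir_shift n *: vac.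
Proof. by move=> n0; rewrite /vir_op Phi_vac // addr0. Qed.

(** The vacuum contraction: 1 for a creation mode, 0 for an annihilation mode, 1/2 for the zero
    mode. *)
Let p (i : int) : F := (i * 2 + bz < 0)%R%:R + 2%:R^-1 * (i * 2 + bz == 0)%:R.

Let p_neg i : i * 2 + bz < 0 -> p i = 1.
Proof. by move=> i0; rewrite /p i0 lt_eqF // mulr0 addr0. Qed.

Let p_pos i : 0 < i * 2 + bz -> p i = 0.
Proof. by move=> i0; rewrite /p gt_eqF // ltNge (ltW i0) mulr0 addr0. Qed.

Let p_zero i : i * 2 + bz = 0 -> p i = 2%:R^-1.
Proof. by move=> i0; rewrite /p i0 eqxx mulr1 add0r. Qed.

Let aa_vac i : a (- bz - i) (a i vac) = p i *: vac.
Proof.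
rewrite /p; case: (ltgtP (i * 2 + bz) 0) => i0.
- rewrite fs_carN (@fs_a_vac _ _ S (- bz - i)); last by lia.
  by rewrite (_ : _ == 0) ?mulr0 ?addr0 ?linear0 ?oppr0 ?addr0 //; lia.
- by rewrite fs_a_vac // linear0 mulr0 addr0 scale0r.
- have -> : - bz - i = i by lia.
  apply: (scalerI char_neq2); rewrite scalerA mulr1 add0r mulfV // scale1r.
  rewrite scaler_nat mulr2n fs_car (_ : _ == 0) ?scale1r //; lia.
Qed.

Let vir_op_vac2 (m : nat) : (0 < m)%N -> vir_op m%:Z (vir_op (- m%:Z) vac)
  = (2%:R^-1 * vir_cocycle F m%:Z + (2%:R * m%:R) * vir_shift 0) *: vac.
Proof.
move=> m0; rewrite {1}/vir_shift eqxx andbT -vir_vacuum_sum //.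
have -> : vir_op (- m%:Z) vac = Phi vir_coef (- m%:Z) vac.
  rewrite /vir_op /vir_shift (_ : (_ == 0) = false) ?andbF ?mul0r; last by lia.
  by rewrite scale0r add0r.
have m1 : 0 < m%:Z * 2 + bz by lia.
rewrite /Phi zsum_linear; last exact: Phi_fins.
pose j i := - m%:Z - bz - i.
have E i : vir_op m%:Z (vir_coef i *: nord i (j i) vac)
    = (vir_coef i * wt m%:Z i * (p (j i) - p (- bz - i))) *: vac.
  rewrite linearZ /= nordE //; last by rewrite /j; lia.
  rewrite (vir_op_a m%:Z i) (vir_op_a m%:Z (j i)) vir_op_vac //.
  rewrite /vir_shift (_ : (m%:Z == 0) = false) ?andbF ?mul0r; last by lia.
  rewrite scale0r linear0 add0r linearZ /= -!/(wt _ _).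
  rewrite (_ : m%:Z + i = - bz - j i); last by rewrite /j; lia.
  rewrite (_ : m%:Z + j i = - bz - i); last by rewrite /j; lia.
  have := aa_vac (- bz - i); rewrite opprB addrCA [- bz + _]addrC subrr addr0 => ->.
  rewrite aa_vac !scalerA -scalerDl scalerA; congr (_ *: _).
  rewrite (_ : wt m%:Z (j i) = - wt m%:Z i); first by ring.
  by rewrite /wt -mulrN -rmorphN /=; congr (_ * _%:~R); rewrite /j; lia.
(* Only [-m <= i < 0] contributes: elsewhere the two contractions agree, except at the zero mode,
   where [vir_coef] vanishes. *)
rewrite (eq_zsum E) (@zsum_ord _ _ _ (- m%:Z) m).
  rewrite scaler_suml; apply: eq_bigr => k _; congr (_ *: _).
  rewrite [vir_coef _]/vir_coef /fval /wt; congr (_ * _); have := ltn_ord k => km.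
  rewrite (p_pos (i := - bz - _)) ?subr0; last by lia.
  case: ifP => bk; first by rewrite p_neg // /j; lia.
  by rewrite p_zero // /j; lia.
move=> i [im|im].
  by rewrite !p_pos ?subr0 ?mulr0 ?scale0r // /j; lia.
have [i0|i0] := ltP 0 (i * 2 + bz).
  by rewrite !p_neg ?subrr ?mulr0 ?scale0r // /j; lia.
rewrite /vir_coef (_ : fval b F i = 0) ?mulr0 ?mul0r ?scale0r //.
rewrite /fval (_ : i = 0); last by lia.
by rewrite (_ : b%:R = 0 :> F) ?mul0r ?addr0 //; move: im i0; case: (b) => //=; lia.
Qed.

(** The scalar of [anom_scalar] is read off the vacuum: by degree if [m + n] is nonzero, by
    [vir_op_vac2] if [n = -m < 0], and by antisymmetry if [m < 0]. *)
Lemma vir_op_rel m n v : vir_op m (vir_op n v) - vir_op n (vir_op m v)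
  = (m - n)%:~R *: vir_op (m + n) v
    + (2%:R^-1 * (vir_cocycle F m *+ (m + n == 0))) *: v.
Proof.
suff E w : anom m n w = (2%:R^-1 * (vir_cocycle F m *+ (m + n == 0))) *: w.
  by rewrite -E /anom [RHS]addrC subrK.
have [c cE] := anom_scalar m n.
suff <- : c = 2%:R^-1 * (vir_cocycle F m *+ (m + n == 0)) by exact: cE.
suff : c *: vac = (2%:R^-1 * (vir_cocycle F m *+ (m + n == 0))) *: vac.
  move=> /eqP; rewrite -subr_eq0 -scalerBl scaler_eq0 (negPf (fs_vac_neq0 S)).
  by rewrite orbF subr_eq0 => /eqP.
have [mn|mn] := eqVneq (m + n) 0; last first.
  rewrite mulr0n mulr0 scale0r.
  (* The anomaly shifts degrees by a nonzero amount, so its value on the vacuum has no component of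
     degree 0. *)
  have <- : gr 0 (c *: vac) = c *: vac by rewrite linearZ /= fs_gr_vac eqxx scale1r.
  rewrite -cE /anom !linearB linearZ /= !gr_vir_op !fs_gr_vac.
  rewrite (_ : (0 + m * 2 + n * 2 == 0) = false); last by lia.
  rewrite (_ : (0 + n * 2 + m * 2 == 0) = false); last by lia.
  rewrite (_ : (0 + (m + n) * 2 == 0) = false); last by lia.
  by rewrite !scale0r !linear0 !addr0.
have shift0 (k : nat) : (0 < k)%N -> anom k%:Z (- k%:Z) vac
    = (2%:R^-1 * vir_cocycle F k%:Z) *: vac.
  move=> k0; rewrite /anom vir_op_vac2 // (vir_op_vac (n := k%:Z)) //.
  rewrite [vir_shift k%:Z]/vir_shift (_ : (k%:Z == 0) = false); last by lia.
  rewrite andbF mul0r scale0r linear0 subr0 subrr vir_op_vac // scalerA -scalerBl.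
  congr (_ *: _); rewrite opprK rmorphD /= -!pmulrn; ring.
have nE : n = - m by lia.
rewrite -cE nE mulr1n; have [m0|m0] := leP 0 m.
  have [->|mn0] := eqVneq m 0.
    rewrite /anom !oppr0 !addr0 subrr scale0r oppr0 addr0.
    by rewrite /vir_cocycle mul0r mulr0 scale0r.
  by rewrite -(gez0_abs m0) shift0 //; lia.
have -> : anom m (- m) vac = - anom (- m) m vac.
  have R (x y z : V) (c' : F) : x - y - c' *: z = - (y - x - (- c') *: z).
    by rewrite scaleNr opprK opprD opprB.
  rewrite /anom R -rmorphN /= [- m + m]addrC.
  by rewrite (_ : - (m - - m) = - m - m) //; ring.
have mE : m = - (absz m)%:Z by lia.
by rewrite mE opprK shift0 ?vir_cocycleN ?mulrN ?scaleNr //; lia.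
Qed.

End VirasoroOperators.

(** * Irreducibility of the parity components *)

Section Parity.
Context {F : fieldType} {b : bool} (S : fermiSpace F b).
Local Notation V := (fs_sort S).
Local Notation a := (fs_a S).
Local Notation vac := (fs_vac S).
Local Notation pi := (fs_pi S).
Local Notation bz := (b%:Z).
Implicit Types (v : V).

Definition parity (s : bool) v : Prop := pi v = (-1) ^+ s *: v.

Lemma parity_lin s (c : F) u v :
  parity s u -> parity s v -> parity s (c *: u + v).
Proof.
by rewrite /parity linearP => -> ->; rewrite scalerDr !scalerA mulrC.
Qed.

Lemma parity0 s : parity s 0.
Proof. by rewrite /parity linear0 scaler0. Qed.

Lemma parity_a s k v : parity s v -> parity (~~ s) (a k v).
Proof.
rewrite /parity fs_pi_a => ->; rewrite linearZ /=.
by case: s; rewrite /= ?expr0 ?expr1 ?scaleN1r ?scale1r ?opprK.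
Qed.

Lemma parity_vac : parity false vac.
Proof. by rewrite /parity fs_pi_vac expr0 scale1r. Qed.

Lemma parity_inj s t v : 2%:R != 0 :> F -> parity s v -> parity t v -> v != 0 -> s = t.
Proof.
move=> n2; rewrite /parity => -> /eqP; rewrite -subr_eq0 -scalerBl scaler_eq0.
case: s t => [] [] //=; rewrite expr0 expr1 -?opprD ?opprK ?oppr_eq0 -mulr2n.
  by rewrite (negPf n2) => /= ->.
by rewrite (negPf n2) => /= ->.
Qed.

End Parity.

Section Irreducibility.
Context {F : fieldType} {b : bool} (S : fermiSpace F b).
Context (char_neq2 : 2%N \notin [pchar F]) (char_neq7 : 7%N \notin [pchar F]).
Local Notation V := (fs_sort S).
Local Notation a := (fs_a S).
Local Notation vac := (fs_vac S).
Local Notation bz := (b%:Z).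
Implicit Types (v : V).

Let n2 : 2%:R != 0 :> F.
Proof. by move: char_neq2; rewrite inE /=. Qed.

Context (M : V -> Prop) (s : bool).
Hypothesis (M0 : M 0).
Hypothesis (Ml : forall (c : F) u v, M u -> M v -> M (c *: u + v)).
Hypothesis (M_vir : forall n v, M v -> M (vir_op n v)).
Hypothesis (M_par : forall v, M v -> parity s v).

Let M_aa i j v : M v -> M (a i (a j v)).
Proof.
have [MD MZ MN MB] := linear_closed0 M0 Ml.
move: i j v; apply: (aa_stable n2 M0 Ml) => [n v Mv|N oN N1]; last first.
  exact: nprod_lead_neq0.
(* Constants contribute nothing, so [i] may be replaced by [i + b/2], the function occurring in
   [vir_op]. *)
have Phi0 c : Phi (fun=> c) n v = 0.
  apply: (scalerI n2); rewrite scaler0 scaler_nat mulr2n {1}PhiN.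
  by rewrite addNr.
have -> : Phi (fun i => i%:~R) n v = - 2%:R *: Phi (@vir_coef F b) n v.
  rewrite -[RHS]addr0 -[0 in RHS](Phi0 (- (b%:R / 2%:R))) -PhiDZ.
  by apply: eq_Phi => i; rewrite /vir_coef /fval; field.
apply/MZ; have -> : Phi (@vir_coef F b) n v = vir_op n v - @vir_shift F b n *: v.
  by rewrite /vir_op addrC addKr.
by apply: MB; [exact: M_vir|exact: MZ].
Qed.

(** The counterpart of [M] in the other parity: each mode maps [M] into [N] and [N] into [M]. *)
Let N v := forall k, M (a k v).

Let aM k v : M v -> N (a k v).
Proof. by move=> Mv l; exact: M_aa. Qed.

(** The annihilation mode of the top creation mode strips it from [v], exchanging [M] and [N], until
    a multiple of the vacuum is reached. *)
Let vac_in K v t : Sp K v -> v != 0 -> parity t v -> M v \/ N v -> M vac \/ N vac.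
Proof.
have [MD MZ MN MB] := linear_closed0 M0 Ml.
have NZ (c : F) u : N u -> N (c *: u).
  by move=> Nu k; rewrite linearZ; apply/MZ/Nu.
have vacZ (c : F) : c *: vac != 0 -> M (c *: vac) \/ N (c *: vac) -> M vac \/ N vac.
  rewrite scaler_eq0 negb_or => /andP[c0 _].
  have E : vac = c^-1 *: (c *: vac) by rewrite scalerA mulVf // scale1r.
  by case=> ?; [left|right]; rewrite E; [exact: MZ|exact: NZ].
have aMN k u : M u \/ N u -> M (a k u) \/ N (a k u).
  by case=> [/aM Nu|Nu]; [right|left].
elim: K v t => [|K IHK] v t /=; first by move=> [c ->] v0 _; exact: vacZ.
move=> [x [y [Sx Sy vE]]] v0 vt vM.
have [K0|] := boolP ((0 < K)%N || b).
  have ay : a K%:Z v = y.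
    by rewrite vE linearD /= (Sp_low Sx) ?add0r ?(Sp_create Sy) //; lia.
  have [y0|y0] := eqVneq y 0.
    by apply: (IHK x t) => //; move: v0 vt vM; rewrite vE y0 linear0 addr0.
  apply: (IHK y (~~ t)) => //; rewrite -ay; first exact: parity_a.
  exact: aMN.
(* For integral indices [c vac + d a(0) vac] is left; homogeneity in parity removes one term, and
   [a 0] maps [a 0 vac] back to half the vacuum. *)
rewrite negb_or -eqn0Ngt => /andP[/eqP K0 bN].
move: Sx Sy; rewrite K0 /= => -[c xE] [d yE].
have b0 : bz = 0 by lia.
move: vE; rewrite K0 b0 subrr xE yE linearZ /= => vE.
have aa : a 0 (a 0 vac) = 2%:R^-1 *: vac.
  apply: (scalerI n2); rewrite scalerA mulfV // scaler_nat mulr2n fs_car b0.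
  by rewrite !addr0 eqxx.
move: vt; rewrite /parity vE linearD !linearZ /= fs_pi_a fs_pi_vac => vt.
have [c0|c0] := eqVneq (c *: vac) 0.
  have Ev : v = d *: a 0 vac by rewrite vE c0 add0r.
  have := aMN 0 _ vM; rewrite Ev linearZ /= aa scalerA.
  apply: vacZ; rewrite scaler_eq0 negb_or mulf_neq0 ?invr_neq0 ?fs_vac_neq0 //.
  by apply: contraNneq v0 => d0; rewrite Ev d0 scale0r.
suff d0 : d *: a 0 vac = 0 by apply: (vacZ c) => //; move: vM; rewrite vE d0 addr0.
case: t vt => /= [|]; rewrite ?expr0 ?expr1 ?scale1r ?scaleN1r.
  rewrite scalerN opprD => /addIr /eqP; rewrite -subr_eq0 opprK.
  by rewrite -mulr2n -scaler_nat scaler_eq0 (negPf n2) (negPf c0).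
move=> /addrI /eqP; rewrite scalerN eq_sym -subr_eq0 opprK.
by rewrite -mulr2n -scaler_nat scaler_eq0 (negPf n2) => /eqP.
Qed.

(** If the modes exchange [X] and [Y] and the vacuum lies in [X], every vector has its even part in
    [X] and its odd part in [Y]. *)
Let split_parity (X Y : V -> Prop) v :
  X 0 -> (forall (c : F) u w, X u -> X w -> X (c *: u + w)) ->
  Y 0 -> (forall (c : F) u w, Y u -> Y w -> Y (c *: u + w)) ->
  (forall k u, X u -> Y (a k u)) -> (forall k u, Y u -> X (a k u)) -> X vac ->
  exists v0 v1, [/\ v = v0 + v1, parity false v0 /\ X v0 & parity true v1 /\ Y v1].
Proof.
move=> X0 Xl Y0 Yl XY YX Xv.
move: v; apply: fs_ind =>
  [|c u v [u0 [u1 [-> [p0 q0] [p1 q1]]]] [v0 [v1 [-> [p0' q0'] [p1' q1']]]]||].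
- by exists 0, 0; rewrite addr0; split=> //; split=> //; exact: parity0.
- exists (c *: u0 + v0), (c *: u1 + v1); split.
  + by rewrite scalerDr addrACA.
  + by split; [exact: parity_lin|exact: Xl].
  + by split; [exact: parity_lin|exact: Yl].
- exists vac, 0; rewrite addr0; split=> //; split=> //; first exact: parity_vac.
  exact: parity0.
- move=> k u [u0 [u1 [-> [p0 q0] [p1 q1]]]].
  exists (a k u1), (a k u0); rewrite linearD addrC; split=> //.
  + by split; [exact: parity_a p1|exact: YX].
  + by split; [exact: parity_a p0|exact: XY].
Qed.

(** By [vac_in] the vacuum lies in [M] or in [N]. Since [M] has parity [s], this fixes [s], and
    [split_parity] then puts the whole component into [M]. *)
Lemma fermi_irr u v : M u -> u != 0 -> parity s v -> M v.
Proof.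
move=> Mu u0 vs.
have [MD MZ MN MB] := linear_closed0 M0 Ml.
have N0 : N 0 by move=> k; rewrite linear0.
have Nl (c : F) x y : N x -> N y -> N (c *: x + y).
  by move=> Nx Ny k; rewrite linearP; exact: Ml.
have NM k x : N x -> M (a k x) by [].
have [K Su] := Sp_all n2 u.
have uniq v0 v1 t : parity t v -> v = v0 + v1 -> parity t v0 -> parity (~~ t) v1 ->
    v = v0.
  move=> vt vE v0t v1t; suff v10 : v1 = 0 by rewrite vE v10 addr0.
  apply/eqP; apply: contraT => v1N.
  suff : t = ~~ t by case: t {vt v0t v1t}.
  apply: (parity_inj n2 _ _ v1N) => //.
  by rewrite (_ : v1 = (-1) *: v0 + v); [exact: parity_lin|rewrite vE scaleN1r addKr].
have [Mv|Nv] := vac_in Su u0 (M_par Mu) (or_introl Mu).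
  have s0 : s = false.
    exact: parity_inj n2 (M_par Mv) (parity_vac S) (fs_vac_neq0 S).
  have [v0 [v1 [vE [p0 q0] [p1 q1]]]] := split_parity v M0 Ml N0 Nl aM NM Mv.
  by rewrite (uniq v0 v1 s) // s0.
(* The mode [a (1 - bz)] is an annihilation mode that brings this vector back to the vacuum. *)
have x0 : a (- 1) vac != 0.
  apply: contra_neq (fs_vac_neq0 S) => x0.
  have := fs_car (1 - bz) (- 1) vac; rewrite x0 linear0 fs_a_vac; last by lia.
  rewrite linear0 addr0 (_ : _ == 0); last by lia.
  by rewrite scale1r.
have s1 : s = true.
  exact: parity_inj n2 (M_par (Nv (- 1))) (parity_a _ (parity_vac S)) x0.
have [v0 [v1 [vE [p0 q0] [p1 q1]]]] := split_parity v N0 Nl M0 Ml NM aM Nv.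
by rewrite (uniq v1 v0 s) // ?s1 // addrC.
Qed.

End Irreducibility.

(** * Parity eigenspaces as spans of ordered monomials *)

Section MonomialParity.
Context {F : fieldType} {b : bool} (S : fermiSpace F b).
Context (char_neq2 : 2%:R != 0 :> F).
Local Notation V := (fs_sort S).
Local Notation a := (fs_a S).
Local Notation vac := (fs_vac S).
Local Notation bz := (b%:Z).
Implicit Types (v : V).

Let monom (ks : seq int) : V :=
  foldr (fun k w => a (fopp b k) w) vac ks.

Definition monom_parity (s : bool) : set V :=
  lspan [set v | exists ks : seq int,
    [/\ sorted (fun k l => fval b rat l < fval b rat k) ks,
        all (fun k => 0 <= fval b rat k) ks, odd (size ks) = s
      & v = monom ks]].

Let monom_below (N : nat) (t : bool) : set V :=
  lspan [set v | exists ks : seq int,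
    [/\ sorted (fun k l => fval b rat l < fval b rat k) ks,
        all (fun k => (0 <= k) && (k < N%:Z)) ks, odd (size ks) = t
      & v = monom ks]].

Let monom_belowS N t v :
  monom_below N t v -> monom_below N.+1 t v.
Proof.
elim=> [|w [ks [ks1 /allP ks2 ks3 ->]]|c u w _ IHu _ IHw].
- exact: lspan_zero.
- apply: lspan_gen; exists ks; split=> //; apply/allP => k /ks2 /andP[-> kN].
  by apply: lt_trans kN _; rewrite ltz_nat.
- exact: lspan_lin.
Qed.

Let monom_belowA N t v :
  monom_below N t v -> monom_below N.+1 (~~ t) (a (- bz - N%:Z) v).
Proof.
elim=> [|w [ks [ks1 ks2 ks3 ->]]|c u w _ IHu _ IHw].
- by rewrite linear0; exact: lspan_zero.
- apply: lspan_gen; exists (N%:Z :: ks); split.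
  + rewrite /= path_sortedE ?ks1 ?andbT => [|x y z xy yz]; last exact: lt_trans yz xy.
    by apply: sub_all ks2 => k /andP[_]; rewrite fval_lt.
  + rewrite /= ltz_nat ltnSn; apply: sub_all ks2 => k /andP[-> kN].
    by apply: lt_trans kN _; rewrite ltz_nat.
  + by rewrite /= ks3.
  + by rewrite /= /fopp addrC.
- by rewrite linearP; exact: lspan_lin.
Qed.

Let monom_split N v : Sp N v -> exists v0 v1,
  [/\ v = v0 + v1, monom_below N false v0 & monom_below N true v1].
Proof.
elim: N v => [|N IHN] v /=.
  move=> [c ->]; exists (c *: vac), 0; rewrite addr0; split=> //.
    by apply/lspanZ/lspan_gen; exists [::].
  exact: lspan_zero.
move=> [x [y [/IHN[x0 [x1 [-> ? ?]]] /IHN[y0 [y1 [-> ? ?]]] ->]]].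
have D t (u w : V) : monom_below N.+1 t u -> monom_below N.+1 t w ->
    monom_below N.+1 t (u + w).
  by move=> Pu Pw; rewrite -[u]scale1r; exact: lspan_lin.
exists (x0 + a (- bz - N%:Z) y1), (x1 + a (- bz - N%:Z) y0); split.
- by rewrite linearD [X in _ + X]addrC addrACA.
- by apply: D; [exact: monom_belowS|exact: (@monom_belowA N true)].
- by apply: D; [exact: monom_belowS|exact: (@monom_belowA N false)].
Qed.

Let monom_belowW N t v : monom_below N t v -> monom_parity t v.
Proof.
elim=> [|w [ks [ks1 ks2 ks3 ->]]|c u w _ IHu _ IHw].
- exact: lspan_zero.
- apply: lspan_gen; exists ks; split=> //; apply: sub_all ks2 => k /andP[k0 _].
  by rewrite /fval addr_ge0 ?ler0z // divr_ge0 ?ler0n.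
- exact: lspan_lin.
Qed.

(** Splitting [v] into even and odd monomials, the component of the wrong parity has both parities,
    hence is 0. *)
Lemma monom_parityE (s : bool) (v : V) : monom_parity s v <-> parity s v.
Proof.
have to t w : monom_parity t w -> parity t w.
  elim=> [|_ [ks [_ _ <- ->]]|c u u' _ pu _ pu'].
  - exact: parity0.
  - elim: ks => [|k ks IH] /=; first exact: parity_vac.
    exact: parity_a.
  - exact: parity_lin.
split=> [|vs]; first exact: to.
have [N /monom_split[v0 [v1 [vE /monom_belowW p0 /monom_belowW p1]]]] :=
  Sp_all char_neq2 v.
have uniq t (w0 w1 : V) : v = w0 + w1 -> parity t w0 ->
    parity (~~ t) w1 -> s = t -> v = w0.
  move=> wE w0t w1t st; suff w10 : w1 = 0 by rewrite wE w10 addr0.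
  apply/eqP; apply: contraT => w1N.
  suff : t = ~~ t by case: (t).
  apply: (parity_inj char_neq2 _ _ w1N) => //.
  have -> : w1 = (-1) *: w0 + v by rewrite wE scaleN1r addKr.
  by apply: parity_lin => //; rewrite -st.
case sE: s.
  have vE' : v = v1 + v0 by rewrite addrC.
  by rewrite (uniq true v1 v0 vE' (to _ _ p1) (to _ _ p0) sE).
by rewrite (uniq false v0 v1 vE (to _ _ p0) (to _ _ p1) sE).
Qed.

End MonomialParity.

(** Provides the image of the vacuum under the second zero mode, which [fock_twisted] requires to be
    killed by the positive modes. *)
Lemma zero_mode_ann (F : fieldType) (b : bool) (V : lmodType F)
    (a : int -> {linear V -> V}) (w : V) :
  (forall k l v, a k (a l v) + a l (a k v) = (k + l + b%:Z == 0)%:R *: v) ->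
  (forall k, 0 < k * 2 + b%:Z -> a k w = 0) ->
  forall k, 0 < k * 2 + b%:Z -> a k ((~~ b)%:R *: a 0 w) = 0.
Proof.
move=> car ann k k0; have := car k 0 w; rewrite (ann k k0) linear0 addr0 => E.
rewrite linearZ /= E; case bE: (~~ b); last by rewrite scale0r.
by rewrite (_ : _ == 0 = false) ?scale0r ?scaler0 //; lia.
Qed.

(** * The Fock module as a [fermiSpace], and its Virasoro operators *)

Section FockSpace.
Context (F : fieldType) (b : bool).
Local Notation V := (fock F b).
Local Notation a := (@fock_a F b).
Local Notation vac := (fock_vec F b).
Local Notation bz := (b%:Z).

(** The operators [- a k] satisfy the same relations as the [a k], so the universal property applies
    to them. *)
Lemma fock_twisted (w : V) : (forall k, 0 < k * 2 + bz -> a k w = 0) ->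
  exists f : {linear V -> V}, f vac = w /\ forall k v, f (a k v) = - a k (f v).
Proof.
move=> w0; have opL k : linear (fun v => - a k v).
  have R (A : {linear V -> V}) c u v : - A (c *: u + v) = c *: - A u + - A v.
    by rewrite linearP opprD scalerN.
  exact: (R (a k)).
have R (A : {linear V -> V}) u : - A (- u) = A u by rewrite linearN opprK.
apply: (@fock_univ F b V _ w opL) => [k l v|k k0].
  by rewrite [X in X + _](R (a k)) [X in _ + X](R (a l)); exact: fock_car.
by rewrite w0 // oppr0.
Qed.

Lemma fock_pi_exists :
  exists f : {linear V -> V}, f vac = vac /\ forall k v, f (a k v) = - a k (f v).
Proof. by apply: fock_twisted => k; exact: fock_a_vec. Qed.

Lemma fock_om_exists : exists f : {linear V -> V},
  f vac = (~~ b)%:R *: a 0 vac /\ forall k v, f (a k v) = - a k (f v).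
Proof.
apply: fock_twisted.
exact: (zero_mode_ann (a := fun k => a k) (@fock_car F b) (@fock_a_vec F b)).
Qed.

(** The universal property is applied to the functions from degrees to [V], on which the modes also
    shift the degree; the projections are the components of the resulting map. *)
Lemma fock_gr_exists : exists f : int -> {linear V -> V},
  (forall d, f d vac = (d == 0)%:R *: vac) /\
  forall d k v, f d (a k v) = a k (f (d + (k * 2 + bz)) v).
Proof.
have dE (d k l : int) : k + l + bz = 0 -> d + (k * 2 + bz) + (l * 2 + bz) = d.
  by lia.
pose op (k : int) (phi : int -> V) (d : int) := a k (phi (d + (k * 2 + bz))).
have opL k : linear (op k).
  by move=> c phi psi; apply: funext => d; exact: linearP.
have opC k l phi :
    op k (op l phi) + op l (op k phi) = (k + l + bz == 0)%:R *: phi.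
  apply: funext => d.
  rewrite -[LHS]/(a k (a l (phi (d + (k * 2 + bz) + (l * 2 + bz))))
    + a l (a k (phi (d + (l * 2 + bz) + (k * 2 + bz))))).
  rewrite -[RHS]/((k + l + bz == 0)%:R *: phi d).
  rewrite (addrAC d (l * 2 + bz)) fock_car.
  have [kl|] := eqVneq (k + l + bz) 0; last by rewrite !scale0r.
  by rewrite dE.
have [k k0|f [fv fa]] := @fock_univ F b _ op (fun d => (d == 0)%:R *: vac) opL opC.
  by apply: funext => d; rewrite /op linearZ /= fock_a_vec // scaler0.
have fL d : linear (fun v => f v d).
  by move=> c u v; rewrite linearP.
pose g d (v : V) : V := f v d.
pose gL d : {linear V -> V} :=
  HB.pack (g d) (GRing.isLinear.Build F V V *:%R (g d) (fL d)).
exists gL; split=> [d|d k v].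
  by rewrite -[LHS]/(f vac d) fv.
by rewrite -[LHS]/(f (a k v) d) fa.
Qed.

Definition fock_space (char_neq2 : 2%:R != 0 :> F) : fermiSpace F b :=
  @FermiSpace F b V (fun k => a k) vac
    (sval (cid fock_pi_exists)) (sval (cid fock_om_exists))
    (sval (cid fock_gr_exists))
    (@fock_car F b) (@fock_a_vec F b) (@fock_ind F b) (fock_vec_neq0 b char_neq2)
    (svalP (cid fock_pi_exists)).1 (svalP (cid fock_pi_exists)).2
    (svalP (cid fock_om_exists)).1 (svalP (cid fock_om_exists)).2
    (svalP (cid fock_gr_exists)).1 (svalP (cid fock_gr_exists)).2.

Lemma fock_act_normal_order i k (v : V) :
  fock_act (normal_order F b i k) v
  = if i <= k then a i (a k v) else - a k (a i v).
Proof.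
rewrite /normal_order fval_le; case: ifP => _; first exact: ind_actM.
exact: etrans (ind_actN _ _) (congr1 _ (ind_actM _ _ _)).
Qed.

Context (char_neq2 : 2%:R != 0 :> F).
Local Notation S := (fock_space char_neq2).

Lemma fock_L_vir_op n (v : V) : @fock_L F b n v = @vir_op F b S n v.
Proof.
rewrite /fock_L /vir_op; congr (_ + _).
  rewrite /vir_shift; case: ifP => _; last by rewrite mul0r scale0r.
  by rewrite mul1r.
(* In the encoding, [- bz - j] is the opposite of the index [j]. *)
rewrite -/(zsum _) (zsum_flip _ (- bz)).
have E j : fval b F (- bz - j)
      *: fock_act (normal_order F b (fopp b (- bz - j)) (n + (- bz - j))) v
    = 2%:R *: (@vir_coef F b j *: @nord F b S j (n - bz - j) v).
  rewrite (_ : fopp b (- bz - j) = j); last by rewrite /fopp; ring.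
  rewrite (_ : n + (- bz - j) = n - bz - j); last by ring.
  rewrite fock_act_normal_order scalerA.
  have -> : 2%:R * @vir_coef F b j = fval b F (- bz - j).
    rewrite /vir_coef mulrA mulrN mulfV // mulN1r /fval rmorphB rmorphN /=.
    by case: (b) => /=; field.
  set k := n - bz - j; rewrite /nord; case: ltgtP => [//|//|jk].
  (* On the diagonal [normal_order] gives the square of a mode and [nord] gives 0; the square
     vanishes except for the zero mode, whose coefficient is 0. *)
  have [j0|j0] := eqVneq (j * 2 + bz) 0.
    rewrite (_ : fval b F _ = 0) ?scale0r //.
    have -> : fval b F (- bz - j) = - ((j * 2 + bz)%:~R / 2%:R).
      by rewrite /fval !(rmorphB, rmorphN, rmorphD, rmorphM) /=; case: (b) => /=; field.
    by rewrite j0 mul0r oppr0.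
  by rewrite -jk; congr (_ *: _); exact: (@fs_sqr0 F b S j v char_neq2 j0).
rewrite (eq_zsum E).
have <- := @zsum_linear F V V (GRing.scale 2%:R) _ (@Phi_fins F b S (@vir_coef F b) n v).
by rewrite scalerA mulVf // scale1r.
Qed.

Lemma fock_parityE (s : bool) (v : V) : fock_parity F b s v <-> @parity F b S s v.
Proof. exact: (@monom_parityE F b S char_neq2 s v). Qed.

End FockSpace.

Lemma sum_narrow (V : nmodType) (f : nat -> V) (m n : nat) : (m <= n)%N ->
  \sum_(i < n) (if (i < m)%N then f i else 0) = \sum_(i < m) f i.
Proof. by move=> mn; rewrite -big_mkcond /= big_ord_narrow. Qed.

(** * Verma modules *)

Section HighestWeightSpan.
Context {F : fieldType} {M : lmodType F} (L : int -> {linear M -> M}) (vec : M).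
Context (h : F) (d : int -> F).
Hypothesis L_rel : forall m n v, L m (L n v) - L n (L m v)
  = (m - n)%:~R *: L (m + n) v + (d m *+ (m + n == 0)) *: v.
Hypothesis L0_vec : L 0 vec = h *: vec.
Hypothesis Lpos_vec : forall n, 0 < n -> L n vec = 0.

Definition hw_monom (s : seq nat) : M :=
  foldr (fun n v => L (- n%:Z) v) vec s.

Let pos (s : seq nat) := all (fun i => 0 < i)%N s.

Definition hw_deg (n : nat) : set M :=
  lspan [set m | exists s : seq nat,
    [/\ sorted geq s, pos s, sumn s = n & m = hw_monom s]]%classic.

(** [hw_deg] filtered by the number of factors, along which the sorting of monomials proceeds. *)
Let deg_below (k n : nat) : set M :=
  lspan [set m | exists s : seq nat,
    [/\ sorted geq s, pos s, sumn s = n, (size s <= k)%N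
      & m = hw_monom s]]%classic.

Let deg_belowW k l n v : (k <= l)%N -> deg_below k n v -> deg_below l n v.
Proof.
move=> kl; elim=> [|w [s [s1 s2 s3 s4 ->]]|c u w _ IHu _ IHw].
- exact: lspan_zero.
- by apply: lspan_gen; exists s; split=> //; exact: leq_trans kl.
- exact: lspan_lin.
Qed.

Let lspanD (A : set M) u v : lspan A u -> lspan A v -> lspan A (u + v).
Proof. by move=> Au Av; rewrite -[u]scale1r; exact: lspan_lin. Qed.

Let Lswap m n v : L m (L n v) = L n (L m v)
  + ((m - n)%:~R *: L (m + n) v + (d m *+ (m + n == 0)) *: v).
Proof. by rewrite -L_rel addrC subrK. Qed.

(* Moving L_{-a} to its place in a sorted monomial only creates shorter
   monomials. *)
Let insert_monom k a t : (0 < a)%N -> sorted geq t -> pos t -> (size t <= k)%N ->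
  exists t', [/\ sorted geq t', perm_eq t' (a :: t)
    & deg_below (size t) (a + sumn t) (L (- a%:Z) (hw_monom t) - hw_monom t')].
Proof.
elim: k a t => [|k IHk] a t a0 t1 t2 tk.
  case: t t1 t2 tk => // _ _ _; exists [:: a]; split=> //.
  by rewrite /= subrr; exact: lspan_zero.
have low b m n v : (0 < b)%N -> (m <= k)%N -> deg_below m n v ->
    deg_below m.+1 (b + n) (L (- b%:Z) v).
  move=> b0 mk; elim=> [|w [s [s1 s2 s3 s4 ->]]|c u w _ IHu _ IHw].
  - by rewrite linear0; exact: lspan_zero.
  - have [|t' [u1 u2 u3]] := IHk b s b0 s1 s2; first exact: leq_trans mk.
    rewrite -[L _ _](subrK (hw_monom t')) -s3; apply: lspanD.
      by apply: deg_belowW u3; exact: leqW.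
    apply: lspan_gen; exists t'; split=> //.
    + by rewrite /pos (perm_all _ u2) /= b0.
    + by rewrite (perm_sumn u2).
    + by rewrite (perm_size u2).
  - by rewrite linearP; exact: lspan_lin.
case: t t1 t2 tk => [|b u] t1 t2 tk.
  by exists [:: a]; split=> //; rewrite /= subrr; exact: lspan_zero.
have [ba|ab] := leqP b a.
  exists [:: a, b & u]; split=> //; first by rewrite /= ba.
  by rewrite subrr; exact: lspan_zero.
have [b0 u2] : (0 < b)%N /\ pos u by apply/andP.
have u1 : sorted geq u by exact: path_sorted t1.
have [t' [v1 v2 v3]] := IHk a u a0 u1 u2 tk.
exists (b :: t'); split.
- rewrite /= path_sortedE ?v1 ?andbT => [|x y z xy yz]; last exact: leq_trans yz xy.
  rewrite (perm_all _ v2) /= (ltnW ab) /=.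
  by move: t1; rewrite /= path_sortedE => [/andP[]//|x y z xy yz]; exact: leq_trans yz xy.
- rewrite -(perm_cons b) in v2; apply: perm_trans v2 _.
  by apply/permP => x /=; rewrite addnCA.
rewrite /= Lswap (_ : - a%:Z + - b%:Z == 0 = false); last by lia.
rewrite mulr0n scale0r addr0 addrAC -linearB /=.
have -> : (a + (b + sumn u) = b + (a + sumn u))%N by rewrite addnCA.
apply: lspanD; first exact: low.
apply: lspanZ; rewrite addnA (_ : - a%:Z + - b%:Z = - (b + a)%N%:Z); last by lia.
apply: low => //; first by lia.
by apply: lspan_gen; exists u; split.
Qed.

Lemma hw_monom_deg s : pos s -> hw_deg (sumn s) (hw_monom s).
Proof.
move=> s0; suff : deg_below (size s) (sumn s) (hw_monom s).
  elim=> [|w [t [t1 t2 t3 t4 ->]]|c u w _ IHu _ IHw].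
  - exact: lspan_zero.
  - by apply: lspan_gen; exists t.
  - exact: lspan_lin.
elim: s s0 => [|a s IHs] /=; first by move=> _; apply: lspan_gen; exists [::].
move=> /andP[a0 /IHs]; elim=> [|w [t [t1 t2 t3 t4 ->]]|c u w _ IHu _ IHw].
- by rewrite linear0; exact: lspan_zero.
- have [t' [u1 u2 u3]] := insert_monom a0 t1 t2 (leqnn _).
  rewrite -[L _ _](subrK (hw_monom t')) -t3; apply: lspanD.
    by apply: deg_belowW u3; exact: leqW.
  apply: lspan_gen; exists t'; split=> //.
  + by rewrite /pos (perm_all _ u2) /= a0.
  + by rewrite (perm_sumn u2).
  + by rewrite (perm_size u2).
- by rewrite linearP; exact: lspan_lin.
Qed.

(** Move [L k] to the right; each commutator acts on a shorter monomial, and the highest weight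
    vector absorbs what reaches it unless [k < 0]. *)
Lemma hw_monom_span s k :
  pos s -> lspan [set m | exists2 t, pos t & m = hw_monom t]%classic (L k (hw_monom s)).
Proof.
elim: s k => [|b s IHs] k /=.
  move=> _; have [k0|k0|->] := ltgtP k 0.
  - by apply: lspan_gen; exists [:: `|k|%N] => /=; [lia|congr (L _ _); lia].
  - by rewrite Lpos_vec //; exact: lspan_zero.
  - by rewrite L0_vec; apply/lspanZ/lspan_gen; exists [::].
move=> /andP[b0 s0].
have Lneg n v : (0 < n)%N ->
    lspan [set m | exists2 t, pos t & m = hw_monom t]%classic v ->
    lspan [set m | exists2 t, pos t & m = hw_monom t]%classic (L (- n%:Z) v).
  move=> n0; elim=> [|w [t t0 ->]|c u w _ IHu _ IHw].
  - by rewrite linear0; exact: lspan_zero.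
  - by apply: lspan_gen; exists (n :: t) => //=; rewrite n0.
  - by rewrite linearP; exact: lspan_lin.
rewrite Lswap; apply: lspanD; first by apply: Lneg => //; exact: IHs.
apply: lspan_lin; first exact: IHs.
by apply/lspanZ/lspan_gen; exists s.
Qed.

Hypothesis L_ind : forall P : M -> Prop,
  P 0 -> (forall (c : F) u v, P u -> P v -> P (c *: u + v)) ->
  P vec -> (forall k u, P u -> P (L k u)) -> forall u, P u.

Lemma hw_decomp u : exists N (f : nat -> M),
  (forall n, hw_deg n (f n)) /\ u = \sum_(n < N) f n.
Proof.
have Uu : lspan [set m | exists2 t, pos t & m = hw_monom t]%classic u.
  move: u; apply: L_ind.
  - exact: lspan_zero.
  - by move=> c u v; exact: lspan_lin.
  - by apply: lspan_gen; exists [::].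
  - move=> k u; elim=> [|w [t t0 ->]|c v w _ IHu _ IHw].
    + by rewrite linear0; exact: lspan_zero.
    + exact: hw_monom_span.
    + by rewrite linearP; exact: lspan_lin.
elim: Uu => [|w [t t0 ->]|c v w _ [N [f [fd ->]]] _ [N' [f' [fd' ->]]]].
- by exists 0%N, (fun=> 0); rewrite big_ord0; split=> // n; exact: lspan_zero.
- exists (sumn t).+1, (fun n => if n == sumn t then hw_monom t else 0); split.
    by move=> n; case: eqP => [->|_]; [exact: hw_monom_deg|exact: lspan_zero].
  rewrite big_ord_recr /= eqxx big1 ?add0r // => i _.
  by rewrite ltn_eqF.
- exists (maxn N N'), (fun n => c *: (if (n < N)%N then f n else 0)
    + if (n < N')%N then f' n else 0); split.
    by move=> n; apply: lspan_lin; case: ifP => _;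
      do ?[exact: fd|exact: fd'|exact: lspan_zero].
  by rewrite big_split /= -scaler_sumr !sum_narrow ?leq_maxl ?leq_maxr.
Qed.

End HighestWeightSpan.

(** * Modules induced from the enveloping algebra *)

Section EnvelopingAction.
Context {F : fieldType} (L : lieAlgType F) (G : set (env L * F)).
Implicit Types (x y : L) (m : ind_mod G).

Let act x m : ind_mod G := ind_act (env_in x) m.

Lemma env_in_linear (c : F) x y : env_in (c *: x + y) = c *: env_in x + env_in y.
Proof.
rewrite /env_in -(linearP (api (@env_rel F L))); apply/lpiP; apply: lspan_gen.
exists aone, (fgen F (c *: x + y) - (c *: fgen F x + fgen F y)), aone.
by split; [left; exists c, x, y|rewrite amul1r amulr1].
Qed.

Lemma env_in_lie x y :
  env_in x ** env_in y = env_in (lie x y) + env_in y ** env_in x.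
Proof.
rewrite /env_in -!apiM -(linearD (api (@env_rel F L))); apply/lpiP.
apply: lspan_gen.
exists aone, (fgen F x ** fgen F y - fgen F y ** fgen F x - fgen F (lie x y)), aone.
split; first by right; exists x, y.
by rewrite amul1r amulr1 opprD addrCA addrC.
Qed.

Lemma env_act_linear (c : F) x y m :
  ind_act (env_in (c *: x + y)) m = c *: ind_act (env_in x) m + ind_act (env_in y) m.
Proof. by rewrite env_in_linear ind_actDZ. Qed.

Lemma env_act_lie x y m : ind_act (env_in x) (ind_act (env_in y) m)
  = ind_act (env_in (lie x y)) m + ind_act (env_in y) (ind_act (env_in x) m).
Proof.
rewrite -!ind_actM env_in_lie -[env_in (lie x y)]scale1r ind_actDZ.
by rewrite !scale1r.
Qed.

Context (W : lmodType F) (op : L -> W -> W) (w0 : W).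
Hypothesis op_linearl : forall (c : F) x y w,
  op (c *: x + y) w = c *: op x w + op y w.
Hypothesis op_linear : forall x, linear (op x).
Hypothesis op_lie : forall x y w,
  op (lie x y) w = op x (op y w) - op y (op x w).
Hypothesis op_char : forall q l, G (q, l) ->
  exists2 x, q = env_in x & op x w0 = l *: w0.

Lemma env_univ : exists f : {linear ind_mod G -> W},
  f (ind_vec G) = w0 /\ forall x m, f (ind_act (env_in x) m) = op x (f m).
Proof.
apply: (@ind_mod_univ F L (@env_rel F L) G W op w0 op_linear) => [r w|q l Gq].
  have Lact (c : F) (y z : freealg F L) :
      free_act op (c *: y + z) w = c *: free_act op y w + free_act op z w.
    exact: free_act_linearl.
  case=> [[c [x [y ->]]]|[x [y ->]]].
    have -> : fgen F (c *: x + y) - (c *: fgen F x + fgen F y)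
      = (-1) *: (c *: fgen F x + fgen F y) + fgen F (c *: x + y).
      by rewrite scaleN1r addrC.
    rewrite !Lact !free_act_gen op_linearl.
    by rewrite scaleN1r addNr.
  have E (u v : L) : free_act op (fgen F u ** fgen F v) w = op u (op v w).
    by rewrite (free_actM op_linear) (free_act_gen op v) (free_act_gen op u).
  have -> : fgen F x ** fgen F y - fgen F y ** fgen F x - fgen F (lie x y)
    = (-1) *: fgen F (lie x y)
      + ((-1) *: (fgen F y ** fgen F x) + fgen F x ** fgen F y).
    by rewrite !scaleN1r addrC [X in _ + X]addrC.
  transitivity (-1 *: op (lie x y) w + (-1 *: op y (op x w) + op x (op y w))).
    apply: etrans (Lact _ _ _) _; congr (_ *: _ + _); first exact: free_act_gen.
    apply: etrans (Lact _ _ _) _; congr (_ *: _ + _); exact: E.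
  by rewrite op_lie !scaleN1r opprB [- op y _ + _]addrC addrA subrK subrr.
have [x -> xw] := op_char Gq; exists (fgen F x) => //.
by rewrite free_act_gen.
Qed.

End EnvelopingAction.

Section VermaTheory.
Context {F : fieldType} (c h : F).
Local Notation V := (verma c h).
Local Notation act := (@verma_act F c h).
Local Notation vec := (verma_vec c h).

Lemma verma_act_linearl (k : F) x y (m : V) :
  act (k *: x + y) m = k *: act x m + act y m.
Proof. exact: env_act_linear. Qed.

Lemma verma_act_linear x : linear (act x).
Proof. by move=> k u v; exact: ind_act_linear. Qed.

HB.instance Definition _ x := GRing.isLinear.Build F V V *:%R (act x)
  (verma_act_linear x).

Lemma verma_actr0 x : act x 0 = 0.
Proof. exact: (linear0 (act x)). Qed.

Lemma verma_actZr x (k : F) m : act x (k *: m) = k *: act x m.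
Proof. exact: (linearZZ (act x)). Qed.

Lemma verma_act_lie x y (m : V) :
  act x (act y m) = act (lie x y) m + act y (act x m).
Proof. exact: env_act_lie. Qed.

Lemma verma_act0 (m : V) : act 0 m = 0.
Proof.
have := verma_act_linearl (-1) 0 0 m; rewrite scaler0 addr0 scaleN1r addNr.
by [].
Qed.

Lemma verma_actZ (k : F) x (m : V) : act (k *: x) m = k *: act x m.
Proof. by rewrite -[k *: x]addr0 verma_act_linearl verma_act0 addr0. Qed.

Lemma verma_act_char x (l : F) : verma_char c h (env_in x, l) -> act x vec = l *: vec.
Proof.
move=> xl; rewrite /verma_act /verma_vec /ind_vec ind_actE.
rewrite -(linearZZ (lpi (tensor_rel (verma_char c h)))); apply/lpiP.
apply: lspan_gen; exists aone, (env_in x), l; split; first exact: acts_gen.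
by rewrite amul1r amulr1.
Qed.

Lemma verma_ind (P : V -> Prop) :
  P 0 -> (forall (k : F) u v, P u -> P v -> P (k *: u + v)) ->
  P vec -> (forall x u, P u -> P (act x u)) -> forall u, P u.
Proof. exact: ind_mod_ind. Qed.

Lemma verma_actC (m : V) : act (virC F) m = c *: m.
Proof.
elim/verma_ind: m => [|k u v IHu IHv||x u IHu].
- by rewrite (linear0 (act (virC F))) scaler0.
- rewrite (verma_act_linear (virC F) k u v).
  by rewrite IHu IHv scalerDr !scalerA [k * c]mulrC.
- by apply: (@verma_act_char (virC F) c); constructor 1.
- have E1 : act (lie (virC F) x) u = 0.
    by rewrite [lie _ _]vir_bracketCl; exact: verma_act0.
  have E2 : act x (act (virC F) u) = c *: act x u.
    by rewrite IHu; exact: (linearZZ (act x)).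
  exact: etrans (verma_act_lie _ _ _) (etrans (f_equal2 +%R E1 E2) (add0r _)).
Qed.

Lemma verma_act_ind (P : V -> Prop) :
  P 0 -> (forall (k : F) u v, P u -> P v -> P (k *: u + v)) ->
  P vec -> (forall n u, P u -> P (act (virL F n) u)) -> forall u, P u.
Proof.
move=> P0 Pl Pv PL; have [PD PZ PN PB] := linear_closed0 P0 Pl.
apply: verma_ind => // x u Pu; elim/vir_ind: x => [|k x y Px Py|[n|]].
- by rewrite verma_act0.
- by rewrite verma_act_linearl; exact: Pl.
- exact: PL.
- by rewrite verma_actC; exact: PZ.
Qed.

Lemma verma_decomp u : exists N (f : nat -> V),
  (forall n, verma_deg n (f n)) /\ u = \sum_(n < N) f n.
Proof.
pose L n : {linear V -> V} := act (virL F n).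
apply: (@hw_decomp F V L vec h (fun m => vir_cocycle F m * c)).
- move=> m n v; apply/eqP; rewrite subr_eq; apply/eqP.
  rewrite {1}/L /= verma_act_lie; congr (_ + _).
  rewrite -[lie _ _]/(vir_bracket _ _) vir_bracketU.
  apply: etrans (verma_act_linearl _ _ _ _) _; congr (_ *: _ + _).
  apply: etrans (verma_actZ _ _ _) _.
  by rewrite verma_actC scalerA mulrnAl.
- by apply: (@verma_act_char (virL F 0) h); constructor 2.
- move=> n n0; rewrite -[RHS](scale0r vec).
  by apply: (@verma_act_char (virL F n) 0); constructor 3; exists n.
- exact: verma_act_ind.
Qed.

End VermaTheory.

(** * The kernel of a map onto an irreducible graded module *)

Section IrreducibleQuotient.
Context {F : fieldType} {c h : F} {W : lmodType F}.
Context (f : {linear verma c h -> W}) (act : vir F -> W -> W).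
Context (gr : int -> {linear W -> W}) (d0 : int) (S : set W).
Local Notation V := (verma c h).
Local Notation vec := (verma_vec c h).
Hypothesis f_act : forall x m, f (verma_act x m) = act x (f m).
Hypothesis gr_vec : forall d, gr d (f vec) = (d == d0)%:R *: f vec.
Hypothesis gr_act : forall d n w,
  gr d (act (virL F n) w) = act (virL F n) (gr (d + n * 2) w).
Hypothesis f_vec : f vec != 0.
Hypothesis f_S : forall m, S (f m).
Hypothesis S_irr : forall M : W -> Prop, M 0 ->
  (forall (k : F) u v, M u -> M v -> M (k *: u + v)) ->
  (forall x u, M u -> M (act x u)) -> (forall u, M u -> S u) ->
  (exists2 u, M u & u != 0) -> forall v, S v -> M v.

Let ker : set V := [set m | f m = 0]%classic.

Let act_scale x (k : F) m : act x (k *: f m) = k *: act x (f m).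
Proof.
rewrite -(linearZZ f) -!f_act -(linearZZ f); congr (f _).
exact: verma_actZr.
Qed.

Let gr_monom d s :
  gr d (f (verma_monom c h s)) = (d == d0 + (sumn s)%:Z * 2)%:R *: f (verma_monom c h s).
Proof.
elim: s d => [|n s IHs] d /=; first by rewrite addr0 gr_vec.
rewrite f_act gr_act IHs act_scale; congr (_ *: _).
by congr (_%:R); congr nat_of_bool; apply/eqP/eqP; lia.
Qed.

Let gr_deg d n u : verma_deg n u -> gr d (f u) = (d == d0 + n%:Z * 2)%:R *: f u.
Proof.
elim=> [|_ [s [_ _ <- ->]]|k v w _ IHv _ IHw].
  by rewrite (linear0 f) (linear0 (gr d)) scaler0.
  exact: gr_monom.
by rewrite (linearP f) (linearP (gr d)) IHv IHw scalerDr !scalerA [k * _]mulrC.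
Qed.

Let f_deg0 u : verma_deg 0 u -> exists k, u = k *: vec.
Proof.
elim=> [|_ [s [_ s2 s3 ->]]|k v w _ [kv ->] _ [kw ->]].
- by exists 0; rewrite scale0r.
- exists 1; rewrite scale1r; case: s s2 s3 => //= n s /andP[n0 _]; lia.
- by exists (k * kv + kw); rewrite scalerDl scalerA.
Qed.

(** The projections on the target separate the images of the homogeneous components; this makes the
    kernel graded. *)
Let gr_sum n N (g : nat -> V) : (forall i, verma_deg i (g i)) ->
  gr (d0 + n%:Z * 2) (f (\sum_(i < N) g i)) = if (n < N)%N then f (g n) else 0.
Proof.
move=> gd; rewrite !linear_sum /=.
have E (i : 'I_N) : gr (d0 + n%:Z * 2) (f (g i)) = if n == i then f (g i) else 0.
  rewrite (gr_deg _ (gd i)) (_ : (_ == _) = (n == i)); last by apply/eqP/eqP; lia.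
  by case: eqP => _; rewrite ?scale1r ?scale0r.
rewrite (eq_bigr _ (fun i _ => E i)); case: ltnP => nN.
  rewrite (bigD1 (Ordinal nN)) //= eqxx big1 ?addr0 // => i ni.
  by rewrite ifN //; apply: contraNneq ni => ni; apply/eqP/val_inj.
by rewrite big1 // => i _; rewrite ifN // gtn_eqF // (leq_trans (ltn_ord i)).
Qed.

Let submod_full (U : set V) : verma_submod U -> U vec -> U = setT.
Proof.
move=> [U0 Ul Ua] Uv; rewrite predeqE => u; split=> // _.
exact: verma_ind.
Qed.

Let ker_submod : verma_submod ker.
Proof.
split; rewrite /ker /=; first exact: linear0.
- by move=> k u v; rewrite linearP => -> ->; rewrite scaler0 addr0.
- move=> x u fu; rewrite f_act fu -(linear0 f) -f_act.
  by rewrite verma_actr0 linear0.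
Qed.

Let ker_graded : verma_graded ker.
Proof.
move=> u; rewrite /ker /= => fu; have [N [g [gd uE]]] := verma_decomp u.
exists N, (fun n => if (n < N)%N then g n else 0); split; last first.
  by rewrite uE; apply: eq_bigr => i _; rewrite ltn_ord.
move=> n; have := gr_sum n N gd; rewrite -uE fu linear0.
by case: ifP => _ fgn; [split|split; [exact: linear0|exact: lspan_zero]].
Qed.

Let ker_neqT : ker <> setT.
Proof.
move=> kT; have : ker vec by rewrite kT.
by move/eqP; rewrite (negPf f_vec).
Qed.

(** A vector of [U] outside the kernel gives [U] a nonzero image, which by irreducibility contains
    [f vec]; then [vec] lies in [U], and [U] is everything. *)
Let proper_sub_ker U : proper_graded_submod U -> (ker `<=` U)%classic -> U = ker.
Proof.
move=> [[U0 Ul Ua] Ug UT] kU; apply/seteqP; split=> // u Uu.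
apply: contrapT => /eqP fu.
pose M w := exists2 m, U m & w = f m.
have : M (f vec).
  apply: S_irr => //.
  - by exists 0; rewrite ?linear0.
  - move=> k _ _ [v Uv ->] [w Uw ->]; exists (k *: v + w); rewrite ?linearP //.
    exact: Ul.
  - by move=> x _ [v Uv ->]; exists (verma_act x v); [exact: Ua|rewrite f_act].
  - by move=> _ [v _ ->].
  - by exists (f u) => //; exists u.
move=> [m Um fm]; apply: UT; apply: submod_full => //.
rewrite -[vec](subrK m) -[vec - m]scale1r; apply: Ul => //; apply: kU.
by rewrite /ker /= linearB fm subrr.
Qed.

(** [U + ker] is again graded and proper, so by maximality it equals [U], and [proper_sub_ker]
    identifies it with the kernel. *)
Let maximal_ker U : maximal_graded_submod U -> U = ker.
Proof.
move=> [[[U0 Ul Ua] Ug UT] Umax].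
pose U' : set V := [set m | exists u k, [/\ U u, ker k & m = u + k]]%classic.
have [K0 Kl Ka] := ker_submod.
have UU' : (U `<=` U')%classic by move=> u Uu; exists u, 0; rewrite addr0.
suff pU' : proper_graded_submod U'.
  have kU' : (ker `<=` U')%classic by move=> k kk; exists 0, k; rewrite add0r.
  by rewrite -(proper_sub_ker pU' kU'); apply/esym/Umax.
split.
- split; first exact: UU'.
  + move=> k _ _ [u [l [Uu kl ->]]] [v [m [Uv km ->]]].
    exists (k *: u + v), (k *: l + m); split; [exact: Ul|exact: Kl|].
    by rewrite scalerDr addrACA.
  + move=> x _ [u [k [Uu kk ->]]]; exists (verma_act x u), (verma_act x k).
    by split; [exact: Ua|exact: Ka|exact: linearD].
- move=> _ [u [k [Uu kk ->]]].
  have [N [g [gd ->]]] := Ug _ Uu; have [K [l [ld ->]]] := ker_graded kk.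
  exists (maxn N K), (fun n => (if (n < N)%N then g n else 0)
    + if (n < K)%N then l n else 0); split; last first.
    by rewrite big_split /= !sum_narrow ?leq_maxl ?leq_maxr.
  move=> n; split.
    exists (if (n < N)%N then g n else 0), (if (n < K)%N then l n else 0).
    split=> //; first by case: ifP => _ //; case: (gd n).
    by case: ifP => _ //; case: (ld n).
  rewrite -[X in X + _]scale1r; apply: lspan_lin.
    by case: ifP => _; [case: (gd n)|exact: lspan_zero].
  by case: ifP => _; [case: (ld n)|exact: lspan_zero].
- move=> U'T; have : U' vec by rewrite U'T.
  move=> [u [k [Uu kk vE]]].
  have [N [g [gd uE]]] := Ug _ Uu.
  have fvec : f vec = f u by rewrite vE linearD kk addr0.
  have := gr_sum 0 N (fun i => (gd i).2).
  rewrite -uE -fvec gr_vec addr0 eqxx scale1r.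
  case: ifP => N0 E; last by move: f_vec; rewrite E eqxx.
  (* As [U] is graded it contains the component of degree 0 of [u], which is [m] times [vec];
     comparing images gives [m = 1]. *)
  have [Ug0 /f_deg0[m gE]] := gd 0%N.
  apply: UT; apply: submod_full => //.
  suff m1 : m = 1 by rewrite -[vec]scale1r -m1 -gE.
  move: E; rewrite gE linearZ /= => /eqP; rewrite -subr_eq0 -{1}[f vec]scale1r.
  rewrite -scalerBl scaler_eq0 (negPf f_vec) orbF subr_eq0 => /eqP.
  by move=> <-.
Qed.

Lemma verma_max_ker : @verma_max F c h = ker.
Proof.
rewrite /verma_max; case: xgetP => [U _ /maximal_ker //|nomax].
case: (nomax ker); split=> [|U pU kU].
  by split; [exact: ker_submod|exact: ker_graded|exact: ker_neqT].
exact: proper_sub_ker.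
Qed.

Let lspan_max u : lspan (@verma_max F c h) u -> f u = 0.
Proof.
rewrite verma_max_ker; elim=> [|//|k v w _ fv _ fw]; first exact: linear0.
by rewrite linearP fv fw scaler0 addr0.
Qed.

(** [f] factors injectively through the quotient by its kernel [verma_max]; its image is a nonzero
    submodule of [S], hence all of [S]. *)
Lemma irr_mod_isomorphic : vir_isomorphic (irr_act c h) act S.
Proof.
pose g (q : irr_mod c h) := f (repr q).
have gE m : g (lpi (@verma_max F c h) m) = f m.
  apply/eqP; rewrite -subr_eq0 -linearB; apply/eqP/lspan_max/lpi_repr.
have gl : linear g.
  move=> k p q; rewrite -[p]lpiK -[q]lpiK -(linearP (lpi (@verma_max F c h))).
  by rewrite !gE linearP.
pose G : {linear irr_mod c h -> W} :=
  HB.pack g (GRing.isLinear.Build F (irr_mod c h) W *:%R g gl).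
exists G; split.
- move=> p q; rewrite -[p]lpiK -[q]lpiK -[G _]/(g _) -[RHS]/(g _) !gE => E.
  have maxP m : f m = 0 -> @verma_max F c h m by rewrite verma_max_ker.
  by apply/lpiP/lspan_gen/maxP; rewrite linearB E subrr.
- apply/seteqP; split=> [_ [q _ <-]|v Sv]; first exact: f_S.
  have [|||||m _ ->] := S_irr (M := fun w => exists2 m, True & w = f m) _ _ _ _ _ Sv.
  + by exists 0; rewrite ?linear0.
  + by move=> k _ _ [u _ ->] [w _ ->]; exists (k *: u + w); rewrite ?linearP.
  + by move=> x _ [u _ ->]; exists (verma_act x u); rewrite ?f_act.
  + by move=> _ [u _ ->]; exact: f_S.
  + by exists (f vec) => //; exists vec.
  by exists (lpi (@verma_max F c h) m) => //; exact: gE.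
- move=> x q; rewrite -[q]lpiK irr_actE -[LHS]/(g _) -[G _]/(g _) !gE.
  exact: f_act.
Qed.

End IrreducibleQuotient.

(** * The parity components as irreducible highest weight modules *)

Section VirasoroAction.
Context {F : fieldType} {b : bool} (S : fermiSpace F b).
Context (char_neq2 : 2%N \notin [pchar F]) (char_neq7 : 7%N \notin [pchar F]).
Local Notation V := (fs_sort S).
Local Notation a := (fs_a S).
Local Notation vac := (fs_vac S).
Local Notation pi := (fs_pi S).
Local Notation bz := (b%:Z).
Implicit Types (v : V).

Let n2 : 2%:R != 0 :> F.
Proof. by move: char_neq2; rewrite inE /=. Qed.

Definition vir_act (x : vir F) v : V :=
  lin_ext (fun k => if k is Some n then vir_op n v else 2%:R^-1 *: v) x.

Lemma vir_act_linearl (k : F) x y v :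
  vir_act (k *: x + y) v = k *: vir_act x v + vir_act y v.
Proof. exact: linearP. Qed.

Lemma vir_act0 v : vir_act 0 v = 0.
Proof. exact: linear0. Qed.

Lemma vir_actL n v : vir_act (virL F n) v = vir_op n v.
Proof. by rewrite /vir_act lin_extU. Qed.

Lemma vir_actC v : vir_act (virC F) v = 2%:R^-1 *: v.
Proof. by rewrite /vir_act lin_extU. Qed.

Lemma vir_act_linear x : linear (vir_act x).
Proof.
move=> k u v; elim/vir_ind: x => [|l x y IHx IHy|[n|]].
- by rewrite !vir_act0 scaler0 addr0.
- rewrite !vir_act_linearl IHx IHy !scalerDr !scalerA [k * l]mulrC.
  by rewrite addrACA.
- by rewrite -/(virL F n) !vir_actL; exact: vir_op_linear.
- by rewrite -/(virC F) !vir_actC scalerDr !scalerA mulrC.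
Qed.

HB.instance Definition _ x := GRing.isLinear.Build F V V *:%R (vir_act x)
  (vir_act_linear x).

Lemma vir_act_lie x y v : vir_act (lie x y) v
  = vir_act x (vir_act y v) - vir_act y (vir_act x v).
Proof.
have lin (A B C D : V) (k : F) :
    k *: (A - B) + (C - D) = (k *: A + C) - (k *: B + D).
  by rewrite scalerBr opprD addrACA.
elim/vir_ind: x => [|k x x' IHx IHx'|i].
- by rewrite -[lie 0 y]/(vir_bracket 0 y) vir_bracket0l !vir_act0 linear0 subrr.
- by rewrite lie_linearl !vir_act_linearl IHx IHx' linearP lin.
elim/vir_ind: y => [|k y y' IHy IHy'|j].
- rewrite -[lie _ 0]/(vir_bracket << i >> 0) vir_bracket0r !vir_act0 linear0.
  by rewrite subrr.
- by rewrite lie_linearr !vir_act_linearl IHy IHy' linearP lin.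
rewrite -[lie _ _]/(vir_bracket _ _) vir_bracketU.
case: i j => [m|] [n|] /=; rewrite -?/(virL F _) -?/(virC F) ?vir_act0 ?vir_actC.
- rewrite !vir_actL (vir_op_rel n2) vir_act_linearl vir_actL; congr (_ + _).
  rewrite -[_ *: virC F]addr0 vir_act_linearl vir_act0 addr0 vir_actC scalerA.
  by rewrite mulrC.
- by rewrite linearZ subrr.
- by rewrite linearZ subrr.
- by rewrite subrr.
Qed.

(** [- bz] encodes the index -1/2 or 0, so the odd vector is [a(-1/2) vac] or [a(0) vac]. *)
Definition hw_vec (s : bool) : V := if s then a (- bz) vac else vac.

Definition hw_weight (s : bool) : F :=
  if b then (if s then 2%:R^-1 else 0) else 16%:R^-1.

Lemma hw_vec_parity s : parity s (hw_vec s).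
Proof. by case: s; [apply: (@parity_a _ _ _ false)|]; exact: parity_vac. Qed.

Lemma hw_vec_neq0 s : hw_vec s != 0.
Proof.
case: s; last exact: fs_vac_neq0.
apply/eqP => /= x0; have := @fs_car _ _ S 0 (- bz) vac.
rewrite x0 linear0 add0r add0r addNr eqxx scale1r.
case bE: (~~ b); last first.
  rewrite fs_a_vac; last by lia.
  by rewrite linear0 => /esym/eqP; rewrite (negPf (fs_vac_neq0 S)).
have b0 : - bz = 0 by lia.
by rewrite -{1}b0 x0 linear0 => /esym/eqP; rewrite (negPf (fs_vac_neq0 S)).
Qed.

Lemma vir_op_hw_vec n s : 0 <= n ->
  vir_op n (hw_vec s) = (if n == 0 then hw_weight s else 0) *: hw_vec s.
Proof.
move=> n0.
have shiftE : @vir_shift F b n = if n == 0 then hw_weight false else 0.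
  rewrite /vir_shift /hw_weight; case: (n == 0); rewrite ?andbF ?andbT ?mul0r //.
  by case: b; rewrite ?mul0r ?mul1r.
case: s => /=; last by rewrite vir_op_vac // shiftE.
rewrite vir_op_a // vir_op_vac // linearZ /= shiftE.
have [->|nn0] := eqVneq n 0.
  rewrite (_ : 0 + - bz * 2 + bz = - bz); last by lia.
  rewrite add0r -scalerDl; congr (_ *: _); rewrite /hw_weight rmorphN mulrNN.
  by case: b => /=; rewrite ?mulr0 ?addr0 ?mulr1 ?add0r.
rewrite !scale0r add0r fs_a_vac ?scaler0 //; lia.
Qed.

Lemma gr_hw_vec d s : fs_gr S d (hw_vec s) = (d == (s && b)%:Z)%:R *: hw_vec s.
Proof.
case: s => /=; last exact: fs_gr_vac.
rewrite fs_gr_a fs_gr_vac linearZ /=; congr (_%:R *: _); congr nat_of_bool.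
by apply/eqP/eqP; lia.
Qed.

(** [env_univ] maps the Verma module to the Fock space by sending its generator to [hw_vec s];
    [fermi_irr] gives the irreducibility that [irr_mod_isomorphic] asks for. *)
Lemma irr_mod_parity s :
  vir_isomorphic (irr_act (2%:R^-1 : F) (hw_weight s)) vir_act (parity (S := S) s).
Proof.
have [|f [f_vec f_act]] := @env_univ F (vir F) (verma_char 2%:R^-1 (hw_weight s))
    V vir_act (hw_vec s) vir_act_linearl vir_act_linear vir_act_lie.
  move=> q l [[-> ->]|[-> ->]|[n n0 [-> ->]]].
  - by exists (virC F) => //; exact: vir_actC.
  - by exists (virL F 0) => //; rewrite vir_actL vir_op_hw_vec // eqxx.
  - exists (virL F n) => //; rewrite vir_actL vir_op_hw_vec ?ltW //.
    by rewrite gt_eqF.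
have par x v : parity s v -> parity s (vir_act x v).
  move=> pv; elim/vir_ind: x => [|k x y px py|[n|]].
  - by rewrite vir_act0; exact: parity0.
  - by rewrite vir_act_linearl; exact: parity_lin.
  - rewrite -/(virL F n) vir_actL /parity (vir_op_even S n).1 pv.
    exact: (linearZZ (vir_op n)).
  - rewrite -/(virC F) vir_actC -[_ *: v]addr0.
    by apply: parity_lin => //; exact: parity0.
apply: (@irr_mod_isomorphic F 2%:R^-1 (hw_weight s) V f vir_act (fs_gr S)
  (s && b)%:Z) => //.
- by move=> d; rewrite f_vec gr_hw_vec.
- by move=> d n w; rewrite !vir_actL gr_vir_op.
- by rewrite f_vec hw_vec_neq0.
- apply: verma_ind.
  + by rewrite linear0; exact: parity0.
  + by move=> k u v pu pv; rewrite linearP; exact: parity_lin.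
  + by rewrite f_vec; exact: hw_vec_parity.
  + by move=> x u pu; rewrite f_act; exact: par.
- move=> M M0 Ml M_act M_par [u Mu u0] v.
  apply: (fermi_irr char_neq2 char_neq7 M0 Ml _ M_par Mu u0).
  by move=> n w Mw; rewrite -vir_actL; exact: M_act.
Qed.

End VirasoroAction.

Lemma fock_irr_mod (F : fieldType) (b s : bool) :
  2%N \notin [pchar F] -> 7%N \notin [pchar F] ->
  vir_isomorphic (irr_act (2%:R^-1 : F) (@hw_weight F b s))
    (fock_vir F b) (fock_parity F b s).
Proof.
move=> char_neq2 char_neq7; have n2 : 2%:R != 0 :> F by move: char_neq2; rewrite inE.
have actE : @vir_act F b (fock_space b n2) = fock_vir F b.
  apply: funext => x; apply: funext => v; rewrite /fock_vir /vir_act.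
  congr (lin_ext _ x); apply: funext => -[n|//]; exact/esym/fock_L_vir_op.
have parE : fock_parity F b s = @parity F b (fock_space b n2) s.
  rewrite predeqE; exact: (fock_parityE n2 s).
rewrite -actE parE.
exact: (@irr_mod_parity F b (fock_space b n2) char_neq2 char_neq7 s).
Qed.

Theorem theorem4p3 (F : fieldType) (char_neq2 : 2%N \notin [pchar F])
    (char_neq7 : 7%N \notin [pchar F]) :
  [/\ vir_isomorphic (irr_act (2%:R^-1 : F) 0)
        (fock_vir F true) (fock_parity F true false),
      vir_isomorphic (irr_act (2%:R^-1 : F) 2%:R^-1)
        (fock_vir F true) (fock_parity F true true)
    & forall s : bool, vir_isomorphic (irr_act (2%:R^-1 : F) 16%:R^-1)
        (fock_vir F false) (fock_parity F false s)].
Proof.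
split; last by move=> s; exact: (fock_irr_mod false s char_neq2 char_neq7).
- exact: (fock_irr_mod true false char_neq2 char_neq7).
- exact: (fock_irr_mod true true char_neq2 char_neq7).
Qed.
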